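(* Let $\Omega\subset\mathbb{H}^N$ be a bounded smooth domain, $0<s<1<p<Q$ with $Q=2N+2$, $p^*=\frac{Qp}{Q-p}$, and $\alpha>0$. Let $f\in L^m(\Omega)\setminus\{0\}$ be nonnegative, and let $u=\lim_{n\to\infty}u_n$ be the weak solution of $$-\Delta_{H,p}u+\alpha(-\Delta_{H,p})^s u=f(x)u^{-1}\ \text{in }\Omega,\qquad u>0\ \text{in }\Omega,\qquad u=0\ \text{in }\mathbb{H}^N\setminus\Omega$$ obtained as the pointwise limit of the approximate solutions $u_n$ described in the context. Then: (i) if $m\in(1,Q/p)$, then $u\in L^t(\Omega)$, where $t=p^*\gamma$ and $\gamma=\frac{pm'}{pm'-p^*}$; (ii) if $m>\frac{Q}{p}$, then $u\in L^\infty(\Omega)$.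
   Context: Heisenberg group. $N\ge1$ is an integer; $\mathbb{H}^N$ is $\mathbb{R}^{2N+1}$ with group law $\xi\circ\eta=(x_1+y_1,\dots,x_{2N}+y_{2N},\tau+\tau'+\frac12\sum_{i=1}^N(x_iy_{N+i}-x_{N+i}y_i))$ for $\xi=(x_1,\dots,x_{2N},\tau)$, $\eta=(y_1,\dots,y_{2N},\tau')$. Horizontal vector fields: $X_i=\partial_{x_i}-\frac{x_{N+i}}2\partial_\tau$, $X_{N+i}=\partial_{x_{N+i}}+\frac{x_i}2\partial_\tau$, $1\le i\le N$; $\nabla_Hu=(X_1u,\dots,X_{2N}u)$ (weak sense). $|\xi|=((\sum_{i=1}^{2N}x_i^2)^2+\tau^2)^{1/4}$. Measure is Lebesgue measure on $\mathbb{R}^{2N+1}$. For $l>1$, $l'=\frac{l}{l-1}$. Function spaces. $HW^{1,p}(\Omega)=\{u\in L^p(\Omega):\nabla_Hu\in L^p(\Omega)\}$; $HW^{1,p}_{\mathrm{loc}}(\Omega)$ is the set of $u$ with $u\in HW^{1,p}(\Omega')$ for every open $\Omega'\Subset\Omega$; $HW^{1,p}_0(\Omega)=\{u\in HW^{1,p}(\mathbb{H}^N):u=0\text{ in }\mathbb{H}^N\setminus\Omega\}$. $J_p(t)=|t|^{p-2}t$ and $d\mu=\frac{dx\,dy}{|y^{-1}\circ x|^{Q+sp}}$. Operators. $\Delta_{H,p}u=\operatorname{div}(|\nabla_Hu|^{p-2}\nabla_Hu)$ (horizontal divergence), $(-\Delta_{H,p})^su(x)=\mathrm{P.V.}\int_{\mathbb{H}^N}\frac{J_p(u(x)-u(y))}{|y^{-1}\circ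 x|^{Q+sp}}\,dy$; both are understood through weak formulations. Approximate solutions. For $n\in\mathbb{N}$ let $f_n=\min\{f,n\}$, and let $u_n\in HW^{1,p}_0(\Omega)\cap L^\infty(\Omega)$ be the unique positive function satisfying, for all $\varphi\in HW^{1,p}_0(\Omega)$, $$\int_\Omega|\nabla_Hu_n|^{p-2}\nabla_Hu_n\cdot\nabla_H\varphi\,dx+\alpha\int_{\mathbb{H}^N}\int_{\mathbb{H}^N}J_p(u_n(x)-u_n(y))(\varphi(x)-\varphi(y))\,d\mu=\int_\Omega f_n(x)\Big(u_n^++\frac1n\Big)^{-1}\varphi\,dx.$$ The sequence $\{u_n\}$ exists and is nondecreasing in $n$, and $u$ denotes its pointwise limit. Weak solution. $u\in HW^{1,p}_{\mathrm{loc}}(\Omega)\cap L^{p-1}(\Omega)$ is a weak solution of the singular problem if $u=0$ in $\mathbb{H}^N\setminus\Omega$; $u\ge0$ and $(u-\theta)^+\in HW^{1,p}_0(\Omega)$ for every $\theta>0$; for every $\omega\Subset\Omega$ there is $C(\omega)>0$ with $u\ge C(\omega)$ a.e. in $\omega$; and for every $\varphi\in C^1_c(\Omega)$ the displayed identity holds with $u_n$ replaced by $u$ and right-hand side $\int_\Omega f u^{-1}\varphi\,dx$. *)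

(* Defs.v *)
From HB Require Import structures.
From mathcomp Require Import all_boot all_order all_algebra.
From mathcomp Require Import all_classical all_reals all_analysis.

Set Implicit Arguments.
Unset Strict Implicit.
Unset Printing Implicit Defensive.

Import Order.TTheory GRing.Theory Num.Theory.
Import numFieldNormedType.Exports.

Local Open Scope classical_set_scope.
Local Open Scope ring_scope.

Fact rV_display : measure_display.
Proof. exact: default_measure_display. Qed.

(* The sigma-algebra on R^n generated by the coordinates; R^n being second
   countable, this is the Borel sigma-algebra. *)
Section measurable_rV.
Context {R : realType} {n : nat}.

Let coors : 'I_n -> 'rV[R]_n -> measurableTypeR R := fun i x => x ord0 i.

Let rV_set0 : g_sigma_preimage coors set0.
Proof. exact: sigma_algebra0. Qed.

Let rV_setC A : g_sigma_preimage coors A -> g_sigma_preimage coors (~` A).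
Proof. exact: sigma_algebraC. Qed.

Let rV_bigcup (F : _^nat) : (forall i, g_sigma_preimage coors (F i)) ->
  g_sigma_preimage coors (\bigcup_i (F i)).
Proof. exact: sigma_algebra_bigcup. Qed.

HB.instance Definition _ := @isMeasurable.Build rV_display
  'rV[R]_n (g_sigma_preimage coors) rV_set0 rV_setC rV_bigcup.

End measurable_rV.

Section measurable_rV_lemmas.
Context {R : realType}.
Local Notation TR := (measurableTypeR R).

Lemma measurable_coord n (i : 'I_n) :
  measurable_fun [set: 'rV[R]_n] (fun x : 'rV[R]_n => x ord0 i : TR).
Proof.
move=> _ Y mY; rewrite setTI; apply: sub_sigma_algebra => /=.
rewrite -bigcup_seq/=; exists i => /=; first by rewrite mem_index_enum.
by exists Y => //; rewrite setTI.
Qed.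

Lemma measurable_rVP d (T : measurableType d) n (f : T -> 'rV[R]_n) :
  (forall i, measurable_fun [set: T] (fun x => f x ord0 i : TR)) ->
  measurable_fun [set: T] f.
Proof.
move=> mf _ A mA.
suff : g_sigma_preimage (fun (i : 'I_n) (x : T) => f x ord0 i : TR)
    `<=` measurable.
  apply; rewrite (_ : (fun i x => f x ord0 i : TR) =
    (fun i => (fun v : 'rV[R]_n => v ord0 i : TR) \o f))//.
  by rewrite g_sigma_preimage_comp; exists A.
apply: smallest_sub; first exact: sigma_algebra_measurable.
case: n => [|n] in f mf A mA *; first by rewrite big_ord0.
rewrite -bigcup_mkord_ord; apply: bigcup_sub => i Ii.
by move=> B [C mC <-]; exact: mf.
Qed.

Definition rV_cons n (p : TR * 'rV[R]_n) : 'rV[R]_n.+1 :=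
  \row_i oapp (p.2 ord0) p.1 (unlift ord0 i).

Definition rV_uncons n (v : 'rV[R]_n.+1) : TR * 'rV[R]_n :=
  (v ord0 ord0, \row_i v ord0 (lift ord0 i)).

Lemma rV_consK n : cancel (@rV_cons n) (@rV_uncons n).
Proof.
move=> [x v]; rewrite /rV_uncons mxE unlift_none/=; congr pair.
by apply/rowP => i; rewrite !mxE liftK.
Qed.

Lemma measurable_rV_cons n : measurable_fun setT (@rV_cons n).
Proof.
apply: measurable_rVP => i; rewrite /rV_cons.
under eq_fun do rewrite mxE.
case: (unliftP ord0 i) => [j|] _ /=; last exact: measurable_fst.
exact: (measurableT_comp (measurable_coord j) measurable_snd).
Qed.

Lemma measurable_rV_uncons n : measurable_fun setT (@rV_uncons n).
Proof.
apply: measurable_fun_pair; first exact: measurable_coord.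
apply: measurable_rVP => i; rewrite /rV_uncons/=.
under eq_fun do rewrite mxE.
exact: measurable_coord.
Qed.

End measurable_rV_lemmas.

Section leb_succ.
Context {R : realType} {n : nat}.
Variable m : {sigma_finite_measure set 'rV[R]_n -> \bar R}.

Definition leb_succ : set 'rV[R]_n.+1 -> \bar R :=
  pushforward (lebesgue_measure \x m)%E (@rV_cons R n).

Let leb_succ0 : leb_succ set0 = 0%E.
Proof. by rewrite /leb_succ /pushforward preimage_set0 measure0. Qed.

Let leb_succ_ge0 A : (0 <= leb_succ A)%E.
Proof. exact: (measure_ge0 (lebesgue_measure \x m)%E). Qed.

Let leb_succ_sigma_additive : semi_sigma_additive leb_succ.
Proof.
move=> F mF tF mUF; rewrite /leb_succ /pushforward preimage_bigcup.
have mpre k : measurable (@rV_cons R n @^-1` F k).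
  by rewrite -[X in measurable X]setTI; exact: measurable_rV_cons.
apply: measure_semi_sigma_additive => //.
- apply/trivIsetP => /= i j _ _ ij; rewrite -preimage_setI.
  by move/trivIsetP : tF => /(_ _ _ _ _ ij) ->//; rewrite preimage_set0.
- exact: bigcup_measurable.
Qed.

HB.instance Definition _ := isMeasure.Build _ _ _ leb_succ
  leb_succ0 leb_succ_ge0 leb_succ_sigma_additive.

Let leb_succ_sigma_finite : sigma_finite setT leb_succ.
Proof.
have /sigma_finiteP[F [TF ndF Foo]] := sigma_finiteT (@lebesgue_measure R).
have /sigma_finiteP[G [TG ndG Goo]] := sigma_finiteT m.
exists (fun k => @rV_uncons R n @^-1` (F k `*` G k)).
  rewrite -preimage_bigcup (_ : \bigcup_k _ = setT) ?preimage_setT//.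
  rewrite -setXTT TF TG predeqE => -[x y]; split.
    by move=> [k _ []/= ? ?]; split; exists k.
  move=> [/= [k _ Fkx] [l _ Gly]]; exists (maxn k l) => //; split.
  - by move: x Fkx; exact/subsetPset/ndF/leq_maxl.
  - by move: y Gly; exact/subsetPset/ndG/leq_maxr.
move=> k; have [? ?] := Foo k; have [? ?] := Goo k.
have mFG : measurable (F k `*` G k) by exact: measurableX.
split.
  by rewrite -[X in measurable X]setTI; exact: measurable_rV_uncons.
rewrite /leb_succ /pushforward -comp_preimage.
rewrite (_ : _ \o _ = id); last by apply/funext => x /=; rewrite rV_consK.
by rewrite preimage_id product_measure1E// lte_mul_pinfty// ge0_fin_numE.
Qed.

HB.instance Definition _ := Measure_isSigmaFinite.Build _ _ _ leb_succ
  leb_succ_sigma_finite.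

End leb_succ.

(* n-dimensional Lebesgue measure, on Borel sets: the n-fold product of the
   one-dimensional one, see [leb_box]. *)
Fixpoint leb {R : realType} n : {sigma_finite_measure set 'rV[R]_n -> \bar R} :=
  match n with
  | 0 => \d_(0 : 'rV[R]_0)
  | n'.+1 => leb_succ (leb n')
  end.

Lemma leb_box {R : realType} n (A : 'I_n -> set (measurableTypeR R)) :
  (forall i, measurable (A i)) ->
  leb n [set v : 'rV[R]_n | forall i, A i (v ord0 i)] =
  (\prod_(i < n) lebesgue_measure (A i))%E.
Proof.
elim: n => [|n IH] in A *; move=> mA.
  by rewrite big_ord0 /= diracE mem_set//= => -[].
rewrite big_ord_recl /= /leb_succ /pushforward -IH//.
have mbox : measurable
    [set v : 'rV[R]_n | forall i, A (lift ord0 i) (v ord0 i)].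
  rewrite (_ : mkset _ = \bigcap_(i in setT)
      ((fun v : 'rV[R]_n => v ord0 i) @^-1` A (lift ord0 i))).
    apply: fin_bigcap_measurable => // i _.
    by rewrite -[X in measurable X]setTI; exact: measurable_coord.
  by apply/seteqP; split => v /= Av i; [move=> _|]; exact: Av.
rewrite -product_measure1E//.
congr (_ _); apply/seteqP; split => -[x v] /=.
  move=> Av; split; first by have := Av ord0; rewrite mxE unlift_none.
  by move=> i; have := Av (lift ord0 i); rewrite mxE liftK.
by move=> [Ax Av] i; rewrite mxE; case: unliftP => [j|] ->.
Qed.

Section heisenberg_group.
Context {R : realType} {N : nat}.
Local Notation H := 'rV[R]_(N + N + 1).

(* [hx xi j] is x_{j+1} for j < 2N; the coordinates are numbered from 0 here,
   so x_i and x_{N+i} are [hx xi (lshift N i)] and [hx xi (rshift N i)]. *)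
Definition hx (xi : H) (j : 'I_(N + N)) : R := xi ord0 (lshift 1 j).
Definition htau (xi : H) : R := xi ord0 (rshift (N + N) ord0).

Definition hsymp (xi eta : H) : R :=
  \sum_(i < N) (hx xi (lshift N i) * hx eta (rshift N i)
                - hx xi (rshift N i) * hx eta (lshift N i)).

Definition hmul (xi eta : H) : H :=
  row_mx (\row_j (hx xi j + hx eta j))
         (const_mx (htau xi + htau eta + 2^-1 * hsymp xi eta)).

Definition hinv (xi : H) : H := - xi.

Lemma hmulVx xi : hmul (hinv xi) xi = 0.
Proof.
have xN j : hx (hinv xi) j = - hx xi j by rewrite /hx mxE.
have tN : htau (hinv xi) = - htau xi by rewrite /htau mxE.
rewrite /hmul /hsymp tN addNr add0r big1 ?mulr0 => [|i _]; last first.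
  by rewrite !xN !mulNr opprK mulrC addNr.
apply/rowP => k; rewrite !mxE.
by case: splitP => j _; rewrite !mxE // xN addNr.
Qed.

Definition hnorm (xi : H) : R :=
  ((\sum_j hx xi j ^+ 2) ^+ 2 + htau xi ^+ 2) `^ 4^-1.

End heisenberg_group.

Section differentiability_classes.
Context {R : realType} {n : nat}.
Implicit Types (f : 'rV[R]_n -> R) (A D : set 'rV[R]_n).

Definition basis_vec (i : 'I_n) : 'rV[R]_n := delta_mx ord0 i.

Fixpoint class_C (k : nat) f : Prop :=
  continuous f /\
  match k with
  | 0 => True
  | k'.+1 => forall i, (forall x, derivable f x (basis_vec i)) /\
                       class_C k' (fun x => 'D_(basis_vec i) f x)
  end.

Definition smooth f := forall k, class_C k f.

Definition compactly_contained A D :=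
  compact (closure A) /\ closure A `<=` D.

Definition compactly_supported D f :=
  compactly_contained [set x | f x != 0] D.

(* Near each boundary point the set is the sublevel set [rho < 0] of a smooth
   function with nonzero gradient at that point. *)
Definition smooth_boundary D :=
  forall x0, (closure D `\` D°) x0 ->
  exists (U : set 'rV[R]_n) (rho : 'rV[R]_n -> R),
    [/\ open U, U x0, smooth rho,
        exists i, 'D_(basis_vec i) rho x0 != 0
      & D `&` U = [set x | rho x < 0] `&` U].

Definition bounded_smooth_domain D :=
  [/\ open D, connected D, D !=set0, bounded_set D & smooth_boundary D].

(* [finite_norm] integrates over the whole space and [f \_ D] is 0 off D, so
   this is f in L^q(D), for 0 < q <= +oo. *)
Definition inLp D (q : \bar R) f :=
  measurable_fun D f /\ finite_norm (leb n) q (f \_ D).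

Definition loc_integrable D f :=
  measurable_fun D f /\
  forall K, compact K -> K `<=` D -> (leb n).-integrable K (EFin \o f).

End differentiability_classes.

Section horizontal_sobolev.
Context {R : realType} {N : nat}.
Local Notation H := 'rV[R]_(N + N + 1).
Local Notation mu := (leb (N + N + 1)).
Implicit Types (D Omega : set H) (u phi : H -> R) (g : 'I_(N + N) -> H -> R).

Definition hvf (j : 'I_(N + N)) phi (xi : H) : R :=
  let dx := 'D_(basis_vec (lshift 1 j)) phi xi in
  let dtau := 'D_(basis_vec (rshift (N + N) ord0)) phi xi in
  match fintype.split j with
  | inl i => dx - hx xi (rshift N i) / 2 * dtau
  | inr i => dx + hx xi (lshift N i) / 2 * dtau
  end.

(* The fields X_j are divergence free, hence the adjoint of X_j is - X_j. *)
Definition weak_hgrad D u g :=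
  [/\ loc_integrable D u, forall j, loc_integrable D (g j)
    & forall j phi, smooth phi -> compactly_supported D phi ->
        \int[mu]_(x in D) (u x * hvf j phi x) =
        - \int[mu]_(x in D) (g j x * phi x)].

Definition HW1 D (p : R) u :=
  inLp D p%:E u /\
  exists2 g, weak_hgrad D u g & forall j, inLp D p%:E (g j).

Definition HW1_loc D (p : R) u :=
  forall D', open D' -> compactly_contained D' D -> HW1 D' p u.

Definition HW1_0 D (p : R) u :=
  HW1 setT p u /\ (\forall x \ae mu, ~ D x -> u x = 0).

Definition hdot g1 g2 (x : H) : R := \sum_j g1 j x * g2 j x.
Definition hgrad_norm g (x : H) : R := Num.sqrt (hdot g g x).

Definition hdim : R := (2 * N + 2)%:R.

(* [0 `^ a = 0] for a != 0, so that |t|^(p-2) t is 0 at t = 0 also when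
   p < 2; likewise for [local_term]. *)
Definition Jp (p t : R) : R := `|t| `^ (p - 2) * t.

Definition local_term (p : R) g1 g2 (x : H) : R :=
  hgrad_norm g1 x `^ (p - 2) * hdot g1 g2 x.

Definition nonlocal_term (s p : R) u phi (z : H * H) : R :=
  Jp p (u z.1 - u z.2) * (phi z.1 - phi z.2)
  / hnorm (hmul (hinv z.2) z.1) `^ (hdim + s * p).

(* Weak formulation, tested with phi, of
   - Delta_{H,p} u + alpha (- Delta_{H,p})^s u = F in Omega.
   Weak gradients are unique only up to null sets; the identity is asked for
   every choice of them.  Integrability is part of the identity, since
   [\int] on reals returns 0 when the Lebesgue integral is infinite. *)
Definition weak_identity Omega (s p alpha : R) u (F : H -> R) phi :=
  forall gu gphi, weak_hgrad Omega u gu -> weak_hgrad Omega phi gphi ->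
  [/\ mu.-integrable Omega (EFin \o local_term p gu gphi),
      (mu \x mu)%E.-integrable setT (EFin \o nonlocal_term s p u phi),
      mu.-integrable Omega (EFin \o (fun x => F x * phi x))
    & \int[mu]_(x in Omega) local_term p gu gphi x
      + alpha * \int[(mu \x mu)%E]_z nonlocal_term s p u phi z
      = \int[mu]_(x in Omega) (F x * phi x)].

Definition approx_solution Omega (s p alpha : R) (f : H -> R) (n : nat) u :=
  [/\ HW1_0 Omega p u, inLp Omega +oo%E u,
      \forall x \ae mu, Omega x -> 0 < u x
    & forall phi, HW1_0 Omega p phi ->
        weak_identity Omega s p alpha u
          (fun x => Num.min (f x) n%:R * (Num.max (u x) 0 + n%:R^-1)^-1) phi].

Definition weak_solution Omega (s p alpha : R) (f : H -> R) u :=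
  [/\ HW1_loc Omega p u /\ inLp Omega (p - 1)%:E u,
      \forall x \ae mu, ~ Omega x -> u x = 0,
      (\forall x \ae mu, 0 <= u x) /\
      (forall theta, 0 < theta ->
        HW1_0 Omega p (fun x => Num.max (u x - theta) 0)),
      forall w, compactly_contained w Omega ->
        exists2 C, 0 < C & \forall x \ae mu, w x -> C <= u x
    & forall phi, class_C 1 phi -> compactly_supported Omega phi ->
        weak_identity Omega s p alpha u (fun x => f x * (u x)^-1) phi].

End horizontal_sobolev.

Definition conj_exp {R : realType} (l : R) : R := l / (l - 1).

Definition sobolev_exp {R : realType} (Q p : R) : R := Q * p / (Q - p).

Definition gamma_exp {R : realType} (Q p m : R) : R :=
  p * conj_exp m / (p * conj_exp m - sobolev_exp Q p).

(* Main.v *)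
(** The paper's Sobolev inequality is replaced by an estimate on level sets.  If
    [w >= 0] is a Sobolev function and [P = {w > 0}] has finite measure, then for
    [x] in [{w >= L}] at least half of a box [B_r] of measure [2 |P|] consists of
    [h] with [w (x h) = 0].  Averaging [|w (x h) - w x|^p] over that box, and
    writing each [h] in [B_r] as a product of five horizontal elements of size at
    most [r] (a commutator produces the vertical part), gives
    [L^p |{w >= L}| <= C |P|^(p/Q) \int |grad w|^p].

    The equation for [u_n] is tested with [G (u_n)], where [G'] is a tent function
    supported in [[a, a + 2 r]]: the nonlocal term is nonnegative, and since
    [G (v) <= v] the singular right-hand side is at most the integral of [f] over
    [{u_n > a}].  Letting [n] tend to infinity,
    [r^p |{u > a + 2 r}| <= C |{u > a}|^(p/Q) \int_{u > a} f].
    By Hölder's inequality, Stampacchia's iteration gives (ii), and summing over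
    dyadic levels with the weights [2^(k t)], where [t = p^* gamma] equals
    [p / (1/m - p/Q)], gives (i).

    Weak derivatives are handled without mollification: for test functions the
    horizontal difference is an integral of the derivative along the flow
    [x |-> x (s y)], which preserves the measure, and by duality this holds almost
    everywhere for Sobolev functions.  The chain rule follows by letting the flow
    time tend to 0 in the difference quotients. *)
From HB Require Import structures.
From mathcomp Require Import all_boot all_order all_algebra.
From mathcomp Require Import all_classical all_reals all_analysis measurable_realfun.
From mathcomp Require Import ring lra.
Require Import Defs.

Set Implicit Arguments.
Unset Strict Implicit.
Unset Printing Implicit Defensive.

Import Order.TTheory GRing.Theory Num.Theory.
Import numFieldNormedType.Exports.

Local Open Scope classical_set_scope.
Local Open Scope ring_scope.

(** * Borel sets and Lebesgue measure on R^n *)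

(** Testing with powers of [u] would ask for a chain rule beyond bounded [G']. A bounded, compactly
    supported [G'] avoids this; it must also be Lipschitz, because the chain rule rests on a
    second-order estimate for [G], so the plain truncation, whose derivative jumps, is smoothed into
    a tent. The price is that information passes from level [a] to [a + 2 r] and not to [a + r],
    which only changes constants. As [0 <= G' <= 1] and [p > 1], the energy [|G'(u) grad u|^p] is at
    most the term [G'(u) |grad u|^p] of the equation. With [A (b) = |{u > b}|], Hölder turns the
    level estimate into [r^p A (a + 2 r) <= C A (a)^kappa], where [kappa = p/Q + 1 - 1/m] exceeds 1
    exactly when [m > Q/p]; then [A] vanishes at a finite level. For [m < Q/p] the integrals of [f]
    are kept until the dyadic levels have been summed, and Hölder is applied once to the whole sum.
    Applied level by level it would give a weak-type bound at the exponent [t]; applied to the sum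
    it gives [L^t] itself, through a recursion that is sublinear because [kappa < 1]. *)

Lemma le_of_eq {d} {T : porderType d} (x y : T) : x = y -> (x <= y)%O.
Proof. by move->. Qed.

Section leb_uniqueness.
Context {R : realType} {n : nat}.
Local Notation V := 'rV[R]_n.
Local Notation TR := (measurableTypeR R).

Definition obox (a b : V) : set V :=
  [set v | forall i, v ord0 i \in `]a ord0 i, b ord0 i[%R].

Definition oboxes : set (set V) := [set A | exists a b, A = obox a b].

Lemma measurable_obox a b : measurable (obox a b).
Proof.
rewrite (_ : obox a b = \bigcap_(i in setT)
    ((fun v : V => v ord0 i) @^-1` `]a ord0 i, b ord0 i[%classic)).
  apply: fin_bigcap_measurable => // i _.
  rewrite -[X in measurable X]setTI; apply: measurable_coord => //.
by apply/seteqP; split => v /= Av i; [move=> _|]; exact: Av.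
Qed.

(** Second countability: an open set is the union of the countably many boxes with rational corners
    that it contains. *)
Lemma open_oboxes U : open U -> <<s oboxes >> U.
Proof.
move=> oU.
pose rv (q : 'rV[rat]_n) : V := map_mx ratr q.
pose P := [set q : 'rV[rat]_n * 'rV[rat]_n | obox (rv q.1) (rv q.2) `<=` U].
have -> : U = \bigcup_(q in P) obox (rv q.1) (rv q.2).
  apply/seteqP; split => [x Ux|x [q Pq]]; last exact: Pq.
  have /nbhs_ballP[e /= e0 xeU] := open_nbhs_nbhs (conj oU Ux).
  have ha i : {q : rat | ratr q \in `]x ord0 i - e, x ord0 i[%R}.
    by apply/cid; have [|q qi] := @rat_in_itvoo R (x ord0 i - e) (x ord0 i);
      [rewrite ltrBlDr ltrDl|exists q].
  have hb i : {q : rat | ratr q \in `]x ord0 i, x ord0 i + e[%R}.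
    by apply/cid; have [|q qi] := @rat_in_itvoo R (x ord0 i) (x ord0 i + e);
      [rewrite ltrDl|exists q].
  exists (\row_i sval (ha i), \row_i sval (hb i)) => /=; last first.
    move=> i; rewrite !mxE in_itv/=.
    have /itvP hai := svalP (ha i); have /itvP hbi := svalP (hb i).
    by rewrite hai hbi.
  move=> y /= yab; apply: xeU; split => // i j.
  rewrite (ord1 i); have := yab j; rewrite !mxE in_itv/= => /andP[ay yb].
  have := svalP (ha j); have := svalP (hb j).
  rewrite !in_itv/= => /andP[_ hb2] /andP[ha1 _].
  rewrite /ball/= ltr_norml; apply/andP; split.
    by rewrite ltrBrDl -ltrBrDr opprK (lt_trans yb).
  by rewrite ltrBlDl -ltrBlDr (lt_trans ha1).
rewrite bigcup_mkcond.
apply: (@countable_bigcupT_measurable _ (g_sigma_algebraType oboxes)).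
  exact: countableP.
move=> q; case: ifPn => _; last exact: sigma_algebra0.
by apply: sub_sigma_algebra; exists (rv q.1), (rv q.2).
Qed.

Lemma measurable_rVE : @measurable rV_display V = <<s oboxes >>.
Proof.
apply/seteqP; split; last first.
  apply: smallest_sub; first exact: sigma_algebra_measurable.
  by move=> _ [a [b ->]]; exact: measurable_obox.
apply: smallest_sub; first exact: smallest_sigma_algebra.
have key (i : 'I_n) : preimage_set_system setT (fun x : V => x ord0 i : TR)
    measurable `<=` <<s oboxes >>.
  suff : measurable_fun [set: g_sigma_algebraType oboxes]
      (fun x : V => x ord0 i : TR).
    by move=> mi _ [C mC <-]; exact: mi.
  apply: (measurability _ (measurable_realfun.RGenOpens.measurableE R)) => // _ [_ [c [d ->]] <-].
  rewrite setTI; apply: open_oboxes.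
  apply: open_comp; [move=> x _; exact: coord_continuous|exact: interval_open].
move=> A; rewrite -bigcup_seq/= => -[i _]; exact: key.
Qed.

Lemma open_measurable_rV (U : set V) : open U -> measurable U.
Proof. by rewrite measurable_rVE; exact: open_oboxes. Qed.

Lemma closed_measurable_rV (U : set V) : closed U -> measurable U.
Proof.
move=> cU; rewrite -(setCK U); apply: measurableC; apply: open_measurable_rV.
exact: closed_openC.
Qed.

Lemma continuous_measurable_rV (f : V -> R) :
  continuous f -> measurable_fun setT (f : V -> TR).
Proof.
move=> cf; apply: (measurability _ (measurable_realfun.RGenOpens.measurableE R)) => // _ [_ [c [d ->]] <-].
by rewrite setTI; apply: open_measurable_rV; apply: open_comp; [move=> x _; exact: cf|exact: interval_open].
Qed.

Lemma setI_closed_oboxes : setI_closed oboxes.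
Proof.
move=> _ _ [a [b ->]] [c [d ->]].
exists (\row_i Num.max (a ord0 i) (c ord0 i)), (\row_i Num.min (b ord0 i) (d ord0 i)).
apply/seteqP; split => [v [v1 v2] i|v vi].
  rewrite !mxE in_itv/= gt_max lt_min.
  by have := v1 i; have := v2 i; rewrite !in_itv/= => /andP[-> ->] /andP[-> ->].
split => i; have := vi i; rewrite !mxE !in_itv/= gt_max lt_min.
  by move=> /andP[/andP[-> _] /andP[-> _]].
by move=> /andP[/andP[_ ->] /andP[_ ->]].
Qed.

Definition cube (k : nat) : set V := obox (const_mx (- k%:R)) (const_mx k%:R).

Lemma cubeE k v : cube k v <-> forall i, `|v ord0 i| < k%:R.
Proof.
by split=> h i; have := h i; rewrite !mxE in_itv/= ltr_norml.
Qed.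

Lemma bounded_cube (A : set V) : bounded_set A -> exists k, A `<=` cube k.
Proof.
move=> [M [_ hM]].
exists (Num.truncn (`|M| + 1)).+1 => v /(hM (`|M| + 1)).
rewrite (le_lt_trans (ler_norm M)) ?ltrDl// => /(_ isT) vM; apply/cubeE => i.
rewrite (@le_lt_trans _ _ (`|M| + 1)) ?truncnS_gt//.
apply: le_trans vM; rewrite (_ : `|v| = mx_norm v)// mx_normrE.
exact: (le_bigmax _ (fun ij => `|v ij.1 ij.2|) (ord0, i)).
Qed.

Lemma cube_cover : \bigcup_k cube k = setT.
Proof.
rewrite -subTset => v _.
have [|k hk] := @bounded_cube [set v]; last by exists k => //; exact: hk.
by exists `|v|; split => // x vx y ->; exact: ltW.
Qed.

Lemma leb_obox (a b : V) : (forall i, a ord0 i <= b ord0 i) ->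
  leb n (obox a b) = (\prod_(i < n) (b ord0 i - a ord0 i))%:E.
Proof.
move=> ab; have := @leb_box R n (fun i => `]a ord0 i, b ord0 i[%classic).
move=> ->; last by move=> i; exact: measurable_itv.
rewrite -prodEFin; apply: eq_bigr => i _.
by rewrite lebesgue_measure_itv/= lte_fin lt_neqAle ab andbT;
  case: eqVneq => //= ->; rewrite subrr.
Qed.

Lemma leb_cube k : (leb n (cube k) < +oo)%E.
Proof.
rewrite leb_obox ?ltry// => i.
by rewrite !mxE (@le_trans _ _ 0)// oppr_le0.
Qed.

Lemma leb_bounded (A : set V) : bounded_set A -> measurable A ->
  (leb n A < +oo)%E.
Proof.
move=> /bounded_cube[k Ak] mA; apply: le_lt_trans (leb_cube k).
by apply: le_measure => //; rewrite inE//; exact: measurable_obox.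
Qed.

(** Boxes form a pi-system generating the Borel sets, and the cubes exhaust the space with finite
    measure. A box with a reversed side is empty, so agreement is asked only for ordered corners. *)
Lemma measure_rV_unique (m1 m2 : {measure set V -> \bar R}) :
  (forall a b : V, (forall i, a ord0 i <= b ord0 i) ->
     m1 (obox a b) = m2 (obox a b)) ->
  (forall k, (m1 (cube k) < +oo)%E) ->
  forall A, measurable A -> m1 A = m2 A.
Proof.
move=> m12 m1oo A mA; apply: (measure_unique oboxes cube) => //.
- exact: measurable_rVE.
- exact: setI_closed_oboxes.
- by move=> k; exists (const_mx (- k%:R)), (const_mx k%:R).
- exact: cube_cover.
- move=> _ [a [b ->]]; have [ab|] := pselect (forall i, a ord0 i <= b ord0 i).
    exact: m12.
  move=> /existsNP[i /negP]; rewrite -ltNge => bai.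
  rewrite (_ : obox a b = set0) ?measure0//; apply/seteqP; split => // v /(_ i).
  by rewrite in_itv/= => /andP[av vb]; have := lt_trans av vb; rewrite ltNge ltW.
Qed.

End leb_uniqueness.

(** * Measure preserving maps *)

Section measure_preserving.
Context {R : realType}.
Local Notation TR := (measurableTypeR R).

Lemma leb_pushforward {n d} {T : measurableType d}
    (m : {measure set T -> \bar R}) (f : T -> 'rV[R]_n) :
  measurable_fun setT f ->
  (forall a b : 'rV[R]_n, (forall i, a ord0 i <= b ord0 i) ->
     m (f @^-1` obox a b) = leb n (obox a b)) ->
  forall A, measurable A -> m (f @^-1` A) = leb n A.
Proof.
move=> mf mfE A mA; symmetry.
have := @measure_rV_unique R n (leb n)
  (measure_function_pushforward__canonical__measure_function_Measure m mf).
apply => //; last exact: leb_cube.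
by move=> a b /mfE/esym.
Qed.

Lemma lebesgue_measure_shift (t : R) (A : set TR) : measurable A ->
  lebesgue_measure [set x | A (x + t)] = lebesgue_measure A.
Proof.
move=> mA; symmetry.
have mt : measurable_fun setT (fun x : TR => (x + t : TR)) by exact: measurable_funD.
apply: (@lebesgue_measure_unique R
  (measure_function_pushforward__canonical__measure_function_Measure
     (@lebesgue_measure R) mt)) => //= X [[a b] _ <-].
rewrite /pushforward /= (_ : _ @^-1` _ = `]a - t, b - t]%classic).
  rewrite !lebesgue_measure_itv/= !lte_fin ltrD2r; case: ifPn => // _.
  by rewrite -!EFinD; congr (_%:E); rewrite opprB addrA subrK.
by apply/seteqP; split => x /=; rewrite !in_itv/= ltrBlDr lerBrDr.
Qed.

Definition mpres {d} {T : measurableType d} (m : {measure set T -> \bar R})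
    (f : T -> T) :=
  measurable_fun setT f /\ forall A, measurable A -> m (f @^-1` A) = m A.

Lemma mpres_comp {d} {T : measurableType d} (m : {measure set T -> \bar R})
    (f g : T -> T) : mpres m f -> mpres m g -> mpres m (f \o g).
Proof.
move=> [mf fE] [mg gE]; split; first exact: measurableT_comp.
move=> A mA; rewrite comp_preimage gE ?fE//.
by rewrite -[X in measurable X]setTI; exact: mf.
Qed.

Lemma mpres_id {d} {T : measurableType d} (m : {measure set T -> \bar R}) :
  mpres m (fun x => x).
Proof. by split. Qed.

Lemma mpres_integral {d} {T : measurableType d} (m : {measure set T -> \bar R})
    (f : T -> T) (h : T -> \bar R) : mpres m f -> measurable_fun setT h ->
  (forall x, 0 <= h x)%E -> (\int[m]_x h (f x) = \int[m]_x h x)%E.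
Proof.
move=> [mf fE] mh h0; rewrite -[LHS]/(\int[m]_x (h \o f) x)%E.
rewrite -{1}(preimage_setT f) -ge0_integral_pushforward//.
by apply: eq_measure_integral => A mA _; exact: fE.
Qed.

Lemma mpres_integrable {d} {T : measurableType d}
    (m : {measure set T -> \bar R}) (f : T -> T) (h : T -> \bar R) :
  mpres m f -> m.-integrable setT h -> m.-integrable setT (h \o f).
Proof.
move=> mpf /integrableP[mh hoo]; apply/integrableP; split.
  by apply: measurableT_comp => //; exact: mpf.1.
rewrite (_ : \int[m]_x _ = \int[m]_x (abse \o h) (f x))%E//.
by rewrite mpres_integral//; [exact: measurableT_comp|move=> x /=].
Qed.

Lemma mpres_Rintegral {d} {T : measurableType d}
    (m : {measure set T -> \bar R}) (f : T -> T) (h : T -> R) :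
  mpres m f -> measurable_fun setT h ->
  \int[m]_x h (f x) = \int[m]_x h x.
Proof.
move=> mpf mh; rewrite /Rintegral; congr fine.
rewrite [LHS]integralE [RHS]integralE.
have mh' : measurable_fun setT (EFin \o h) by exact/measurable_EFinP.
congr (_ - _)%E.
  rewrite -[RHS](mpres_integral mpf (measurable_funepos mh')); last first.
    by move=> x; exact: funepos_ge0.
  by apply: eq_integral => x _; rewrite -[fun _ => _]/((EFin \o h) \o f) funepos_comp.
rewrite -[RHS](mpres_integral mpf (measurable_funeneg mh')); last first.
    by move=> x; exact: funeneg_ge0.
  by apply: eq_integral => x _; rewrite -[fun _ => _]/((EFin \o h) \o f) funeneg_comp.
Qed.

Lemma mpres_translation {n} (w : 'rV[R]_n) : mpres (leb n) (fun v => v + w).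
Proof.
have mw : measurable_fun setT (fun v : 'rV[R]_n => v + w).
  apply: measurable_rVP => i.
  under eq_fun do rewrite mxE.
  by apply: measurable_funD => //; exact: measurable_coord.
split => // A mA; apply: leb_pushforward mA => // a b ab.
rewrite (_ : _ @^-1` _ = obox (a - w) (b - w)); last first.
  by apply/seteqP; split => v /= vab i; have := vab i;
    rewrite !mxE !in_itv/= ltrBlDr ltrBrDr.
rewrite (leb_obox ab); apply: etrans (leb_obox _) _.
  by move=> i; rewrite !mxE lerD2r.
congr EFin; apply: eq_bigr => i _; rewrite !mxE; ring.
Qed.

Definition snoc {n} (p : 'rV[R]_n * TR) : 'rV[R]_(n + 1) :=
  row_mx p.1 (const_mx p.2).

Lemma snocl {n} (p : 'rV[R]_n * TR) j : snoc p ord0 (lshift 1 j) = p.1 ord0 j.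
Proof. by rewrite /snoc row_mxEl. Qed.

Lemma snocr {n} (p : 'rV[R]_n * TR) j : snoc p ord0 (rshift n j) = p.2.
Proof. by rewrite /snoc row_mxEr mxE. Qed.

Lemma measurable_snoc n : measurable_fun setT (@snoc n).
Proof.
apply: measurable_rVP => i.
case: (splitP i) => j ij.
  have -> : i = lshift 1 j by apply/val_inj.
  under eq_fun do rewrite snocl.
  exact: (measurableT_comp (measurable_coord j) measurable_fst).
have -> : i = rshift n j by apply/val_inj.
under eq_fun do rewrite snocr.
exact: measurable_snd.
Qed.

(** [leb] splits off the first coordinate, whereas the vertical coordinate of the group is the last
    one. Both products agree on boxes, so Fubini may also be used with the last coordinate split
    off. *)
Lemma leb_snoc n (A : set 'rV[R]_(n + 1)) : measurable A ->
  (leb n \x lebesgue_measure)%E (@snoc n @^-1` A) = leb (n + 1) A.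
Proof.
apply: leb_pushforward; first exact: measurable_snoc.
move=> a b ab; pose a' := lsubmx a; pose b' := lsubmx b.
pose at_ := a ord0 (rshift n ord0); pose bt := b ord0 (rshift n ord0).
rewrite (_ : _ @^-1` _ = obox a' b' `*` `]at_, bt[%classic); last first.
  apply/seteqP; split => [[v t] /= vt|[v t] [/= vab tab] i].
    split => [i|]; first by have := vt (lshift 1 i); rewrite snocl !mxE.
    by have := vt (rshift n ord0); rewrite snocr.
  case: (splitP i) => j ij.
    rewrite (_ : i = lshift 1 j); last by apply/val_inj.
    by rewrite snocl; have := vab j; rewrite !mxE.
  rewrite (_ : i = rshift n j); last by apply/val_inj.
  by rewrite snocr (ord1 j).
apply: etrans (product_measure1E _ _ (measurable_obox _ _) _) _ => //.
have ab' i : a' ord0 i <= b' ord0 i by rewrite !mxE.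
rewrite (leb_obox ab); apply: etrans (congr1 ( *%E^~ _) (leb_obox ab')) _.
rewrite [X in (_ * X)%E](_ : _ = lebesgue_measure `]at_, bt[%classic)//.
rewrite lebesgue_measure_itv/= lte_fin big_split_ord/= big_ord1.
rewrite EFinM; congr (_ * _)%E.
  by congr EFin; apply: eq_bigr => i _; rewrite !mxE.
rewrite lt_neqAle ab andbT; case: eqVneq => //= e.
by rewrite -/bt -/at_ e subrr.
Qed.

Definition shear {n} (c : 'rV[R]_n -> R) (v : 'rV[R]_(n + 1)) : 'rV[R]_(n + 1) :=
  snoc (lsubmx v, v ord0 (rshift n ord0) + c (lsubmx v)).

Lemma measurable_lsubmx n m :
  measurable_fun setT (fun v : 'rV[R]_(n + m) => lsubmx v).
Proof.
apply: measurable_rVP => i.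
by under eq_fun do rewrite mxE; exact: measurable_coord.
Qed.

(** By Fubini: on each vertical fibre the shear is a translation of the line. *)
Lemma mpres_shear n (c : 'rV[R]_n -> R) : measurable_fun setT c ->
  mpres (leb (n + 1)) (shear c).
Proof.
move=> mc.
have ms : measurable_fun setT (shear c).
  apply: (measurableT_comp (@measurable_snoc n)).
  apply: measurable_fun_pair; first exact: measurable_lsubmx.
  apply: measurable_funD; first exact: measurable_coord.
  exact: measurableT_comp (@measurable_lsubmx n 1).
split => // A mA; apply: etrans (esym (leb_snoc _)) (etrans _ (leb_snoc mA)).
  by rewrite -[X in measurable X]setTI; exact: ms.
have mpre B : measurable B -> measurable (@snoc n @^-1` B).
  by move=> mB; rewrite -[X in measurable X]setTI; exact: measurable_snoc.
have mpA := mpre _ mA.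
rewrite /product_measure1/=; apply: eq_integral => v _ /=.
rewrite -[RHS](lebesgue_measure_shift (c v)); last exact: measurable_xsection.
congr lebesgue_measure; apply/seteqP; split => t; rewrite /xsection/= !inE/=.
  by rewrite /shear snocr row_mxKl.
by rewrite /shear snocr row_mxKl.
Qed.

End measure_preserving.

(** * The Heisenberg group *)

Section heisenberg_translations.
Context {R : realType} {N : nat}.
Local Notation H := 'rV[R]_(N + N + 1).
Local Notation mu := (leb (N + N + 1)).
Local Notation TR := (measurableTypeR R).
Implicit Types (xi eta h : H) (y : 'rV[R]_(N + N)).

Lemma hx_lsubmx xi j : hx xi j = lsubmx xi ord0 j.
Proof. by rewrite mxE. Qed.

Definition rsymp (v w : 'rV[R]_(N + N)) : R :=
  \sum_(i < N) (v ord0 (lshift N i) * w ord0 (rshift N i)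
                - v ord0 (rshift N i) * w ord0 (lshift N i)).

Lemma hsympE xi eta : hsymp xi eta = rsymp (lsubmx xi) (lsubmx eta).
Proof. by apply: eq_bigr => i _; rewrite !hx_lsubmx. Qed.

Lemma rsympDl v w z : rsymp (v + w) z = rsymp v z + rsymp w z.
Proof. by rewrite /rsymp -big_split/=; apply: eq_bigr => i _; rewrite !mxE; ring. Qed.

Lemma rsympDr v w z : rsymp v (w + z) = rsymp v w + rsymp v z.
Proof. by rewrite /rsymp -big_split/=; apply: eq_bigr => i _; rewrite !mxE; ring. Qed.

Lemma rsympZl a v w : rsymp (a *: v) w = a * rsymp v w.
Proof. by rewrite /rsymp mulr_sumr; apply: eq_bigr => i _; rewrite !mxE; ring. Qed.

Lemma rsympZr a v w : rsymp v (a *: w) = a * rsymp v w.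
Proof. by rewrite /rsymp mulr_sumr; apply: eq_bigr => i _; rewrite !mxE; ring. Qed.

Lemma rsymp_sumr I (s : seq I) v (w : I -> 'rV[R]_(N + N)) :
  rsymp v (\sum_(i <- s) w i) = \sum_(i <- s) rsymp v (w i).
Proof.
elim: s => [|i s IH]; last by rewrite !big_cons rsympDr IH.
by rewrite !big_nil -(scale0r 0) rsympZr mul0r.
Qed.

Lemma rsympNl v w : rsymp (- v) w = - rsymp v w.
Proof. by rewrite -scaleN1r rsympZl mulN1r. Qed.

Lemma rsympNr v w : rsymp v (- w) = - rsymp v w.
Proof. by rewrite -scaleN1r rsympZr mulN1r. Qed.

Lemma htauN xi : htau (- xi) = - htau xi.
Proof. by rewrite /htau mxE. Qed.

Lemma htauD xi eta : htau (xi + eta) = htau xi + htau eta.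
Proof. by rewrite /htau mxE. Qed.

Lemma htauZ t xi : htau (t *: xi) = t * htau xi.
Proof. by rewrite /htau mxE. Qed.

Lemma rsympvv v : rsymp v v = 0.
Proof. by rewrite /rsymp big1// => i _; ring. Qed.

Lemma hmulE xi eta : hmul xi eta =
  snoc (lsubmx xi + lsubmx eta,
        htau xi + htau eta + 2^-1 * rsymp (lsubmx xi) (lsubmx eta)).
Proof.
rewrite /hmul /snoc/= hsympE; congr row_mx.
by apply/rowP => j; rewrite !mxE.
Qed.

Lemma hP xi eta : lsubmx xi = lsubmx eta -> htau xi = htau eta -> xi = eta.
Proof.
move=> xe te; rewrite -[xi]hsubmxK -[eta]hsubmxK xe; congr row_mx.
by apply/rowP => j; rewrite !mxE (ord1 j).
Qed.

Lemma lsubmx_snoc (v : 'rV[R]_(N + N)) t : lsubmx (snoc (v, t)) = v.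
Proof. exact: row_mxKl. Qed.

Lemma htau_snoc (v : 'rV[R]_(N + N)) t : htau (snoc (v, t)) = t.
Proof. exact: snocr. Qed.

Lemma lsubmx_hmul xi eta : lsubmx (hmul xi eta) = lsubmx xi + lsubmx eta.
Proof. by rewrite hmulE lsubmx_snoc. Qed.

Lemma htau_hmul xi eta : htau (hmul xi eta) =
  htau xi + htau eta + 2^-1 * rsymp (lsubmx xi) (lsubmx eta).
Proof. by rewrite hmulE htau_snoc. Qed.

Lemma hmulA xi eta h : hmul xi (hmul eta h) = hmul (hmul xi eta) h.
Proof.
apply: hP; rewrite ?lsubmx_hmul ?htau_hmul ?lsubmx_hmul; first by rewrite addrA.
by rewrite rsympDl rsympDr; ring.
Qed.

Lemma hmulxV h xi : hmul (hmul xi (- h)) h = xi.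
Proof.
apply: hP; rewrite ?lsubmx_hmul ?htau_hmul ?lsubmx_hmul !raddfN/= ?subrK//.
by rewrite rsympDl rsympNl rsympNr rsympvv htauN; ring.
Qed.

Lemma hmulVK h xi : hmul (hmul xi h) (- h) = xi.
Proof. by rewrite -{1}(opprK h) hmulxV. Qed.

Lemma measurable_rsympl w : measurable_fun setT (fun v => rsymp v w : TR).
Proof.
apply: measurable_sum => i.
by apply: measurable_funB; apply: measurable_funM => //; exact: measurable_coord.
Qed.

Lemma measurable_rsympr v : measurable_fun setT (fun w => rsymp v w : TR).
Proof.
apply: measurable_sum => i.
by apply: measurable_funB; apply: measurable_funM => //; exact: measurable_coord.
Qed.

(** Right translation by [h] is the Euclidean translation by [h] followed by a shear. Shearing after
    translating gives the group law because the symplectic form vanishes on the diagonal. *)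
Lemma mpres_hmulr h : mpres mu (fun xi => hmul xi h).
Proof.
have := mpres_comp (@mpres_shear R (N + N) (fun v => 2^-1 * rsymp v (lsubmx h)) _)
                   (@mpres_translation R (N + N + 1) h).
rewrite (_ : _ \o _ = (fun xi => hmul xi h)); first apply.
  by apply: measurable_funM => //; exact: measurable_rsympl.
apply/funext => xi /=; rewrite hmulE /shear; congr snoc; congr pair.
  by rewrite raddfD.
by rewrite raddfD/= rsympDl rsympvv addr0 mxE.
Qed.

Lemma mpres_hmull xi : mpres mu (fun h => hmul xi h).
Proof.
have := mpres_comp (@mpres_shear R (N + N) (fun v => 2^-1 * rsymp (lsubmx xi) v) _)
                   (@mpres_translation R (N + N + 1) xi).
rewrite (_ : _ \o _ = (fun h => hmul xi h)); first apply.
  by apply: measurable_funM => //; exact: measurable_rsympr.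
apply/funext => h /=; rewrite hmulE /shear; congr snoc; congr pair.
  by rewrite raddfD/= addrC.
by rewrite raddfD/= rsympDr rsympvv addr0 mxE; congr (_ + _); rewrite addrC.
Qed.

Lemma measurable_hmul : measurable_fun setT (fun z : H * H => hmul z.1 z.2).
Proof.
under eq_fun do rewrite hmulE.
apply: (measurableT_comp (@measurable_snoc R (N + N))).
have m1 (j : 'I_(N + N + 1)) :
    measurable_fun setT (fun z : H * H => z.1 ord0 j : TR).
  exact: (measurableT_comp (measurable_coord j) measurable_fst).
have m2 (j : 'I_(N + N + 1)) :
    measurable_fun setT (fun z : H * H => z.2 ord0 j : TR).
  exact: (measurableT_comp (measurable_coord j) measurable_snd).
apply: measurable_fun_pair.
  apply: measurable_rVP => i; under eq_fun do rewrite !mxE.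
  by apply: measurable_funD; [exact: m1|exact: m2].
apply: measurable_funD; first by apply: measurable_funD; [exact: m1|exact: m2].
apply: measurable_funM => //; apply: measurable_sum => i.
under eq_fun do rewrite !mxE.
by apply: measurable_funB; apply: measurable_funM; do ?exact: m1; exact: m2.
Qed.

Definition horiz y : H := snoc (y, 0).

Lemma lsubmx_horiz y : lsubmx (horiz y) = y.
Proof. exact: lsubmx_snoc. Qed.

Lemma htau_horiz y : htau (horiz y) = 0.
Proof. exact: htau_snoc. Qed.

(* The value at [xi] of the left invariant vector field [\sum_j y_j X_j]. *)
Definition hfield y xi : H := snoc (y, 2^-1 * rsymp (lsubmx xi) y).

Lemma hmul_horiz y xi t : hmul xi (horiz (t *: y)) = xi + t *: hfield y xi.
Proof.
apply: hP; rewrite ?raddfD/= ?linearZ/= ?lsubmx_hmul ?htau_hmul ?lsubmx_horiz ?lsubmx_snoc//.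
by rewrite htau_horiz addr0 rsympZr htauD htauZ htau_snoc; ring.
Qed.

(** The field is constant along its own integral curves, since the symplectic form vanishes on the
    pair [y], [y]. The curves are therefore straight lines, and the flow is an affine one-parameter
    group. *)
Lemma hfield_line y xi t : hfield y (xi + t *: hfield y xi) = hfield y xi.
Proof.
rewrite /hfield; congr snoc; congr pair.
by rewrite raddfD/= linearZ/= lsubmx_snoc rsympDl rsympZl rsympvv mulr0 addr0.
Qed.

Lemma measurable_flow y : measurable_fun setT
  (fun z : H * TR => hmul z.1 (horiz (z.2 *: y))).
Proof.
suff m : measurable_fun setT (fun z : H * TR => (z.1, horiz (z.2 *: y))).
  exact: (measurableT_comp measurable_hmul m).
apply: measurable_fun_pair; first exact: measurable_fst.
apply: (measurableT_comp (@measurable_snoc R (N + N))).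
apply: measurable_fun_pair => //.
apply: measurable_rVP => i; under eq_fun do rewrite mxE.
by apply: measurable_funM => //; exact: measurable_snd.
Qed.

End heisenberg_translations.

(** * Functions of class C^k *)

Section line_derivatives.
Context {R : realType} {V : normedModType R}.
Implicit Types (f : V -> R) (x v w : V).

Lemma is_derive_eps f x v d :
  (forall e : R, 0 < e -> exists2 r : R, 0 < r &
     forall h : R, `|h| < r -> `|f (x + h *: v) - f x - h * d| <= e * `|h|) ->
  is_derive x v f d.
Proof.
move=> fd; have c : (h^-1 *: ((f \o shift x) (h *: v) - f x)) @[h --> 0^'] --> d.
  apply/cvgrPdist_le => e e0; have [r r0 rP] := fd _ e0.
  exists r => //= h; rewrite /= sub0r normrN => hr h0.
  rewrite [h *: v + x]addrC -[_ *: _]/(h^-1 * _).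
  have -> : d - h^-1 * (f (x + h *: v) - f x) =
      - ((f (x + h *: v) - f x - h * d) / h) by field.
  by rewrite normrN normrM normfV ler_pdivrMr ?normr_gt0//; exact: rP.
by split; [apply/cvg_ex; exists d|exact/cvg_lim].
Qed.

Lemma is_derive_line f x v s d : is_derive (x + s *: v) v f d ->
  is_derive s 1 (fun s => f (x + s *: v)) d.
Proof.
move=> [df dE].
have E : (fun h : R => h^-1 *: (((fun s => f (x + s *: v)) \o shift s) (h *: 1) - f (x + s *: v))) =
    (fun h : R => h^-1 *: ((f \o shift (x + s *: v)) (h *: v) - f (x + s *: v))).
  apply/funext => h /=; congr (_ *: (f _ - _)).
  by rewrite [h%:A]mulr1 scalerDl addrCA.
by split; rewrite /derivable /derive E.
Qed.

(** Strict differentiability along [v]: the estimate is uniform over base points [z] near [x]. This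
    uniformity makes the notion additive in the direction, which mere directional derivability is
    not. *)
Definition sdiff f x v d :=
  forall e : R, 0 < e -> exists2 r : R, 0 < r &
    forall (z : V) (h : R), `|z - x| < r -> `|h| < r ->
    `|f (z + h *: v) - f z - h * d| <= e * `|h|.

Lemma sdiff_derive f x v d : sdiff f x v d -> is_derive x v f d.
Proof.
move=> fd; apply: is_derive_eps => e /fd[r r0 rP]; exists r => // h hr.
by apply: rP => //; rewrite subrr normr0.
Qed.

Lemma sdiff0 f x : sdiff f x 0 0.
Proof.
move=> e e0; exists 1 => // z h _ _.
by rewrite scaler0 addr0 subrr mulr0 subr0 normr0 mulr_ge0// ltW.
Qed.

Lemma sdiffZ f x v d a : sdiff f x v d -> sdiff f x (a *: v) (a * d).
Proof.
have [->|a0] := eqVneq a 0; first by rewrite scale0r mul0r => _; exact: sdiff0.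
have na0 : 0 < `|a| by rewrite normr_gt0.
move=> fd e e0; have [|r r0 rP] := fd (e / `|a|); first by rewrite divr_gt0.
exists (Num.min r (r / `|a|)); first by rewrite lt_min r0 divr_gt0.
move=> z h; rewrite lt_min => /andP[zr _]; rewrite lt_min => /andP[_ hr].
have har : `|h * a| < r by rewrite normrM -ltr_pdivlMr.
have := rP _ _ zr har; rewrite scalerA [h * (a * d)]mulrA normrM.
by rewrite (_ : e / `|a| * (`|h| * `|a|) = e * `|h|)//; field; rewrite gt_eqF.
Qed.

Lemma sdiffD f x v w d d' : sdiff f x v d -> sdiff f x w d' ->
  sdiff f x (v + w) (d + d').
Proof.
move=> fd fd' e e0; have e20 : 0 < e / 2 by rewrite divr_gt0.
have [r r0 rP] := fd _ e20; have [r' r'0 r'P] := fd' _ e20.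
pose q := Num.min r (Num.min (r' / 2) (r' / 2 / (`|v| + 1))).
have v1 : 0 < `|v| + 1 by rewrite ltr_wpDl.
exists q; first by rewrite !lt_min r0 !divr_gt0.
move=> z h; rewrite !lt_min => /andP[zr /andP[zr' _]].
move=> /andP[hr /andP[hr2 hr']].
have zhr : `|z + h *: v - x| < r'.
  rewrite addrAC (le_lt_trans (ler_normD _ _))// (splitr r') ltrD//.
  rewrite normrZ; apply: le_lt_trans (_ : `|h| * (`|v| + 1) < _).
    by rewrite ler_wpM2l// lerDl.
  by rewrite -ltr_pdivlMr.
have hr'' : `|h| < r' by rewrite (lt_le_trans hr2)// ler_pdivrMr// ler_pMr// ler1n.
have := ler_normD (f (z + h *: v + h *: w) - f (z + h *: v) - h * d')
                  (f (z + h *: v) - f z - h * d).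
have -> : f (z + h *: v + h *: w) - f (z + h *: v) - h * d' +
   (f (z + h *: v) - f z - h * d) = f (z + h *: (v + w)) - f z - h * (d + d').
  by rewrite scalerDr [z + (_ + _)]addrA; ring.
move=> /le_trans; apply; rewrite (splitr e) mulrDl lerD//; first exact: r'P.
exact: rP.
Qed.

(** Mean value theorem on the segment from [z] to [z + h v]; the radius [q] keeps that segment
    within distance [r] of [x], where the derivative is within [e] of its value at [x]. *)
Lemma sdiff_continuous f x v : (forall z, derivable f z v) ->
  {for x, continuous (fun z => 'D_v f z)} -> sdiff f x v ('D_v f x).
Proof.
move=> df cf e e0.
move/cvgrPdist_le : cf => /(_ _ e0)/nbhs_ballP[r /= r0 rP].
pose q := Num.min (r / 2) (r / 2 / (`|v| + 1)).
have v1 : 0 < `|v| + 1 by rewrite ltr_wpDl.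
exists q; first by rewrite lt_min !divr_gt0.
move=> z h; rewrite !lt_min => /andP[zr _] /andP[_ hr].
pose F s := f (z + s *: v).
have dF (s : R) : is_derive s 1 F ('D_v f (z + s *: v)).
  by apply: is_derive_line; exact: derivableP.
have near_ (s : R) : `|s| <= `|h| -> `|'D_v f (z + s *: v) - 'D_v f x| <= e.
  move=> sh; rewrite distrC; apply: rP; rewrite -ball_normE/= opprD addrA.
  rewrite (le_lt_trans (ler_normB _ _))// (splitr r) ltrD//; first by rewrite distrC.
  rewrite normrZ; apply: le_lt_trans (_ : `|h| * (`|v| + 1) < _).
    by rewrite ler_pM// lerDl.
  by rewrite -ltr_pdivlMr.
have cF a b : {within `[a, b], continuous F}.
  by apply: derivable_within_continuous => s _; exact: ex_derive.
have F0 : F 0 = f z by rewrite /F scale0r addr0.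
rewrite -/(F h) -F0.
have [h0|h0] := leP 0 h.
  have [c] := MVT_segment h0 (fun s _ => dF s) (cF _ _).
  rewrite in_itv/= => /andP[c0 ch] ->.
  rewrite subr0 [X in X - _]mulrC -mulrBr normrM mulrC ler_wpM2r// near_//.
  by rewrite !ger0_norm.
have [c] := MVT_segment (ltW h0) (fun s _ => dF s) (cF _ _).
rewrite in_itv/= => /andP[c0 ch] E.
have -> : F h - F 0 = h * 'D_v f (z + c *: v).
  by apply: oppr_inj; rewrite opprB E; ring.
rewrite -mulrBr normrM mulrC ler_wpM2r// near_//.
by rewrite !ler0_norm ?lerN2// ltW.
Qed.

End line_derivatives.

Section class_C_closure.
Context {R : realType}.

Section basic.
Context {n : nat}.
Local Notation V := 'rV[R]_n.
Implicit Types (f g : V -> R).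

Lemma class_C_continuous k f : class_C k f -> continuous f.
Proof. by case: k => [|k] []. Qed.

Lemma class_CS k f : class_C k.+1 f -> class_C k f.
Proof.
elim: k f => [|k IH] f; first by move=> [].
move=> [cf df]; split=> // i; have [di ci] := df i; split=> //; exact: IH.
Qed.

Lemma class_C_derivable k f i x : class_C k.+1 f -> derivable f x (basis_vec i).
Proof. by move=> [_ /(_ i)[]]. Qed.

Lemma class_C_derive k f i : class_C k.+1 f ->
  class_C k (fun x => 'D_(basis_vec i) f x).
Proof. by move=> [_ /(_ i)[]]. Qed.

Lemma rV_basis (v : V) : v = \sum_i v ord0 i *: basis_vec i.
Proof. exact: row_sum_delta. Qed.

(** [class_C] records partial derivatives along basis vectors only. Continuity of these gives strict
    differentiability along each of them, and additivity then reaches every direction. *)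
Lemma class_C_sdiff k f x v : class_C k.+1 f ->
  sdiff f x v (\sum_i v ord0 i * 'D_(basis_vec i) f x).
Proof.
move=> cf; rewrite {1}(rV_basis v).
elim/big_ind2 : _ => [|v1 d1 v2 d2|i _]; [exact: sdiff0|exact: sdiffD|].
apply: sdiffZ; apply: sdiff_continuous => [z|]; first exact: class_C_derivable cf.
exact: (class_C_continuous (class_C_derive i cf)).
Qed.

Lemma class_C_is_derive k f x v : class_C k.+1 f ->
  is_derive x v f (\sum_i v ord0 i * 'D_(basis_vec i) f x).
Proof. by move=> cf; apply: sdiff_derive; exact: class_C_sdiff cf. Qed.

Lemma class_C_cst k c : class_C k (fun _ : V => c).
Proof.
elim: k c => [|k IH] c; split => //; try exact: cst_continuous.
move=> i; split => [x|]; first exact: derivable_cst.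
by rewrite (_ : 'D_(basis_vec i) _ = (fun=> 0))//; apply/funext => x; exact: derive_cst.
Qed.

Lemma class_CD k f g : class_C k f -> class_C k g -> class_C k (fun x => f x + g x).
Proof.
elim: k f g => [|k IH] f g cf cg.
  by split=> // x; apply: continuousD; [exact: cf.1|exact: cg.1].
split; first by move=> x; apply: continuousD; [exact: cf.1|exact: cg.1].
move=> i; split => [x|]; first by apply: derivableD; [exact: class_C_derivable cf|exact: class_C_derivable cg].
rewrite (_ : 'D_(basis_vec i) _ =
  (fun x => 'D_(basis_vec i) f x + 'D_(basis_vec i) g x)).
  by apply: IH; exact: class_C_derive.
by apply/funext => x; apply: deriveD; [exact: class_C_derivable cf|exact: class_C_derivable cg].
Qed.

Lemma class_CM k f g : class_C k f -> class_C k g -> class_C k (fun x => f x * g x).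
Proof.
elim: k f g => [|k IH] f g cf cg.
  by split=> // x; apply: continuousM; [exact: cf.1|exact: cg.1].
split; first by move=> x; apply: continuousM; [exact: cf.1|exact: cg.1].
move=> i; split => [x|]; first by apply: derivableM; [exact: class_C_derivable cf|exact: class_C_derivable cg].
rewrite (_ : 'D_(basis_vec i) _ =
  (fun x => f x * 'D_(basis_vec i) g x + g x * 'D_(basis_vec i) f x)).
  by apply: class_CD; apply: IH;
    do ?[exact: class_C_derive|exact: class_CS].
by apply/funext => x; apply: deriveM; [exact: class_C_derivable cf|exact: class_C_derivable cg].
Qed.

Lemma class_C_sum k I (s : seq I) (f : I -> V -> R) :
  (forall i, class_C k (f i)) -> class_C k (fun x => \sum_(i <- s) f i x).
Proof.
move=> cf; elim: s => [|i s IH].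
  by under eq_fun do rewrite big_nil; exact: class_C_cst.
by under eq_fun do rewrite big_cons; exact: class_CD.
Qed.

Lemma class_C_prod k I (s : seq I) (f : I -> V -> R) :
  (forall i, class_C k (f i)) -> class_C k (fun x => \prod_(i <- s) f i x).
Proof.
move=> cf; elim: s => [|i s IH].
  by under eq_fun do rewrite big_nil; exact: class_C_cst.
by under eq_fun do rewrite big_cons; exact: class_CM.
Qed.

(** The partial derivatives of [f \o T] are constant combinations of partial derivatives of [f]
    composed with [T], so induction on [k] closes. It is meant for group translations, which are
    affine maps with linear part [L]. *)
Lemma class_C_comp_affine k f (T L : V -> V) : continuous T ->
  (forall x v h, T (x + h *: v) = T x + h *: L v) ->
  class_C k f -> class_C k (f \o T).
Proof.
move=> cT TL; elim: k f => [|k IH] f cf.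
  by split=> // x; apply: continuous_comp; [exact: cT|exact: cf.1].
split; first by move=> x; apply: continuous_comp; [exact: cT|exact: cf.1].
move=> i.
have D x : is_derive x (basis_vec i) (f \o T)
    (\sum_j L (basis_vec i) ord0 j * ('D_(basis_vec j) f \o T) x).
  have [df <-] := class_C_is_derive (T x) (L (basis_vec i)) cf.
  have E : (fun h : R => h^-1 *: ((f \o T \o shift x) (h *: basis_vec i) - (f \o T) x)) =
      (fun h : R => h^-1 *: ((f \o shift (T x)) (h *: L (basis_vec i)) - f (T x))).
    by apply/funext => h /=; rewrite [h *: _ + x]addrC TL [_ + T x]addrC.
  by split; rewrite /derivable /derive E.
split => [x|]; first exact: ex_derive.
rewrite (_ : 'D_(basis_vec i) _ =
  (fun x => \sum_j L (basis_vec i) ord0 j * ('D_(basis_vec j) f \o T) x)).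
  apply: class_C_sum => j; apply: class_CM; first exact: class_C_cst.
  by apply: IH; exact: class_C_derive.
by apply/funext => x; exact: derive_val.
Qed.

End basic.
End class_C_closure.

(** * Test functions *)

Section flat_functions.
Context {R : realType}.

(* The functions [x^-k exp(-1/x)], extended by [0] to [x <= 0]; their span is
   stable under derivation. *)
Definition flat (k : nat) (x : R) : R :=
  if 0 < x then x^-1 ^+ k * expR (- x^-1) else 0.

Lemma flat_ge0 k x : 0 <= flat k x.
Proof.
rewrite /flat; case: ifPn => // x0; rewrite mulr_ge0 ?expR_ge0//.
by rewrite exprn_ge0// invr_ge0 ltW.
Qed.

(** Compares [exp (1/x)] with the term of degree [k + 2] of its series. Quadratic smallness is what
    makes the derivative at the origin exist and vanish. *)
Lemma flat_le_sqr k x : flat k x <= (k.+2)`!%:R * x ^+ 2.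
Proof.
rewrite /flat; case: ifPn => [x0|_]; last by rewrite mulr_ge0 ?sqr_ge0.
rewrite expRN ler_pdivrMr ?expR_gt0//.
have y0 : 0 <= x^-1 by rewrite invr_ge0 ltW.
have f0 : 0 < (k.+2)`!%:R :> R by rewrite ltr0n fact_gt0.
apply: (@le_trans _ _ ((k.+2)`!%:R * x ^+ 2 * (x^-1 ^+ k.+2 / (k.+2)`!%:R))).
  have -> : x^-1 ^+ k.+2 = x^-1 ^+ k * x^-1 ^+ 2 by rewrite -exprD addn2.
  move: (x^-1 ^+ k) f0 => z; move: (k.+2)`!%:R => c c0.
  by apply: le_of_eq; field; rewrite !gt_eqF.
apply: ler_wpM2l; first by apply: mulr_ge0; [exact: ltW|exact: sqr_ge0].
by apply: le_trans (expR_ge1Dxn k.+1 y0); rewrite lerDr.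
Qed.

Lemma is_derive_flat k (x : R) :
  is_derive x 1 (flat k) (- k%:R * flat k.+1 x + flat k.+2 x).
Proof.
have [x0|x0|->] := ltgtP x 0.
- rewrite {2 3}/flat ltNge (ltW x0)/= mulr0 addr0.
  apply: (@near_eq_is_derive _ _ _ (fun=> 0)).
  have := lt_nbhsl x0; apply: filterS => y y0.
  by rewrite /flat ltNge (ltW y0).
- apply: (@near_eq_is_derive R R R (fun y : R => y^-1 ^+ k * expR (- y^-1) : R)).
    have := lt_nbhsr x0; apply: filterS => y y0.
    by rewrite /flat y0.
  have xn0 : x != 0 by rewrite gt_eqF.
  have dV : is_derive x 1 (fun y : R => y^-1) (- x ^- 2).
    have [d e] : is_derive x 1 (fun y : R => y^-1) (- (x ^- 2) *: (1 : R)).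
      by apply: is_deriveV.
    by split => //; rewrite e; exact: mulr1.
  have dX := is_deriveX k dV.
  have dE : is_derive x 1 (fun y : R => expR (- y^-1)) (expR (- x^-1) * (x ^- 2)).
    apply: (@is_derive1_comp _ expR (fun y : R => - y^-1)).
    by rewrite -[x ^- 2]opprK; exact: is_deriveN.
  rewrite (_ : (fun y : R => y^-1 ^+ k * expR (- y^-1)) =
      ((fun y : R => y^-1) ^+ k) * (fun y : R => expR (- y^-1))); last first.
    by apply/funext => y /=; congr (_ * _); rewrite exprfctE.
  apply: is_derive_eq (is_deriveM dX dE) _.
  rewrite /flat x0 exprfctE -![_ *: _]/(_ * _); case: k {dX} => [|k].
    by rewrite !mul0r mulr0 addr0 oppr0 mul0r add0r expr0 mul1r; field.
  by rewrite /= !exprS; field.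
rewrite {2 3}/flat ltxx mulr0 addr0; apply: is_derive_eps => e e0.
have f0 : 0 < (k.+2)`!%:R :> R by rewrite ltr0n fact_gt0.
exists (e / (k.+2)`!%:R); first by rewrite divr_gt0.
move=> h he; rewrite add0r mulr0 subr0 {2}/flat ltxx subr0.
rewrite [h%:A]mulr1 ger0_norm ?flat_ge0//; apply: le_trans (flat_le_sqr _ _) _.
rewrite -real_normK ?num_real// expr2 mulrA ler_wpM2r//.
by rewrite mulrC -ler_pdivlMr// ltW.
Qed.

Lemma derive_flat k : 'D_1 (flat k) = fun x => - k%:R * flat k.+1 x + flat k.+2 x.
Proof. by apply/funext => x; have [_ ->] := is_derive_flat k x. Qed.

Lemma continuous_flat k : continuous (flat k).
Proof.
move=> x; apply/differentiable_continuous/derivable1_diffP.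
exact: (@ex_derive _ _ _ _ _ _ _ (is_derive_flat k x)).
Qed.

Lemma sdiff_flat k (x : R) : sdiff (flat k) x 1 (- k%:R * flat k.+1 x + flat k.+2 x).
Proof.
have [_ <-] := is_derive_flat k x; apply: sdiff_continuous.
  by move=> z; exact: (@ex_derive _ _ _ _ _ _ _ (is_derive_flat k z)).
rewrite derive_flat; apply: continuousD; last exact: continuous_flat.
by apply: continuousM; [exact: cst_continuous|exact: continuous_flat].
Qed.

Lemma class_C_flat n r k (i : 'I_n) (a b : R) :
  class_C r (fun v : 'rV[R]_n => flat k (a * v ord0 i + b)).
Proof.
elim: r k => [|r IH] k.
  split=> // v.
  apply: (@continuous_comp _ _ _ (fun v : 'rV[R]_n => a * v ord0 i + b) (flat k)).
    apply: (@class_C_continuous _ _ 0); apply: class_CD; last exact: class_C_cst.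
    by apply: class_CM; [exact: class_C_cst|split=> //; exact: coord_continuous].
  exact: continuous_flat.
split; first exact: (class_C_continuous (IH k)).
move=> j; pose c : R := a * (i == j)%:R.
have D v : is_derive v (basis_vec j) (fun v : 'rV[R]_n => flat k (a * v ord0 i + b))
   (c * (- k%:R * flat k.+1 (a * v ord0 i + b) + flat k.+2 (a * v ord0 i + b))).
  apply: is_derive_eps => e e0.
  have [d d0 dP] := sdiffZ c (sdiff_flat k (a * v ord0 i + b)) e0.
  exists d => // h hd.
  have := dP (a * v ord0 i + b) h _ hd; rewrite subrr normr0 => /(_ d0).
  rewrite (_ : a * (v + h *: basis_vec j) ord0 i + b =
      a * v ord0 i + b + h *: (c *: 1))//.
  rewrite !mxE eqxx/= -[h *: _]/(h * (c * 1)) /c; ring.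
split => [v|]; first exact: ex_derive.
rewrite (_ : 'D_(basis_vec j) _ = fun v => c *
  (- k%:R * flat k.+1 (a * v ord0 i + b) + flat k.+2 (a * v ord0 i + b))).
  apply: class_CM; first exact: class_C_cst.
  by apply: class_CD => //; apply: class_CM => //; exact: class_C_cst.
by apply/funext => v; exact: derive_val.
Qed.

End flat_functions.

Section plateau_functions.
Context {R : realType} {n : nat}.
Local Notation V := 'rV[R]_n.

(** Smooth approximations of the indicator of a box: each factor has the form [exp (-1/(k d))], with
    [d] a signed distance to a face, and tends to 1 where [d > 0]. The arguments are kept in the
    affine form required by [class_C_flat]. *)
Definition plateau (a b : V) (k : nat) (v : V) : R :=
  \prod_i (flat 0 (k%:R * v ord0 i - k%:R * a ord0 i) *
           flat 0 (- k%:R * v ord0 i + k%:R * b ord0 i)).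

Lemma smooth_plateau a b k : smooth (plateau a b k).
Proof.
by move=> r; apply: class_C_prod => i; apply: class_CM; exact: class_C_flat.
Qed.

Lemma flat0_le1 (x : R) : flat 0 x <= 1.
Proof.
rewrite /flat; case: ifPn => // x0.
by rewrite expr0 mul1r expR_le1 oppr_le0 invr_ge0 ltW.
Qed.

Lemma plateau_ge0 a b k v : 0 <= plateau a b k v.
Proof. by apply: prodr_ge0 => i _; rewrite mulr_ge0 ?flat_ge0. Qed.

Lemma plateau_le1 a b k v : plateau a b k v <= 1.
Proof.
by apply: prodr_ile1 => i _; rewrite mulr_ge0 ?flat_ge0//= mulr_ile1 ?flat_ge0 ?flat0_le1.
Qed.

Lemma plateau0 a b k v : ~ obox a b v -> plateau a b k v = 0.
Proof.
move=> /existsNP[i]; rewrite in_itv/= => /negP/nandP h.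
have k0 : 0 <= k%:R :> R by [].
rewrite /plateau (bigD1 i)//= [X in X * _](_ : _ = 0) ?mul0r//.
have -> : k%:R * v ord0 i - k%:R * a ord0 i = k%:R * (v ord0 i - a ord0 i) by ring.
have -> : - k%:R * v ord0 i + k%:R * b ord0 i = k%:R * (b ord0 i - v ord0 i) by ring.
apply/eqP; rewrite mulf_eq0 /flat.
by case: h; rewrite -leNgt => h; apply/orP; [left|right];
  rewrite ltNge mulr_ge0_le0// subr_le0.
Qed.

Lemma cvg_plateau (a b v : V) : plateau a b k v @[k --> \oo] --> (\1_(obox a b) v : R).
Proof.
have cvgS (x : R) : 0 < x -> flat 0 (k%:R * x) @[k --> \oo] --> (1 : R).
  move=> x0; apply/cvgrPdist_le => e e0.
  near=> k.
  have k0 : 0 < k%:R * x by rewrite mulr_gt0// ltr0n; near: k; exists 1%N.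
  rewrite ger0_norm ?subr_ge0 ?flat0_le1//.
  rewrite /flat k0 expr0 mul1r lerBlDr -lerBlDl.
  apply: le_trans (expR_ge1Dx _); rewrite lerD2l lerN2.
  rewrite -[leRHS]invrK lef_pV2 ?posrE ?invr_gt0//.
  rewrite -ler_pdivrMr//; near: k.
  exact: nbhs_infty_ger.
rewrite indicE; case: (boolP (v \in obox a b)) => [|/negP vab]; last first.
  rewrite /= (_ : (fun k => plateau a b k v) = (fun=> 0)); first exact: cvg_cst.
  by apply/funext => k; rewrite plateau0// => vab'; apply: vab; rewrite inE.
rewrite inE => vab; rewrite /= (_ : 1 = \prod_(i < n) (1 * 1)); last first.
  by rewrite big1// => i _; rewrite mulr1.
rewrite /plateau.
elim: (index_enum 'I_n) => [|i s IH].
  under eq_fun do rewrite big_nil; rewrite big_nil; exact: cvg_cst.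
under eq_fun do rewrite big_cons; rewrite big_cons.
apply: cvgM => //; have := vab i; rewrite in_itv/= => /andP[av vb].
apply: cvgM.
  rewrite (_ : (fun k : nat => _) =
    (fun k : nat => flat 0 (k%:R * (v ord0 i - a ord0 i)))).
    by apply: cvgS; rewrite subr_gt0.
  by apply/funext => k; congr flat; ring.
rewrite (_ : (fun k : nat => _) =
  (fun k : nat => flat 0 (k%:R * (b ord0 i - v ord0 i)))).
  by apply: cvgS; rewrite subr_gt0.
by apply/funext => k; congr flat; ring.
Unshelve. all: by end_near. Qed.

Lemma compact_closure_bounded (A : set V) : bounded_set A -> compact (closure A).
Proof.
move=> [M [Mreal MA]]; apply: bounded_closed_compact; last exact: closed_closure.
exists M; split => // x Mx.
have : closed [set v : V | `|v| <= x].
  have := @closed_closed_ball_ R V 0 x; rewrite /closed_ball_.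
  by under eq_set do rewrite sub0r normrN.
move=> /closure_id E v; have := @closure_subset _ A [set v | `|v| <= x].
rewrite -E; apply; exact: MA.
Qed.

Lemma bounded_obox (a b : V) : bounded_set (obox a b).
Proof.
pose M := \sum_i (`|a ord0 i| + `|b ord0 i|).
exists M; split; first exact: num_real.
move=> x Mx v vab; apply: le_trans (ltW Mx).
have M0 : 0 <= M by apply: sumr_ge0 => i _; rewrite addr_ge0.
rewrite (_ : `|v| = mx_norm v)// mx_normrE; apply/bigmax_leP; split => // -[i j] _ /=.
rewrite (ord1 i) /M (bigD1 j)//= (le_trans (_ : _ <= `|a ord0 j| + `|b ord0 j|))//.
  have := vab j; rewrite in_itv/= ler_norml => /andP[av vb]; apply/andP; split.
    rewrite lerNl; apply: le_trans (_ : - a ord0 j <= _); first by rewrite lerN2 ltW.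
    by rewrite (le_trans (ler_norm _))// normrN lerDl.
  by rewrite (le_trans (ltW vb))// (le_trans (ler_norm _))// lerDr.
by rewrite lerDl; apply: sumr_ge0 => k _; rewrite addr_ge0.
Qed.

Lemma compactly_supported_plateau a b k :
  compactly_supported setT (plateau a b k).
Proof.
split=> //; apply: compact_closure_bounded.
have [M [Mr MP]] := bounded_obox a b; exists M; split => // x /MP{}MP v /= v0.
by apply: MP; apply: contrapT => /(plateau0 k) E; rewrite E eqxx in v0.
Qed.

End plateau_functions.

(** * Fundamental lemma of the calculus of variations *)

Section density_measure.
Local Open Scope ereal_scope.
Context d (T : measurableType d) (R : realType) (mu : {measure set T -> \bar R}).
Variables (h : T -> \bar R) (h0 : forall x, 0 <= h x) (mh : measurable_fun setT h).

Definition density (A : set T) := \int[mu]_(x in A) h x.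

Let density0 : density set0 = 0. Proof. exact: integral_set0. Qed.

Let density_ge0 A : 0 <= density A. Proof. exact: integral_ge0. Qed.

Let density_sigma_additive : semi_sigma_additive density.
Proof. exact: semi_sigma_additive_nng_induced. Qed.

Definition density_measure : {measure set T -> \bar R} :=
  HB.pack density (isMeasure.Build _ _ _ density density0 density_ge0
    density_sigma_additive).

End density_measure.

Section fundamental_lemma.
Context {R : realType} {n : nat}.
Local Notation V := 'rV[R]_n.
Local Notation mu := (leb n).
Implicit Types W : V -> R.

(** After restriction of [W] to a cube, its positive and negative parts are densities of two finite
    measures. The intersection of a box with the cube is again a box, so these measures agree on
    boxes, hence on all Borel sets. *)
Lemma obox_integral_eq0 W : measurable_fun setT W ->
  (forall a b : V, mu.-integrable (obox a b) (EFin \o W)) ->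
  (forall a b : V, (\int[mu]_(x in obox a b) (W x)%:E = 0)%E) ->
  {ae mu, forall x, W x = 0}.
Proof.
move=> mW iW W0.
have key m : {ae mu, forall x, cube m x -> W x = 0}.
  pose F : V -> \bar R := (EFin \o W) \_ (cube m).
  have mc : measurable (cube m : set V) by exact: measurable_obox.
  have iF : mu.-integrable setT F by apply/(integrable_mkcond _ mc); exact: iW.
  have mF : measurable_fun setT F by exact: measurable_int iF.
  have mFp := measurable_funepos mF; have mFn := measurable_funeneg mF.
  have ip A : measurable A -> (\int[mu]_(x in A) (F^\+) x)%E \is a fin_num.
    move=> mA; apply: integrable_fin_num => //; apply: integrable_funepos => //.
    exact: integrableS iF.
  have in_ A : measurable A -> (\int[mu]_(x in A) (F^\-) x)%E \is a fin_num.
    move=> mA; apply: integrable_fin_num => //; apply: integrable_funeneg => //.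
    exact: integrableS iF.
  have pn A : measurable A ->
      (\int[mu]_(x in A) (F^\+) x = \int[mu]_(x in A) (F^\-) x)%E.
    pose m1 := density_measure mu (funepos_ge0 F) mFp.
    pose m2 := density_measure mu (funeneg_ge0 F) mFn.
    apply: (@measure_rV_unique R n m1 m2) => [a b _|k]; last first.
      by rewrite ltey_eq ip//; exact: measurable_obox.
    have mab := measurable_obox a b.
    suff : (\int[mu]_(x in obox a b) F x = 0)%E.
      rewrite integralE -(fineK (ip _ mab)) -(fineK (in_ _ mab)) -EFinB.
      by move=> [/subr0_eq E]; rewrite /= /density -(fineK (ip _ mab)) -(fineK (in_ _ mab)) E.
    rewrite /F -integral_mkcondr.
    have [c [e ->]] : oboxes (obox a b `&` cube m).
      by apply: setI_closed_oboxes; [exists a, b|eexists; eexists].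
    exact: W0.
  have F0 : ae_eq mu setT F (cst 0%E).
    apply: integral_ae_eq => // A _ mA.
    by rewrite integralE pn// subee ?in_// integral0.
  apply: filterS F0 => x /(_ I); rewrite /F/= /patch => + cx.
  by rewrite mem_set// => -[].
have : {ae mu, forall x k, cube k x -> W x = 0}.
  exact/ae_foralln.
apply: filterS => x h.
have [k _ kx] : (\bigcup_k cube k) x by rewrite cube_cover.
exact: h kx.
Qed.

(** Dominated convergence replaces the plateaus by the indicator of their box. Plateaus are thus the
    only test functions ever constructed. *)
Lemma plateau_integral_eq0 W : measurable_fun setT W ->
  (forall a b : V, mu.-integrable (obox a b) (EFin \o W)) ->
  (forall a b k, \int[mu]_x (W x * plateau a b k x) = 0) ->
  {ae mu, forall x, W x = 0}.
Proof.
move=> mW iW W0; apply: obox_integral_eq0 => // a b.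
have mab := measurable_obox a b.
pose g := (fun x => `|(EFin \o W) x|%E) \_ (obox a b).
have ig : mu.-integrable setT g.
  by apply/(integrable_mkcond _ mab); apply: integrable_abse.
have mpl k : measurable_fun setT (plateau a b k).
  by apply: continuous_measurable_rV; exact: (class_C_continuous (@smooth_plateau R n a b k 0)).
have le_g k x : (`|(W x * plateau a b k x)%:E| <= g x)%E.
  rewrite /g /patch; case: ifPn => [|xab]; last first.
    rewrite plateau0 ?mulr0 ?abse0// => xab'.
    by move/negP : xab; apply; rewrite inE.
  move=> _; rewrite /= lee_fin normrM ler_piMr// ger0_norm ?plateau_ge0//.
  exact: plateau_le1.
have mWp k : measurable_fun setT (fun x => (W x * plateau a b k x)%:E).
  by apply/measurable_EFinP; exact: measurable_funM.
have iWp k : mu.-integrable setT (fun x => (W x * plateau a b k x)%:E).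
  apply: le_integrable ig => // x _; apply: le_trans (le_g k x) _.
  exact: lee_abs.
have [] := @dominated_convergence _ _ _ mu setT measurableT
  (fun k x => (W x * plateau a b k x)%:E) (fun x => (W x * \1_(obox a b) x)%:E) g.
- exact: mWp.
- by apply/measurable_EFinP; apply: measurable_funM => //; exact: measurable_indic.
- apply: aeW => x _; apply: cvg_EFin; first exact: nearW.
  by apply: cvgM; [exact: cvg_cst|exact: cvg_plateau].
- exact: ig.
- by apply: aeW => x k _; exact: le_g.
move=> _ _; rewrite /= (_ : (fun k => _) = (fun=> 0%E)); last first.
  apply/funext => k; have := W0 a b k; rewrite /Rintegral.
  by move=> E; rewrite -[LHS]fineK ?E//; exact: integrable_fin_num.
move=> /(cvg_lim (@ereal_hausdorff R)); rewrite lim_cst// => E.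
rewrite integral_mkcond [RHS]E; apply: eq_integral => x _.
rewrite /patch indicE; case: ifPn => _; first by rewrite mulr1.
by rewrite mulr0.
Qed.

End fundamental_lemma.

(** * Group translations of test functions and derivatives along left invariant fields *)

Section smooth_translations.
Context {R : realType} {N : nat}.
Local Notation H := 'rV[R]_(N + N + 1).
Local Notation mu := (leb (N + N + 1)).
Local Notation TR := (measurableTypeR R).
Implicit Types (phi : H -> R) (h xi : H) (y : 'rV[R]_(N + N)).

Lemma continuous_coordP {T : topologicalType} {n} (F : T -> 'rV[R]_n) :
  (forall i, continuous (fun x => F x ord0 i)) -> continuous F.
Proof.
move=> cF x A [P MP sPA].
have hP : \forall z \near x, forall i, P ord0 i (F z ord0 i).
  apply: filter_forall => i; exact: cF (MP ord0 i).
apply: filterS hP => z Pz; apply: sPA => i j; rewrite (ord1 i); exact: Pz.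
Qed.

Lemma lsubmxD (xi eta : H) : lsubmx (xi + eta) = lsubmx xi + lsubmx eta.
Proof. exact: raddfD. Qed.

Lemma lsubmxZ t (xi : H) : lsubmx (t *: xi) = t *: lsubmx xi.
Proof. exact: linearZ. Qed.

Definition hmul_lin h xi : H := xi + snoc (0, 2^-1 * rsymp (lsubmx xi) (lsubmx h)).

Lemma hmul_affine h xi v t :
  hmul (xi + t *: v) h = hmul xi h + t *: hmul_lin h v.
Proof.
apply: hP; rewrite !(lsubmxD, lsubmxZ, lsubmx_hmul, htau_hmul, htauD, htauZ).
  by rewrite lsubmx_snoc addr0 addrAC.
by rewrite rsympDl rsympZl htau_snoc; ring.
Qed.

Lemma continuous_hmulr h : continuous (fun xi => hmul xi h).
Proof.
apply: continuous_coordP => i; apply: (@class_C_continuous _ _ 0).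
have cc (j : 'I_(N + N + 1)) : class_C 0 (fun xi : H => xi ord0 j).
  by split=> //; exact: coord_continuous.
have cs : class_C 0 (fun xi : H => rsymp (lsubmx xi) (lsubmx h)).
  apply: class_C_sum => j.
  rewrite (_ : (fun xi : H => _) = fun xi : H =>
    xi ord0 (lshift 1 (lshift N j)) * lsubmx h ord0 (rshift N j) +
    - lsubmx h ord0 (lshift N j) * xi ord0 (lshift 1 (rshift N j))).
    by apply: class_CD; apply: class_CM => //; exact: class_C_cst.
  by apply/funext => xi; rewrite !mxE; ring.
rewrite (_ : (fun xi => _) = fun xi : H => xi ord0 i + (h ord0 i +
    snoc (0, 2^-1) ord0 i * rsymp (lsubmx xi) (lsubmx h))).
  apply: class_CD => //; apply: class_CD; first exact: class_C_cst.
  by apply: class_CM => //; exact: class_C_cst.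
apply/funext => xi; rewrite hmulE.
case: (splitP i) => j ij.
  have -> : i = lshift 1 j by apply/val_inj.
  by rewrite !snocl !mxE/=; ring.
have -> : i = rshift (N + N) j by apply/val_inj.
by rewrite !snocr (ord1 j)/= /htau; ring.
Qed.

Lemma smooth_hmulr phi h : smooth phi -> smooth (fun xi => phi (hmul xi h)).
Proof.
move=> sphi k; apply: (@class_C_comp_affine _ _ k phi (fun xi => hmul xi h) (hmul_lin h)) => //.
  exact: continuous_hmulr.
by move=> x v t; exact: hmul_affine.
Qed.

Lemma compactly_supportedT (T : Type) phi (K : set H) :
  compact K -> (forall x, phi x != 0 -> K x) -> compactly_supported setT phi.
Proof.
move=> cK phiK; split=> //; have /closure_id clK : closed K by exact: compact_closed.
apply: (subclosed_compact _ cK); first exact: closed_closure.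
by rewrite clK; exact: closure_subset.
Qed.

Lemma compactly_supported_hmulr phi h : compactly_supported setT phi ->
  compactly_supported setT (fun xi => phi (hmul xi h)).
Proof.
move=> [cphi _]; apply: (@compactly_supportedT unit _
    ((fun xi => hmul xi (- h)) @` closure [set x | phi x != 0])).
  by apply: continuous_compact => //; apply: continuous_subspaceT; exact: continuous_hmulr.
move=> x px; exists (hmul x h); last exact: hmulVK.
exact: subset_closure.
Qed.

Lemma hmul_horizD xi y s t :
  hmul (hmul xi (horiz (s *: y))) (horiz (t *: y)) = hmul xi (horiz ((s + t) *: y)).
Proof. by rewrite !hmul_horiz hfield_line -addrA -scalerDl. Qed.

Lemma hfield_hmul xi y s : hfield y (hmul xi (horiz (s *: y))) = hfield y xi.
Proof. by rewrite hmul_horiz hfield_line. Qed.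

Definition hderiv y phi xi : R := 'D_(hfield y xi) phi xi.

(** The field is invariant under its own flow, so differentiation along it commutes with the flow.
    For right translations in other directions this fails, since the left invariant fields do not
    commute. *)
Lemma hderiv_hmul y phi s xi :
  hderiv y (fun xi => phi (hmul xi (horiz (s *: y)))) xi =
  hderiv y phi (hmul xi (horiz (s *: y))).
Proof.
rewrite /hderiv /derive.
suff E : (fun t : R => t^-1 *: (((fun xi => phi (hmul xi (horiz (s *: y)))) \o
      shift xi) (t *: hfield y xi) - phi (hmul xi (horiz (s *: y))))) =
    (fun t : R => t^-1 *: ((phi \o shift (hmul xi (horiz (s *: y))))
      (t *: hfield y (hmul xi (horiz (s *: y)))) - phi (hmul xi (horiz (s *: y))))).
  by rewrite E.
apply/funext => t /=; congr (_ *: (phi _ - _)).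
rewrite [t *: _ + xi]addrC [t *: _ + hmul _ _]addrC -hmul_horiz hmul_horizD.
by rewrite hfield_hmul -[in RHS](hfield_hmul xi y s) -hmul_horiz hmul_horizD addrC.
Qed.

Lemma rsymp_basisl v (i : 'I_N) :
  rsymp v (delta_mx ord0 (lshift N i)) = - v ord0 (rshift N i) :> R.
Proof.
rewrite /rsymp (bigD1 i)//= big1 => [|k ki]; rewrite !mxE !eqxx.
  by rewrite eq_rlshift /=; ring.
by rewrite eq_rlshift eq_lshift (negbTE ki)/=; ring.
Qed.

Lemma rsymp_basisr v (i : 'I_N) :
  rsymp v (delta_mx ord0 (rshift N i)) = v ord0 (lshift N i) :> R.
Proof.
rewrite /rsymp (bigD1 i)//= big1 => [|k ki]; rewrite !mxE !eqxx.
  by rewrite eq_lrshift /=; ring.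
by rewrite eq_lrshift eq_rshift (negbTE ki)/=; ring.
Qed.

Lemma hderivE y phi k xi : class_C k.+1 phi ->
  hderiv y phi xi = \sum_j y ord0 j * hvf j phi xi.
Proof.
move=> cphi; rewrite /hderiv.
have [_ ->] := class_C_is_derive xi (hfield y xi) cphi.
rewrite big_split_ord/= big_ord1 /hfield snocr/=.
have -> : rsymp (lsubmx xi) y =
    \sum_j y ord0 j * rsymp (lsubmx xi) (delta_mx ord0 j).
  by rewrite [in LHS](row_sum_delta y) rsymp_sumr; apply: eq_bigr => j _; rewrite rsympZr.
rewrite mulr_sumr mulr_suml -big_split/=; apply: eq_bigr => j _.
rewrite snocl mulrCA -mulrA -mulrDr; congr (_ * _).
rewrite /hvf; case: (fintype.splitP j) => i ji.
  have -> : j = lshift N i by apply/val_inj.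
  rewrite rsymp_basisl; congr (_ + _); rewrite /hx mxE; ring.
have -> : j = rshift N i by apply/val_inj.
rewrite rsymp_basisr; congr (_ + _); rewrite /hx mxE; ring.
Qed.

End smooth_translations.

(** * Integrability *)

Section p_integrable.
Context {d} {T : measurableType d} {R : realType} (mu : {measure set T -> \bar R}).
Implicit Types (u w : T -> R) (p : R).

Definition pint p u : \bar R := (\int[mu]_x (`|u x| `^ p)%:E)%E.

Definition Lp p u := measurable_fun setT u /\ (pint p u < +oo)%E.

(** The multipliers used in all duality arguments. Test functions and indicators of sets of finite
    measure belong to this class; it is stable under measure preserving substitutions and under
    bounded measurable factors, and a member times an [L^p] function is integrable. *)
Definition bint w := [/\ measurable_fun setT w, mu.-integrable setT (EFin \o w)
  & exists M : R, forall x, `|w x| <= M].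

Lemma measurable_powR_norm p u : measurable_fun setT u ->
  measurable_fun setT (fun x => `|u x| `^ p).
Proof.
move=> mu_; apply: (measurableT_comp (measurable_powR _)).
exact: measurableT_comp.
Qed.

Lemma emeasurable_powR_norm p u : measurable_fun setT u ->
  measurable_fun setT (fun x => (`|u x| `^ p)%:E).
Proof. by move=> mu_; apply/measurable_EFinP; exact: measurable_powR_norm. Qed.

Lemma pint_ge0 p u : (0 <= pint p u)%E.
Proof. by apply: integral_ge0 => x _; rewrite lee_fin powR_ge0. Qed.

Lemma le_powR_norm1 p (a : R) : 1 <= p -> 0 <= a -> a <= 1 + a `^ p.
Proof.
move=> p1 a0; have [a1|a1] := leP a 1; first by rewrite (le_trans a1)// lerDl powR_ge0.
rewrite -[leLHS]powRr1// (@le_trans _ _ (a `^ p))//; last by rewrite lerDr.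
by rewrite ler_powR// ltW.
Qed.

Lemma Lp_le p u w : 0 <= p -> measurable_fun setT u -> Lp p w ->
  (forall x, `|u x| <= `|w x|) -> Lp p u.
Proof.
move=> p0 mu_ [mw wp] uw; split; [exact: mu_|apply: le_lt_trans wp].
apply: ge0_le_integral => //.
- exact: emeasurable_powR_norm.
- exact: emeasurable_powR_norm.
by move=> x _; rewrite lee_fin ge0_ler_powR ?nnegrE.
Qed.

Lemma bint_norm w : bint w -> bint (fun x => `|w x|).
Proof.
move=> [mw iw [M wM]]; split; first exact: measurableT_comp.
  exact: integrable_norm.
by exists M => x; rewrite normr_id.
Qed.

Lemma bint_bounded w : bint w -> exists M : R, 0 <= M /\ forall x, `|w x| <= M.
Proof.
move=> [_ _ [M wM]]; exists (Num.max M 0); rewrite le_max lexx orbT; split => // x.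
by rewrite (le_trans (wM x))// le_max lexx.
Qed.

(** From [|u| <= 1 + |u|^p]. This crude bound stands in for Hölder's inequality and is additive,
    hence easy to carry through Tonelli. *)
Lemma Lp_mul_bound p u w M x : 1 <= p -> `|w x| <= M ->
  `|u x * w x| <= `|w x| + M * `|u x| `^ p.
Proof.
move=> p1 wM; rewrite normrM.
apply: (@le_trans _ _ ((1 + `|u x| `^ p) * `|w x|)).
  by rewrite ler_wpM2r// le_powR_norm1.
by rewrite mulrDl mul1r lerD2l mulrC ler_wpM2r// powR_ge0.
Qed.

Lemma Lp_mul_le p u w M : 1 <= p -> measurable_fun setT u ->
  measurable_fun setT w -> 0 <= M -> (forall x, `|w x| <= M) ->
  (\int[mu]_x `|(u x * w x)%:E| <= \int[mu]_x `|w x|%:E + M%:E * pint p u)%E.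
Proof.
move=> p1 mu_ mw M0 wM.
have mpow : measurable_fun setT (fun x => (`|u x| `^ p)%:E).
  exact: emeasurable_powR_norm.
have mnw : measurable_fun setT (fun x => `|w x|%:E).
  by apply/measurable_EFinP; exact: measurableT_comp.
rewrite /pint -ge0_integralZl//.
rewrite -ge0_integralD//; last exact: measurable_funeM.
apply: ge0_le_integral => //.
- by apply: measurableT_comp => //; apply/measurable_EFinP; exact: measurable_funM.
- by apply: emeasurable_funD => //; exact: measurable_funeM.
- by move=> x _; rewrite lee_fin; exact: Lp_mul_bound.
by move=> x _; rewrite mule_ge0// lee_fin.
Qed.

Lemma Lp_integrable_powR p u : Lp p u ->
  mu.-integrable setT (fun x => (`|u x| `^ p)%:E).
Proof.
move=> [mu_ up]; apply/integrableP; split.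
  exact: emeasurable_powR_norm.
apply: le_lt_trans up; apply: le_of_eq.
by apply: eq_integral => x _; rewrite gee0_abs// lee_fin powR_ge0.
Qed.

Lemma Lp_bint p u w : 1 <= p -> Lp p u -> bint w ->
  mu.-integrable setT (fun x => (u x * w x)%:E).
Proof.
move=> p1 uL wb; have [M [M0 wM]] := bint_bounded wb.
have [mw iw _] := wb; have [mu_ _] := uL.
have ig : mu.-integrable setT (fun x => (`|w x|)%:E + M%:E * (`|u x| `^ p)%:E)%E.
  apply: integrableD => //; first exact: integrable_norm.
  by apply: integrableZl => //; exact: Lp_integrable_powR.
apply: le_integrable ig => //; first by apply/measurable_EFinP; exact: measurable_funM.
move=> x _; rewrite /= lee_fin [leRHS]ger0_norm; first exact: Lp_mul_bound.
by rewrite addr_ge0// mulr_ge0// powR_ge0.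
Qed.

Lemma pint_comp p u (f : T -> T) : mpres mu f -> measurable_fun setT u ->
  pint p (u \o f) = pint p u.
Proof.
move=> mf mu_; have m : measurable_fun setT (fun z => (`|u z| `^ p)%:E).
  exact: emeasurable_powR_norm.
by apply: (mpres_integral mf m) => x; rewrite lee_fin powR_ge0.
Qed.

Lemma Lp_comp p u (f : T -> T) : mpres mu f -> Lp p u -> Lp p (u \o f).
Proof.
move=> mf [mu_ up]; split; last by rewrite pint_comp.
by apply: measurableT_comp => //; exact: mf.1.
Qed.

Lemma bint_comp w (f : T -> T) : mpres mu f -> bint w -> bint (w \o f).
Proof.
move=> mf [mw iw [M wM]]; split.
- by apply: measurableT_comp => //; exact: mf.1.
- exact: (mpres_integrable mf iw).
- by exists M => x; exact: wM.
Qed.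

Lemma bint_indic (A : set T) : measurable A -> (mu A < +oo)%E -> bint (\1_A).
Proof.
move=> mA Aoo; split; first exact: measurable_indic.
  apply/integrableP; split; first by apply/measurable_EFinP; exact: measurable_indic.
  under eq_integral do rewrite /= ger0_norm//.
  by rewrite integral_indic// setIT.
by exists 1 => x; rewrite indicE; case: (_ \in _) => /=; rewrite ?normr1 ?normr0.
Qed.

End p_integrable.

Lemma ae_eq_integrable {d} {T : measurableType d} {R : realType}
    (mu : {measure set T -> \bar R}) (f g : T -> R) :
  measurable_fun setT f -> {ae mu, forall x, f x = g x} ->
  mu.-integrable setT (EFin \o g) -> mu.-integrable setT (EFin \o f).
Proof.
move=> mf fg /integrableP[mg goo]; have mf' : measurable_fun setT (EFin \o f).
  exact/measurable_EFinP.
apply/integrableP; split => //; apply: le_lt_trans goo.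
apply: le_of_eq; apply: ge0_ae_eq_integral => //.
- exact: measurableT_comp.
- exact: measurableT_comp.
- by apply: filterS fg => x h _; rewrite /= h.
Qed.

Lemma ae_eq_Rintegral {d} {T : measurableType d} {R : realType}
    (mu : {measure set T -> \bar R}) (f g : T -> R) :
  measurable_fun setT f -> measurable_fun setT g ->
  {ae mu, forall x, f x = g x} -> \int[mu]_x f x = \int[mu]_x g x.
Proof.
move=> mf mg fg; congr fine; apply: ae_eq_integral => //.
- exact/measurable_EFinP.
- exact/measurable_EFinP.
- by apply: filterS fg => x h _; rewrite h.
Qed.

Section real_integrable.
Context {d} {T : measurableType d} {R : realType} (mu : {measure set T -> \bar R}).
Implicit Types f g : T -> R.

Lemma integrable_EFinD f g : mu.-integrable setT (EFin \o f) ->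
  mu.-integrable setT (EFin \o g) -> mu.-integrable setT (EFin \o (fun x => f x + g x)).
Proof. by move=> fi gi; exact: (integrableD measurableT fi gi). Qed.

Lemma integrable_EFinB f g : mu.-integrable setT (EFin \o f) ->
  mu.-integrable setT (EFin \o g) -> mu.-integrable setT (EFin \o (fun x => f x - g x)).
Proof. by move=> fi gi; exact: (integrableB measurableT fi gi). Qed.

Lemma integrable_EFinZ k f : mu.-integrable setT (EFin \o f) ->
  mu.-integrable setT (EFin \o (fun x => k * f x)).
Proof. by move=> fi; exact: (integrableZl measurableT k fi). Qed.

Lemma integrable_EFin_cst (c : R) : (mu setT < +oo)%E ->
  mu.-integrable setT (EFin \o (fun=> c)).
Proof.
move=> muoo; apply/integrableP; split; first exact/measurable_EFinP.
by rewrite /= integral_cst//= lte_mul_pinfty// lee_fin.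
Qed.

Lemma integral_normZ (k : R) f : measurable_fun setT f ->
  (\int[mu]_x `|k * f x|%:E = `|k|%:E * \int[mu]_x `|f x|%:E)%E.
Proof.
move=> mf; under eq_integral do rewrite normrM EFinM.
by rewrite ge0_integralZl//; apply/measurable_EFinP; exact: measurableT_comp.
Qed.

Lemma measurable_EFin_integrable f : mu.-integrable setT (EFin \o f) ->
  measurable_fun setT f.
Proof. by move=> /measurable_int/measurable_EFinP. Qed.

End real_integrable.

Section real_fubini.
Context {d1 d2} {T1 : measurableType d1} {T2 : measurableType d2} {R : realType}.
Variables (m1 : {sigma_finite_measure set T1 -> \bar R})
          (m2 : {sigma_finite_measure set T2 -> \bar R}).
Variable f : T1 * T2 -> R.
Hypothesis fi : (m1 \x m2)%E.-integrable setT (EFin \o f).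

Let ae1 : ae_eq m1 setT (EFin \o (fun x => \int[m2]_y f (x, y)))
  (fubini_F m2 (EFin \o f)).
Proof.
apply: filterS (ae_integrable1 fi) => x ix _.
by rewrite /Rintegral/= fineK//; exact: integrable_fin_num ix.
Qed.

Let ae2 : ae_eq m2 setT (EFin \o (fun y => \int[m1]_x f (x, y)))
  (fubini_G m1 (EFin \o f)).
Proof.
apply: filterS (ae_integrable2 fi) => x ix _.
by rewrite /Rintegral/= fineK//; exact: integrable_fin_num ix.
Qed.

Let mf1 : measurable_fun setT (EFin \o (fun x => \int[m2]_y f (x, y))).
Proof.
apply/measurable_EFinP; apply: (measurableT_comp (fine_measurable measurableT)).
exact: measurable_fubini_F fi.
Qed.

Let mf2 : measurable_fun setT (EFin \o (fun y => \int[m1]_x f (x, y))).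
Proof.
apply/measurable_EFinP; apply: (measurableT_comp (fine_measurable measurableT)).
exact: measurable_fubini_G fi.
Qed.

Lemma integrable_Rintegral1 : m1.-integrable setT (EFin \o (fun x => \int[m2]_y f (x, y))).
Proof.
apply/integrableP; split => //; have /integrableP[mF Foo] := integrable_fubini_F fi.
apply: le_lt_trans Foo; apply: le_of_eq.
apply: ge0_ae_eq_integral => //.
- exact: measurableT_comp.
- exact: measurableT_comp.
- by apply: filterS ae1 => x h xT; rewrite (h xT).
Qed.

Lemma integrable_Rintegral2 : m2.-integrable setT (EFin \o (fun y => \int[m1]_x f (x, y))).
Proof.
have mf : measurable_fun setT (EFin \o f) by exact: measurable_int fi.
apply/integrableP; split => //; have Foo := (integrable21ltyP _ _ mf).1 fi.
apply: le_lt_trans Foo; have mG := measurable_fubini_G fi.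
have -> : (\int[m2]_x `|(EFin \o (fun y => (\int[m1]_x f (x, y))%R)) x| =
    \int[m2]_x `|fubini_G m1 (EFin \o f) x|)%E.
  apply: ge0_ae_eq_integral => //.
  - exact: measurableT_comp.
  - exact: measurableT_comp.
  - by apply: filterS ae2 => x h xT; rewrite (h xT).
apply: ge0_le_integral => //.
- exact: measurableT_comp.
- apply: (measurable_fun_fubini_tonelli_G (fun z => `|(f z)%:E|%E)) => //.
  exact: measurableT_comp.
move=> y _; apply: le_abse_integral => //.
exact: (measurableT_comp mf).
Qed.

Lemma Rintegral_fubini :
  \int[m1]_x \int[m2]_y f (x, y) = \int[m2]_y \int[m1]_x f (x, y).
Proof.
rewrite /Rintegral; congr fine.
transitivity (\int[m1]_x fubini_F m2 (EFin \o f) x)%E.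
  apply: (@ae_eq_integral _ _ _ m1 setT (fubini_F m2 (EFin \o f))
    (EFin \o (fun x => \int[m2]_y f (x, y)))) => //.
  exact: measurable_fubini_F fi.
transitivity (\int[m2]_x fubini_G m1 (EFin \o f) x)%E; first exact: Fubini fi.
symmetry; apply: (@ae_eq_integral _ _ _ m2 setT (fubini_G m1 (EFin \o f))
  (EFin \o (fun x => \int[m1]_y f (y, x)))) => //.
exact: measurable_fubini_G fi.
Qed.

End real_fubini.

Lemma measurable_Rintegral1 {d1 d2} {T1 : measurableType d1}
    {T2 : measurableType d2} {R : realType}
    (m : {sigma_finite_measure set T2 -> \bar R}) (f : T1 * T2 -> R) :
  measurable_fun setT f -> measurable_fun setT (fun x => \int[m]_y f (x, y)).
Proof.
move=> mf; apply: (measurableT_comp (fine_measurable measurableT)).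
have mF : measurable_fun setT (EFin \o f) by exact/measurable_EFinP.
rewrite (_ : (fun x => _) = fun x =>
    (fubini_F m ((EFin \o f)^\+)%E x - fubini_F m ((EFin \o f)^\-)%E x)%E).
  apply: emeasurable_funB.
  - apply: measurable_fun_fubini_tonelli_F; last by move=> z; exact: funepos_ge0.
    exact: measurable_funepos.
  - apply: measurable_fun_fubini_tonelli_F; last by move=> z; exact: funeneg_ge0.
    exact: measurable_funeneg.
apply/funext => x; rewrite integralE; congr (_ - _)%E.
  by apply: eq_integral => y _; rewrite -[fun _ => _]/((EFin \o f) \o (fun y => (x, y))) funepos_comp.
by apply: eq_integral => y _; rewrite -[fun _ => _]/((EFin \o f) \o (fun y => (x, y))) funeneg_comp.
Qed.

(** * Averages over the unit interval *)

Section average.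
Context {R : realType}.
Local Notation TR := (measurableTypeR R).

(** As a probability measure on the whole line, averaging over the unit interval needs no
    integration domain, and Fubini and Jensen apply to it directly. *)
Definition unif : {sigma_finite_measure set TR -> \bar R} :=
  uniform_prob (@ltr01 R).

Lemma integral_unif (f : R -> \bar R) : measurable_fun setT f ->
  (\int[unif]_s f s = \int[lebesgue_measure]_(s in `[0%R, 1%R]) f s)%E.
Proof.
move=> mf; rewrite [LHS]integralE [RHS]integralE.
have e (g : R -> \bar R) : measurable_fun setT g -> (forall x, 0 <= g x)%E ->
    (\int[unif]_s g s = \int[lebesgue_measure]_(s in `[0%R, 1%R]) g s)%E.
  by move=> mg g0; rewrite integral_uniform// subr0 invr1 mul1e.
by rewrite !e//; [exact: measurable_funeneg|exact: measurable_funepos].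
Qed.

Lemma unif_FTC (f F : R -> R) : continuous f ->
  (forall s : R, is_derive s 1 F (f s)) ->
  \int[unif]_s f s = F 1 - F 0.
Proof.
move=> cf dF; rewrite /Rintegral integral_unif; last first.
  by apply/measurable_EFinP; exact: continuous_measurable_fun.
rewrite (@continuous_FTC2 _ f F)//.
- exact: continuous_subspaceT.
- have cF : continuous F.
    move=> s; apply/differentiable_continuous/derivable1_diffP.
    exact: (@ex_derive _ _ _ _ _ _ _ (dF s)).
  split => [s _||]; first exact: (@ex_derive _ _ _ _ _ _ _ (dF s)).
    by apply: cvg_at_right_filter; exact: cF.
  by apply: cvg_at_left_filter; exact: cF.
- by move=> s _; rewrite derive1E; exact: (@derive_val _ _ _ _ _ _ _ (dF s)).
Qed.

Lemma unif_integrable (f : R -> R) (M : R) : measurable_fun setT (f : TR -> R) ->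
  (forall s, `|f s| <= M) -> unif.-integrable setT (EFin \o f).
Proof.
move=> mf fM; apply: measurable_bounded_integrable => //.
  by rewrite [X in (X < _)%E](_ : _ = 1%E) ?ltry//; exact: probability_setT.
by exists M; split; [exact: num_real|move=> x Mx z _; exact: le_trans (fM z) (ltW Mx)].
Qed.

Lemma unif_cst (c : R) : \int[unif]_s c = c.
Proof.
by rewrite Rintegral_cst// [X in fine X](_ : _ = 1%E) ?mulr1//; exact: probability_setT.
Qed.

End average.

(** * Weak derivatives along the flow of a left invariant field *)

Section line_identity.
Context {R : realType} {N : nat}.
Local Notation H := 'rV[R]_(N + N + 1).
Local Notation mu := (leb (N + N + 1)).
Local Notation TR := (measurableTypeR R).
Local Notation P := (@unif R).
Implicit Types (phi u g w : H -> R) (h xi : H) (y : 'rV[R]_(N + N)).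

Definition flow y (s : R) xi : H := hmul xi (horiz (s *: y)).

Lemma flow0 y xi : flow y 0 xi = xi.
Proof. by rewrite /flow hmul_horiz scale0r addr0. Qed.

Lemma flowD y s t xi : flow y t (flow y s xi) = flow y (s + t) xi.
Proof. exact: hmul_horizD. Qed.

Lemma mpres_flow y s : mpres mu (flow y s).
Proof. exact: mpres_hmulr. Qed.

Lemma compact_support_bint w : continuous w -> compactly_supported setT w ->
  bint mu w.
Proof.
move=> cw [cK _]; set K := closure _ in cK.
have w0 x : ~ K x -> w x = 0.
  move=> nK; apply: contrapT => /eqP wx; apply: nK; exact: subset_closure.
have mK : measurable K by apply: closed_measurable_rV; exact: closed_closure.
have [M wM] : exists M : R, forall x, `|w x| <= M.
  have : compact ((fun x => `|w x|) @` K).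
    apply: continuous_compact => //; apply: continuous_subspaceT => x.
    by apply: continuous_comp; [exact: cw|exact: norm_continuous].
  move=> /compact_bounded[M [_ MP]]; exists (Num.max (M + 1) 0) => x.
  have [Kx|/w0->] := pselect (K x); last by rewrite normr0 le_max lexx orbT.
  have := MP (M + 1); rewrite ltrDl ltr01 => /(_ isT `|w x|).
  by rewrite /= normr_id le_max => ->//; exists x.
have mw : measurable_fun setT w by exact: continuous_measurable_rV.
split=> //; last by exists M.
have -> : EFin \o w = (EFin \o w) \_ K.
  by apply/funext => x /=; rewrite /patch; case: ifPn => //; rewrite notin_setE => /w0 ->.
apply/(integrable_mkcond _ mK); apply: measurable_bounded_integrable => //.
- by apply: leb_bounded => //; exact: compact_bounded.
- exact: measurable_funTS.
- by exists M; split; [exact: num_real|move=> x Mx z _; exact: le_trans (wM z) (ltW Mx)].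
Qed.

Lemma continuous_hderiv y phi : class_C 1 phi -> continuous (hderiv y phi).
Proof.
move=> cphi.
have -> : hderiv y phi = fun xi => \sum_i hfield y xi ord0 i * 'D_(basis_vec i) phi xi.
  by apply/funext => xi; rewrite /hderiv; have [_ ->] := class_C_is_derive xi (hfield y xi) cphi.
apply: (@class_C_continuous _ _ 0); apply: class_C_sum => i.
apply: class_CM; last exact: class_C_derive cphi.
have -> : (fun xi => hfield y xi ord0 i) =
    fun xi => hmul xi (horiz y) ord0 i + -1 * xi ord0 i.
  apply/funext => xi; have := hmul_horiz y xi 1; rewrite !scale1r => ->.
  by move: (hfield y xi) => V; rewrite mxE; ring.
apply: class_CD; last first.
  apply: class_CM; [exact: class_C_cst|by split=> //; exact: coord_continuous].
split=> // xi; apply: (@continuous_comp _ _ _ (fun xi => hmul xi (horiz y)) (fun z : H => z ord0 i)).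
  exact: continuous_hmulr.
exact: coord_continuous.
Qed.

Lemma derive_off_support phi v x : ~ closure [set x | phi x != 0] x ->
  'D_v phi x = 0.
Proof.
move=> nK; rewrite -(derive_cst (0 : R) x v); apply: near_eq_derive.
have : open (~` closure [set x | phi x != 0]) by apply: closed_openC; exact: closed_closure.
rewrite openE => /(_ _ nK); apply: filterS => z nz; apply: contrapT => /eqP pz.
exact/nz/subset_closure.
Qed.

Lemma compactly_supported_hderiv y phi : compactly_supported setT phi ->
  compactly_supported setT (hderiv y phi).
Proof.
move=> [cK _]; apply: (@compactly_supportedT R N unit _ _ cK) => x.
by apply: contra_neqP => nK; exact: derive_off_support.
Qed.

Lemma bint_test phi : smooth phi -> compactly_supported setT phi -> bint mu phi.
Proof. by move=> sphi; apply: compact_support_bint; exact: (class_C_continuous (sphi 0)). Qed.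

Lemma bint_hderiv y phi : smooth phi -> compactly_supported setT phi ->
  bint mu (hderiv y phi).
Proof.
move=> sphi cphi; apply: compact_support_bint; first exact: continuous_hderiv.
exact: compactly_supported_hderiv.
Qed.

(** The time [a] is scaled out, so that the integral runs over the unit interval whatever the sign
    of [a]. *)
Lemma hderiv_FTC y phi xi a : class_C 1 phi ->
  phi (flow y a xi) - phi xi = \int[P]_s (a * hderiv y phi (flow y (s * a) xi)).
Proof.
move=> cphi; pose V := hfield y xi.
have VE s : hfield y (flow y s xi) = V by exact: hfield_hmul.
have fE s : flow y (s * a) xi = xi + s *: (a *: V).
  by rewrite /flow hmul_horiz scalerA.
pose F s := phi (xi + s *: (a *: V)).
have F1 : phi (flow y a xi) = F 1 by rewrite /F -fE mul1r.
have F0 : phi xi = F 0 by rewrite /F scale0r addr0.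
rewrite F1 F0; symmetry; apply: unif_FTC => [s|s]; last first.
  apply: is_derive_line; rewrite /hderiv VE -fE.
  have [_ ->] := class_C_is_derive (flow y (s * a) xi) V cphi.
  apply: is_derive_eq (class_C_is_derive (flow y (s * a) xi) (a *: V) cphi) _.
  by rewrite mulr_sumr; apply: eq_bigr => i _; rewrite mxE mulrA.
suff c : {for s : R, continuous (fun s : R => a * hderiv y phi (flow y (s * a) xi))}.
  exact: c.
apply: (@continuousM R R (fun=> a) (fun s : R => hderiv y phi (flow y (s * a) xi))).
  exact: cst_continuous.
apply: (@continuous_comp _ _ _ (fun s : R => flow y (s * a) xi) (hderiv y phi)).
  rewrite (_ : (fun s : R => _) = fun s : R => xi + s *: (a *: V)); last exact/funext.
  by apply: continuousD; [exact: cst_continuous|exact: scalel_continuous].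
exact: continuous_hderiv.
Qed.

(** Both substitutions preserve the measure for each [s], so the bound on the inner integral does
    not depend on [s] and integrates over a probability measure. This is the integrability that
    justifies every use of Fubini along flows. *)
Lemma prod_Lp_bint p u w (T1 T2 : H * TR -> H) : 1 <= p -> Lp mu p u -> bint mu w ->
  measurable_fun setT T1 -> measurable_fun setT T2 ->
  (forall s, mpres mu (fun xi => T1 (xi, s))) ->
  (forall s, mpres mu (fun xi => T2 (xi, s))) ->
  (mu \x P)%E.-integrable setT (fun z => (u (T1 z) * w (T2 z))%:E).
Proof.
move=> p1 uL wb mT1 mT2 pT1 pT2; have [M [M0 wM]] := bint_bounded wb.
have [mw iw _] := wb; have [mu_ up] := uL.
have mF : measurable_fun setT (fun z => (u (T1 z) * w (T2 z))%:E).
  by apply/measurable_EFinP; apply: measurable_funM;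
    [exact: (measurableT_comp mu_ mT1)|exact: (measurableT_comp mw mT2)].
apply/(integrable21ltyP _ _ mF).
pose C := (\int[mu]_x `|w x|%:E + M%:E * pint mu p u)%E.
have Coo : (C < +oo)%E.
  apply: lte_add_pinfty; first by have /integrableP[] := iw.
  by rewrite lte_mul_pinfty// lee_fin.
have le_C s : (\int[mu]_x `|(u (T1 (x, s)) * w (T2 (x, s)))%:E| <= C)%E.
  have muT1 : Lp mu p (fun x => u (T1 (x, s))) by exact: (Lp_comp (pT1 s) uL).
  have mwT2 : bint mu (fun x => w (T2 (x, s))) by exact: (bint_comp (pT2 s) wb).
  have [mwT _ _] := mwT2; have [muT _] := muT1.
  have := @Lp_mul_le _ _ _ mu p _ _ M p1 muT mwT M0 (fun x => wM (T2 (x, s))).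
  have -> : pint mu p (fun x => u (T1 (x, s))) = pint mu p u.
    exact: (pint_comp p (pT1 s) mu_).
  have -> // : (\int[mu]_x `|w (T2 (x, s))|%:E = \int[mu]_x `|w x|%:E)%E.
  apply: (mpres_integral (pT2 s) (h := fun z => `|w z|%:E)).
    by apply/measurable_EFinP; exact: measurableT_comp.
  by move=> x; rewrite lee_fin.
apply: (@le_lt_trans _ _ (\int[P]_s C)%E); last first.
  by rewrite integral_cst// [X in (_ * X)%E](_ : _ = 1%E) ?mule1//; exact: probability_setT.
apply: ge0_le_integral => //.
- by move=> s _; exact: integral_ge0.
- apply: (measurable_fun_fubini_tonelli_G (fun z => `|(u (T1 z) * w (T2 z))%:E|%E)) => //.
  exact: measurableT_comp.
Qed.

Lemma measurable_flow_pair y (a : R) :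
  measurable_fun setT (fun z : H * TR => flow y (z.2 * a) z.1).
Proof.
rewrite (_ : (fun z => _) = fun z : H * TR => hmul z.1 (horiz (z.2 *: (a *: y)))).
  exact: measurable_flow.
by apply/funext => z; rewrite /flow scalerA.
Qed.

Lemma measurable_flow_time w y (a : R) xi : measurable_fun setT w ->
  measurable_fun setT (fun s : TR => w (flow y (s * a) xi)).
Proof.
move=> mw; apply: (measurableT_comp mw).
have m : measurable_fun setT (fun s : TR => (xi, s)) by exact: measurable_fun_pair.
exact: (measurableT_comp (measurable_flow_pair y a) m).
Qed.

Section translation_tests.
Variables (p : R) (u : H -> R) (y : 'rV[R]_(N + N)).
Hypotheses (p1 : 1 <= p) (uL : Lp mu p u).

Let mu_ : measurable_fun setT u := uL.1.

Lemma integrable_flow_prod w a : bint mu w -> (mu \x P)%E.-integrable setT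
    (EFin \o (fun z => u (flow y (z.2 * a) z.1) * w z.1)).
Proof.
move=> bw.
apply: (@prod_Lp_bint p u w (fun z => flow y (z.2 * a) z.1) (fun z => z.1)) => //.
- exact: measurable_flow_pair.
- exact: measurable_fst.
- by move=> s; exact: (mpres_flow y (s * a)).
- by move=> s; exact: mpres_id.
Qed.

Lemma Rintegral_flow_shift w a : measurable_fun setT w ->
  \int[mu]_x (u x * w (flow y (- a) x)) = \int[mu]_x (u (flow y a x) * w x).
Proof.
move=> mw; rewrite -[LHS](mpres_Rintegral (mpres_flow y a)).
  by apply: eq_Rintegral => x _; rewrite flowD addrN flow0.
apply: measurable_funM => //; apply: (measurableT_comp mw).
exact: (mpres_flow y (- a)).1.
Qed.

(** The flow is moved onto the test function, the fundamental theorem is applied there, and the flow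
    is moved back. Only the test function is differentiated, so the formula also applies to [G \o u]
    before that function is known to have weak derivatives. *)
Lemma flow_difference_test phi a : smooth phi -> compactly_supported setT phi ->
  \int[mu]_x ((u (flow y a x) - u x) * phi x) =
  - a * \int[P]_s \int[mu]_x (u (flow y (s * a) x) * hderiv y phi x).
Proof.
move=> sphi cphi; have bphi := bint_test sphi cphi.
have bD := bint_hderiv y sphi cphi.
have i1 : mu.-integrable setT (EFin \o (fun x => u x * phi x)) by exact: Lp_bint uL bphi.
have i2 : mu.-integrable setT (EFin \o (fun x => u (flow y a x) * phi x)).
  exact: (Lp_bint p1 (Lp_comp (mpres_flow y a) uL) bphi).
have bphia : bint mu (phi \o flow y (- a)) by exact: (bint_comp (mpres_flow y (- a)) bphi).
have i3 : mu.-integrable setT (EFin \o (fun x => u x * phi (flow y (- a) x))).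
  exact: (Lp_bint p1 uL bphia).
have prod_u : (mu \x P)%E.-integrable setT
    (EFin \o (fun z => u z.1 * hderiv y phi (flow y (z.2 * - a) z.1))).
  apply: (@prod_Lp_bint p u _ (fun z => z.1) (fun z => flow y (z.2 * - a) z.1)) => //.
  - exact: measurable_fst.
  - exact: measurable_flow_pair.
  - by move=> s; exact: mpres_id.
  - by move=> s; exact: (mpres_flow y (s * - a)).
transitivity (\int[mu]_x (u x * (phi (flow y (- a) x) - phi x))).
  under eq_Rintegral do rewrite mulrBl.
  under [RHS]eq_Rintegral do rewrite mulrBr.
  rewrite !RintegralB//; congr (_ - _); symmetry; apply: Rintegral_flow_shift.
  by have [] := bphi.
transitivity (- a * \int[mu]_x \int[P]_s (u x * hderiv y phi (flow y (s * - a) x))).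
  rewrite -RintegralZl//; last exact: (integrable_Rintegral1 prod_u).
  have [mD _ [M DM]] := bD.
  have iD x : P.-integrable setT (EFin \o (fun s => hderiv y phi (flow y (s * - a) x))).
    by apply: (@unif_integrable _ _ M) => //; exact: measurable_flow_time.
  apply: eq_Rintegral => x _.
  have E c : \int[P]_s (c * hderiv y phi (flow y (s * - a) x)) =
      c * \int[P]_s hderiv y phi (flow y (s * - a) x).
    by apply: RintegralZl => //; exact: iD.
  by rewrite (hderiv_FTC y x (- a) (sphi 1%N)) !E mulrCA.
have [mD _ _] := bD.
rewrite (Rintegral_fubini prod_u); apply: (congr1 (fun z => - a * z)).
apply: eq_Rintegral => s _.
rewrite -(Rintegral_flow_shift (s * a) mD).
by apply: eq_Rintegral => x _; rewrite /= mulrN.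
Qed.

End translation_tests.

Section weak_derivative.
Variables (p : R) (u g : H -> R) (y : 'rV[R]_(N + N)).
Hypotheses (p1 : 1 <= p) (uL : Lp mu p u) (gL : Lp mu p g).

Definition weak_dir := forall phi, smooth phi -> compactly_supported setT phi ->
  \int[mu]_x (u x * hderiv y phi x) = - \int[mu]_x (g x * phi x).

Hypothesis weak : weak_dir.

Let mu_ : measurable_fun setT u := uL.1.
Let mg : measurable_fun setT g := gL.1.

Let prod_gw w a : bint mu w -> (mu \x P)%E.-integrable setT
    (EFin \o (fun z => g (flow y (z.2 * a) z.1) * w z.1)).
Proof. exact: (integrable_flow_prod y p1 gL). Qed.

(** For each [s] the weak derivative is tested with the translate of [phi] by the flow, which is
    again a test function and whose derivative along the field is the translated derivative. *)
Lemma weak_line_test phi a : smooth phi -> compactly_supported setT phi ->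
  \int[mu]_x ((u (flow y a x) - u x) * phi x) =
  a * \int[mu]_x \int[P]_s (g (flow y (s * a) x) * phi x).
Proof.
move=> sphi cphi; have bphi := bint_test sphi cphi.
have bD := bint_hderiv y sphi cphi.
rewrite (flow_difference_test y p1 uL a sphi cphi) (Rintegral_fubini (prod_gw a bphi)).
rewrite mulNr -mulrN; apply: (congr1 (fun z => a * z)); rewrite -mulN1r -RintegralZl//; last first.
  exact: (integrable_Rintegral2 (integrable_flow_prod y p1 uL a bD)).
apply: eq_Rintegral => s _ /=; rewrite mulN1r.
have mD : measurable_fun setT (hderiv y phi) by have [] := bD.
rewrite -(Rintegral_flow_shift y uL (s * a) mD).
have mphi : measurable_fun setT phi by have [] := bphi.
rewrite -(Rintegral_flow_shift y gL (s * a) mphi) -[RHS]opprK; apply: (congr1 -%R).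
rewrite -weak; [|exact: smooth_hmulr|exact: compactly_supported_hmulr].
by apply: eq_Rintegral => x _; rewrite hderiv_hmul.
Qed.

Let A a x := \int[P]_s g (flow y (s * a) x).

Let measurable_gflow a : measurable_fun setT (fun z : H * TR => g (flow y (z.2 * a) z.1)).
Proof. exact: (measurableT_comp mg (measurable_flow_pair y a)). Qed.

Let mA a : measurable_fun setT (A a).
Proof. exact: (measurable_Rintegral1 P (measurable_gflow a)). Qed.

Let bint_cube k : bint mu (\1_(cube k) : H -> R).
Proof. by apply: bint_indic; [exact: measurable_obox|exact: leb_cube]. Qed.

Lemma ae_integrable_flow a : {ae mu, forall x,
  P.-integrable setT (EFin \o (fun s => g (flow y (s * a) x)))}.
Proof.
(* Fubini needs an integrable weight, and [g] is only [p]-integrable on a space of infinite measure;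
   hence the restriction to cubes, of which countably many suffice. *)
have h k : {ae mu, forall x, P.-integrable setT
    (EFin \o (fun s => g (flow y (s * a) x) * \1_(cube k) x))}.
  exact: (ae_integrable1 (prod_gw a (bint_cube k))).
have : {ae mu, forall x k, P.-integrable setT
    (EFin \o (fun s => g (flow y (s * a) x) * \1_(cube k) x))}.
  exact/ae_foralln.
apply: filterS => x hx; have [k _ kx] : (\bigcup_k cube k) x by rewrite cube_cover.
have := hx k; rewrite indicE mem_set//=.
by under [X in _.-integrable _ (_ \o X) -> _]eq_fun do rewrite mulr1.
Qed.

Let ae_A w a : {ae mu, forall x, A a x * w x = \int[P]_s (g (flow y (s * a) x) * w x)}.
Proof. by apply: filterS (ae_integrable_flow a) => x ix; rewrite RintegralZr. Qed.

Lemma integrable_avg w a : bint mu w ->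
  mu.-integrable setT (EFin \o (fun x => A a x * w x)).
Proof.
move=> bw; apply: ae_eq_integrable (ae_A w a) _; last first.
  exact: (integrable_Rintegral1 (prod_gw a bw)).
by apply: measurable_funM => //; have [] := bw.
Qed.

Lemma Rintegral_avg w a : bint mu w ->
  \int[mu]_x (A a x * w x) = \int[mu]_x \int[P]_s (g (flow y (s * a) x) * w x).
Proof.
move=> bw; have [mw _ _] := bw; apply: ae_eq_Rintegral; last exact: ae_A.
  exact: measurable_funM.
apply: (@measurable_Rintegral1 _ _ _ _ _ P (fun z : H * TR => g (flow y (z.2 * a) z.1) * w z.1)).
have m2 : measurable_fun setT (fun z : H * TR => w z.1).
  exact: (measurableT_comp mw measurable_fst).
exact: measurable_funM (measurable_gflow a) m2.
Qed.

(** The difference of the two sides integrates to 0 against every plateau. The exceptional null set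
    depends on [a], so the identity is always used at a fixed flow time. *)
Lemma line_identity a : {ae mu, forall x,
  u (flow y a x) - u x = a * \int[P]_s g (flow y (s * a) x)}.
Proof.
pose W x := u (flow y a x) - u x - a * A a x.
suff : {ae mu, forall x, W x = 0} by apply: filterS => x /subr0_eq.
have iW w : bint mu w -> mu.-integrable setT (EFin \o (fun x => W x * w x)).
  move=> bw; rewrite (_ : _ \o _ = (fun x => (u (flow y a x) * w x)%:E - (u x * w x)%:E
      - a%:E * (A a x * w x)%:E)%E); last first.
    by apply/funext => x; rewrite /W; congr EFin; ring.
  apply: integrableB => //.
    apply: integrableB => //; last exact: Lp_bint uL bw.
    exact: (Lp_bint p1 (Lp_comp (mpres_flow y a) uL) bw).
  by apply: integrableZl => //; exact: integrable_avg.
have mW : measurable_fun setT W.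
  apply: measurable_funB; last by apply: measurable_funM => //; exact: mA.
  by apply: measurable_funB => //; apply: (measurableT_comp mu_); exact: (mpres_flow y a).1.
apply: plateau_integral_eq0 => // b c; last first.
  move=> k; set phi := plateau b c k.
  have sphi : smooth phi by exact: smooth_plateau.
  have cphi : compactly_supported setT phi by exact: compactly_supported_plateau.
  have bphi := bint_test sphi cphi.
  have i1 : mu.-integrable setT (EFin \o (fun x => (u (flow y a x) - u x) * phi x)).
    rewrite (_ : _ \o _ = (fun x => (u (flow y a x) * phi x)%:E - (u x * phi x)%:E)%E); last first.
      by apply/funext => x; congr EFin; ring.
    apply: integrableB => //; last exact: Lp_bint uL bphi.
    exact: (Lp_bint p1 (Lp_comp (mpres_flow y a) uL) bphi).
  have i2 := integrable_avg a bphi.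
  transitivity (\int[mu]_x ((u (flow y a x) - u x) * phi x - a * (A a x * phi x))).
    by apply: eq_Rintegral => x _; rewrite /W; ring.
  rewrite RintegralB//; last exact: (integrableZl measurableT a i2).
  by rewrite weak_line_test// RintegralZl// Rintegral_avg// subrr.
have mbc := measurable_obox b c.
apply/(integrable_mkcond _ mbc).
have bw : bint mu (\1_(obox b c) : H -> R).
  by apply: bint_indic => //; apply: leb_bounded => //; exact: bounded_obox.
have := iW _ bw; congr (_.-integrable _ _); apply/funext => x /=.
by rewrite /patch indicE; case: ifPn; rewrite ?mulr1 ?mulr0.
Qed.

End weak_derivative.

End line_identity.

(** * Jensen's inequality and bounds for translations *)

Section jensen.
Context {d} {T : measurableType d} {R : realType} (m : {measure set T -> \bar R}).
Hypothesis m1 : m setT = 1%E.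

(** With [A] the mean of [|h|], Young's inequality for the pair [|h|], [A^(p-1)] integrates to [A^p
    <= p^-1 * \int |h|^p + (1 - p^-1) * A^p], and the last term is absorbed on the left. *)
Lemma jensen_powR (p : R) (h : T -> R) : 1 < p -> m.-integrable setT (EFin \o h) ->
  ((`|\int[m]_x h x| `^ p)%:E <= \int[m]_x (`|h x| `^ p)%:E)%E.
Proof.
move=> p1 ih; have p0 : 0 < p by exact: lt_trans p1.
have mh : measurable_fun setT h by apply/measurable_EFinP; exact: measurable_int ih.
have mhp := measurable_powR_norm p mh.
have [hoo|] := ltP (\int[m]_x (`|h x| `^ p)%:E)%E +oo%E; last first.
  by rewrite leye_eq => /eqP ->; rewrite leey.
have ihp : m.-integrable setT (EFin \o (fun x => `|h x| `^ p)).
  apply/integrableP; split; first exact/measurable_EFinP.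
  by under eq_integral do rewrite /= ger0_norm ?powR_ge0//.
rewrite -[leRHS]fineK; last exact: integrable_fin_num ihp.
rewrite lee_fin -/(Rintegral _ _ _).
pose A := \int[m]_x `|h x|; have A0 : 0 <= A by exact: Rintegral_ge0.
have hA : `|\int[m]_x h x| <= A by exact: le_normr_Rintegral.
apply: (@le_trans _ _ (A `^ p)); first by rewrite ge0_ler_powR ?nnegrE// ltW.
pose q := p / (p - 1).
have pm1 : 0 < p - 1 by rewrite subr_gt0.
have q0 : 0 < q by rewrite divr_gt0.
have pq : p^-1 + q^-1 = 1 by rewrite /q; field; rewrite !gt_eqF.
have yg x : A `^ (p - 1) * `|h x| <= p^-1 * `|h x| `^ p + q^-1 * A `^ p.
  rewrite mulrC [p^-1 * _]mulrC [q^-1 * _]mulrC.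
  apply: le_trans (conjugate_powR (normr_ge0 (h x)) (powR_ge0 A (p - 1)) p0 q0 pq) _.
  by rewrite -powRrM /q mulrCA mulfV ?gt_eqF// mulr1.
have ic c : m.-integrable setT (EFin \o (fun _ : T => c : R)).
  by apply: integrable_EFin_cst; rewrite m1 ltry.
have inh : m.-integrable setT (EFin \o (fun x => `|h x|)) by exact: integrable_norm.
have : \int[m]_x (A `^ (p - 1) * `|h x|) <= \int[m]_x (p^-1 * `|h x| `^ p + q^-1 * A `^ p).
  apply: le_Rintegral => //; first exact: integrable_EFinZ.
  by apply: integrable_EFinD => //; exact: integrable_EFinZ.
rewrite RintegralZl// RintegralD//; last exact: integrable_EFinZ.
rewrite RintegralZl// Rintegral_cst// m1 mulr1 -/A.
have -> : A `^ (p - 1) * A = A `^ p.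
  have [->|An0] := eqVneq A 0; first by rewrite mulr0 powR0// gt_eqF.
  by rewrite -{2}(powRr1 A0) -powRD ?subrK// An0 implybT.
have -> : q^-1 = 1 - p^-1 by rewrite -pq; ring.
move=> le; have ip : 0 < p^-1 by rewrite invr_gt0.
rewrite -subr_ge0 -(pmulr_rge0 _ ip).
rewrite (_ : p^-1 * _ = p^-1 * (\int[m]_x `|h x| `^ p) + (1 - p^-1) * A `^ p - A `^ p).
  by rewrite subr_ge0.
ring.
Qed.

End jensen.

Section translation_estimates.
Context {R : realType} {N : nat}.
Local Notation H := 'rV[R]_(N + N + 1).
Local Notation mu := (leb (N + N + 1)).
Local Notation TR := (measurableTypeR R).
Local Notation P := (@unif R).
Variables (p : R) (u g : H -> R) (y : 'rV[R]_(N + N)).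

Lemma unif_setT : P setT = 1%E.
Proof. exact: probability_setT. Qed.

Lemma unif_le (f : R -> \bar R) (C : \bar R) : measurable_fun setT (f : TR -> \bar R) ->
  (forall s, (0 <= f s)%E) -> (forall s : R, 0 <= s <= 1 -> (f s <= C)%E) ->
  (\int[P]_s f s <= C)%E.
Proof.
move=> mf f0 fC; have C0 : (0 <= C)%E by rewrite (le_trans (f0 0))// fC// lexx ler01.
rewrite integral_uniform// subr0 invr1 mul1e.
apply: (@le_trans _ _ (\int[lebesgue_measure]_(s in `[0%R, 1%R]) C)%E).
  apply: ge0_le_integral => //; first exact: measurable_funTS.
by rewrite integral_cst//= lebesgue_measure_itv/= lte_fin ltr01 oppr0 adde0 mule1.
Qed.

Lemma tonelli_flow (w f : H -> R) a : measurable_fun setT w -> measurable_fun setT f ->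
  (\int[mu]_x \int[P]_s `|w x * f (flow y (s * a) x)|%:E =
   \int[P]_s \int[mu]_x `|w x * f (flow y (s * a) x)|%:E)%E.
Proof.
move=> mw mf.
apply: (fubini_tonelli (fun z : H * TR => `|w z.1 * f (flow y (z.2 * a) z.1)|%:E)) => //.
apply/measurable_EFinP; apply: measurableT_comp => //; apply: measurable_funM.
  exact: (measurableT_comp mw measurable_fst).
exact: (measurableT_comp mf (measurable_flow_pair y a)).
Qed.

Lemma measurable_tonelli_flow (w f : H -> R) a :
  measurable_fun setT w -> measurable_fun setT f ->
  measurable_fun setT (fun x => \int[P]_s `|w x * f (flow y (s * a) x)|%:E)%E /\
  measurable_fun setT (fun s : TR => \int[mu]_x `|w x * f (flow y (s * a) x)|%:E)%E.
Proof.
move=> mw mf.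
have m : measurable_fun setT (fun z : H * TR => `|w z.1 * f (flow y (z.2 * a) z.1)|%:E).
  apply/measurable_EFinP; apply: measurableT_comp => //; apply: measurable_funM.
    exact: (measurableT_comp mw measurable_fst).
  exact: (measurableT_comp mf (measurable_flow_pair y a)).
by split; [exact: (measurable_fun_fubini_tonelli_F _ m)|exact: (measurable_fun_fubini_tonelli_G _ m)].
Qed.

Lemma test_translation_L1 (phi : H -> R) a : smooth phi -> compactly_supported setT phi ->
  (\int[mu]_x `|phi (flow y a x) - phi x|%:E <= `|a|%:E * \int[mu]_x `|hderiv y phi x|%:E)%E.
Proof.
move=> sphi cphi; have [mD iD [M DM]] := bint_hderiv y sphi cphi.
have mphi : measurable_fun setT phi by have [] := bint_test sphi cphi.
have mfl : measurable_fun setT (flow y a) := (mpres_flow y a).1.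
have [mF mG] := @measurable_tonelli_flow (cst a) _ a (measurable_cst _) mD.
apply: (@le_trans _ _ (\int[mu]_x \int[P]_s `|a * hderiv y phi (flow y (s * a) x)|%:E)%E).
  apply: ge0_le_integral => //.
    apply/measurable_EFinP; apply: measurableT_comp => //.
    by apply: measurable_funB => //; exact: measurableT_comp.
  move=> x _; rewrite (hderiv_FTC y x a (sphi 1%N)).
  have ia : P.-integrable setT (EFin \o (fun s => a * hderiv y phi (flow y (s * a) x))).
    apply: integrable_EFinZ; apply: (@unif_integrable _ _ M) => //.
    exact: measurable_flow_time.
  rewrite EFin_normr_Rintegral//; apply: le_abse_integral => //.
  exact: measurable_int ia.
rewrite (@tonelli_flow (cst a) _ a (measurable_cst _) mD).
apply: unif_le => // [s|s _]; first exact: integral_ge0.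
have mfs : measurable_fun setT (fun x => hderiv y phi (flow y (s * a) x)).
  by apply: measurableT_comp => //; exact: (mpres_flow y (s * a)).1.
rewrite (integral_normZ mu a mfs); apply: lee_wpmul2l; first by rewrite lee_fin.
apply: le_of_eq.
apply: (mpres_integral (mpres_flow y (s * a)) (h := fun x => `|hderiv y phi x|%:E)).
  by apply/measurable_EFinP; exact: measurableT_comp.
by move=> x; rewrite lee_fin.
Qed.

Hypotheses (p1 : 1 < p) (uL : Lp mu p u) (gL : Lp mu p g) (weak : weak_dir u g y).

Let p1' : 1 <= p := ltW p1.

(** Line identity, Tonelli and invariance of the measure. The bound is linear in the flow time,
    which is what the chain rule consumes; [g] enters through [|g| <= 1 + |g|^p]. *)
Lemma flow_translation_L1 (w : H -> R) (M a : R) : bint mu w -> 0 <= M ->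
  (forall x, `|w x| <= M) ->
  (\int[mu]_x `|w x * (u (flow y a x) - u x)|%:E <=
   `|a|%:E * (\int[mu]_x `|w x|%:E + M%:E * pint mu p g))%E.
Proof.
move=> [mw iw _] M0 wM; have [mu_ _] := uL; have [mg _] := gL.
have mfl : measurable_fun setT (flow y a) := (mpres_flow y a).1.
have mawm : measurable_fun setT (fun x => a * w x) by exact: measurable_funM.
have [mF mG] := @measurable_tonelli_flow _ _ a mawm mg.
apply: (@le_trans _ _ (\int[mu]_x \int[P]_s `|a * w x * g (flow y (s * a) x)|%:E)%E).
  apply: ae_ge0_le_integral => //.
    apply/measurable_EFinP; apply: measurableT_comp => //; apply: measurable_funM => //.
    by apply: measurable_funB => //; exact: measurableT_comp.
    by move=> x _; exact: integral_ge0.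
  apply: filterS2 (line_identity p1' uL gL weak a) (ae_integrable_flow y p1' gL a) => x -> ix _.
  rewrite mulrCA -RintegralZl// -RintegralZl//; last exact: integrable_EFinZ.
  under eq_Rintegral do rewrite mulrA.
  have ia := integrable_EFinZ (a * w x) ix.
  rewrite EFin_normr_Rintegral//; apply: le_abse_integral => //.
  exact: measurable_int ia.
rewrite (tonelli_flow a mawm mg).
apply: unif_le => // [s|s _]; first exact: integral_ge0.
have mgf : measurable_fun setT (fun x => g (flow y (s * a) x)).
  by apply: measurableT_comp => //; exact: (mpres_flow y (s * a)).1.
under eq_integral do rewrite -mulrA [w _ * _]mulrC.
have mgw : measurable_fun setT (fun x => g (flow y (s * a) x) * w x).
  exact: measurable_funM.
rewrite (integral_normZ mu a mgw); apply: lee_wpmul2l; first by rewrite lee_fin.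
have <- : pint mu p (fun x => g (flow y (s * a) x)) = pint mu p g.
  exact: (pint_comp p (mpres_flow y (s * a)) mg).
exact: (Lp_mul_le mu p1' mgf mw M0 wM).
Qed.

(** Jensen along each flow line, then Tonelli and invariance of the measure. Time 1 suffices because
    [y] carries the size of the displacement. *)
Lemma flow_translation_Lp :
  (pint mu p (fun x => (u (flow y 1 x) - u x)%R) <= pint mu p g)%E.
Proof.
have [mu_ _] := uL; have [mg _] := gL.
have mfl : measurable_fun setT (flow y 1) := (mpres_flow y 1).1.
pose G x := `|g x| `^ p; have mG : measurable_fun setT G by exact: measurable_powR_norm.
have [mF mG'] := @measurable_tonelli_flow (cst 1) _ 1 (measurable_cst _) mG.
apply: (@le_trans _ _ (\int[mu]_x \int[P]_s `|1 * G (flow y (s * 1) x)|%:E)%E).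
  apply: ae_ge0_le_integral => //.
  - apply/measurable_EFinP; apply: measurable_powR_norm.
    by apply: measurable_funB => //; exact: measurableT_comp.
  - by move=> x _; exact: integral_ge0.
  apply: filterS2 (line_identity p1' uL gL weak 1) (ae_integrable_flow y p1' gL 1) => x -> ix _.
  rewrite mul1r; apply: le_trans (jensen_powR unif_setT p1 ix) _.
  apply: le_of_eq; apply: eq_integral => s _.
  by rewrite /= mul1r [in RHS]ger0_norm ?powR_ge0.
rewrite (@tonelli_flow (cst 1) _ 1 (measurable_cst _) mG).
apply: unif_le => // [s|s _]; first exact: integral_ge0.
apply: le_of_eq.
transitivity (\int[mu]_x (G (flow y (s * 1) x))%:E)%E.
  by apply: eq_integral => x _; rewrite /= mul1r ger0_norm ?powR_ge0.
apply: (mpres_integral (mpres_flow y (s * 1)) (h := fun x => (G x)%:E)).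
  exact/measurable_EFinP.
by move=> x; rewrite lee_fin powR_ge0.
Qed.

End translation_estimates.

(** * Chain rule *)

Section truncated_product.
Context {d} {T : measurableType d} {R : realType} (mu : {measure set T -> \bar R}).
Implicit Types g k : T -> R.

(** Splitting at the level [M]: above it, [a = a^(1-p) * a^p] and the first factor is at most
    [M^(1-p)]. *)
Lemma ler_truncate (p M a : R) : 1 < p -> 0 < M -> 0 <= a ->
  a <= M + M `^ (1 - p) * a `^ p.
Proof.
move=> p1 M0 a0; have [aM|Ma] := leP a M.
  by rewrite (le_trans aM)// lerDl mulr_ge0// powR_ge0.
have a_gt0 : 0 < a by exact: lt_trans Ma.
rewrite (@le_trans _ _ (M `^ (1 - p) * a `^ p))//; last by rewrite lerDr ltW.
have -> : a `^ p = a `^ (p - 1) * a.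
  by rewrite -{3}(powRr1 a0) -powRD ?subrK// (gt_eqF a_gt0) implybT.
rewrite mulrA ler_peMl// -opprB powRN mulrC -ler_pdivrMr ?invr_gt0 ?powR_gt0//.
by rewrite invrK mul1r ge0_ler_powR ?nnegrE ?subr_ge0 ?ltW.
Qed.

(** For a factor [k] that is small in [L^1] but merely bounded in the supremum norm: the first term
    is small for fixed [M], and [M^(1-p)] tends to 0 as [M] grows because [p > 1]. This takes the
    place of continuity of translations in [L^p]. *)
Lemma Lp_mul_truncate p g k B M : 1 < p -> 0 < M -> 0 <= B ->
  measurable_fun setT g -> measurable_fun setT k -> (forall x, `|k x| <= B) ->
  (\int[mu]_x `|g x * k x|%:E <=
   M%:E * \int[mu]_x `|k x|%:E + (B * M `^ (1 - p))%:E * pint mu p g)%E.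
Proof.
move=> p1 M0 B0 mg mk kB.
have mpow : measurable_fun setT (fun x => (`|g x| `^ p)%:E).
  exact: emeasurable_powR_norm.
have mnk : measurable_fun setT (fun x => `|k x|%:E).
  by apply/measurable_EFinP; exact: measurableT_comp.
have BM0 : 0 <= B * M `^ (1 - p) by rewrite mulr_ge0// powR_ge0.
have M0' : 0 <= M by exact: ltW.
rewrite /pint -!ge0_integralZl//.
rewrite -ge0_integralD//; [|by move=> x _; rewrite lee_fin mulr_ge0
  |exact: measurable_funeM|by move=> x _; rewrite lee_fin mulr_ge0// powR_ge0
  |exact: measurable_funeM].
apply: ge0_le_integral => //.
- by apply/measurable_EFinP; apply: measurableT_comp => //; exact: measurable_funM.
- by apply: emeasurable_funD => //; exact: measurable_funeM.
move=> x _; rewrite lee_fin normrM.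
apply: le_trans (ler_wpM2r (normr_ge0 _) (ler_truncate p1 M0 (normr_ge0 (g x)))) _.
rewrite mulrDl lerD2l mulrAC [B * _]mulrC ler_wpM2r ?powR_ge0//.
by rewrite ler_wpM2l// powR_ge0.
Qed.

End truncated_product.

Section difference_quotient.
Context {R : realType}.
Implicit Types (G c : R -> R) (a b : R).

(** The difference quotient of [G], extended by [c a] to the diagonal, where division by 0 makes the
    second summand vanish. A single formula gives measurability without case distinctions. *)
Definition dquot G c a b := c a + (G b - G a - c a * (b - a)) / (b - a).

Lemma dquotE G c a b : dquot G c a b * (b - a) = G b - G a.
Proof.
rewrite /dquot; have [->|ab] := eqVneq a b; first by rewrite !subrr mulr0.
by rewrite mulrDl divfK ?subr_eq0 1?eq_sym// addrC subrK.
Qed.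

Lemma dquot_le1 G c a b : (forall a, `|c a| <= 1) ->
  (forall a b, `|G b - G a| <= `|b - a|) -> `|dquot G c a b| <= 1.
Proof.
move=> c1 G1; have [->|ab] := eqVneq a b.
  by rewrite /dquot !(subrr, invr0, mulr0, addr0).
have ab0 : 0 < `|b - a| by rewrite normr_gt0 subr_eq0 eq_sym.
by rewrite -(ler_pM2r ab0) -normrM dquotE mul1r.
Qed.

Lemma dquot_dist G c L a b :
  (forall a b, `|G b - G a - c a * (b - a)| <= L * (b - a) ^+ 2) ->
  `|dquot G c a b - c a| <= L * `|b - a|.
Proof.
move=> GL; rewrite /dquot addrAC subrr add0r normrM normfV.
have [->|ab] := eqVneq a b; first by rewrite !(subrr, normr0, invr0, mulr0).
by rewrite ler_pdivrMr ?normr_gt0 ?subr_eq0 1?eq_sym// -mulrA -expr2 real_normK ?num_real.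
Qed.

Lemma measurable_invr d (T : measurableType d) (f : T -> R) :
  measurable_fun setT f -> measurable_fun setT (fun x => (f x)^-1).
Proof.
(* The identity [y^-1 = y * (|y|^-1)^2], valid also at 0, reduces the claim to real powers. *)
move=> mf; rewrite (_ : (fun x => _) = fun x => f x * (`|f x| `^ (-1)) ^+ 2).
  apply: measurable_funM => //; apply: measurable_funX; exact: measurable_powR_norm.
apply/funext => x; rewrite powR_inv1// exprVn real_normK ?num_real//.
have [->|fx] := eqVneq (f x) 0; first by rewrite invr0 mul0r.
by rewrite expr2 invfM mulrA divff// mul1r.
Qed.

Lemma measurable_dquot d (T : measurableType d) G c (f h : T -> R) :
  measurable_fun setT G -> measurable_fun setT c ->
  measurable_fun setT f -> measurable_fun setT h ->
  measurable_fun setT (fun x => dquot G c (f x) (h x)).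
Proof.
move=> mG mc mf mh.
have mcf : measurable_fun setT (fun x => c (f x)) by exact: measurableT_comp mf.
have mGf : measurable_fun setT (fun x => G (f x)) by exact: measurableT_comp mf.
have mGh : measurable_fun setT (fun x => G (h x)) by exact: measurableT_comp mh.
have mhf : measurable_fun setT (fun x => h x - f x) by exact: measurable_funB.
apply: measurable_funD => //; apply: measurable_funM; last exact: measurable_invr.
by apply: measurable_funB; [exact: measurable_funB|exact: measurable_funM].
Qed.

End difference_quotient.

Section integral_bounds.
Context {d} {T : measurableType d} {R : realType} (m : {measure set T -> \bar R}).

Lemma norm_Rintegral_le (f : T -> R) (C : R) : m.-integrable setT (EFin \o f) ->
  (\int[m]_x `|f x|%:E <= C%:E)%E -> `|\int[m]_x f x| <= C.
Proof.
move=> fi fC; rewrite -lee_fin; apply: le_trans fC.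
rewrite EFin_normr_Rintegral//; apply: le_abse_integral => //.
exact: measurable_int fi.
Qed.

Lemma bintM (f h : T -> R) (B : R) : bint m f -> measurable_fun setT h ->
  (forall x, `|h x| <= B) -> bint m (fun x => f x * h x).
Proof.
move=> bf mh hB; have [M [M0 fM]] := bint_bounded bf; have [mf fi _] := bf.
have B0 : T -> 0 <= B by move=> x; exact: le_trans (hB x).
split; first exact: measurable_funM.
- have [_ fi' _] := bint_norm bf; have ig := integrable_EFinZ B fi'.
  apply: le_integrable ig => //; first by apply/measurable_EFinP; exact: measurable_funM.
  move=> x _; rewrite /= lee_fin normrM [leRHS]ger0_norm; last by rewrite mulr_ge0// B0.
  by rewrite mulrC ler_wpM2r.
- by exists (M * B) => x; rewrite normrM ler_pM.
Qed.

End integral_bounds.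

Lemma unif_dist {R : realType} (K : R -> R) (X e : R) : (@unif R).-integrable setT (EFin \o K) ->
  (forall s : R, 0 <= s <= 1 -> `|K s - X| <= e) -> `|\int[@unif R]_s K s - X| <= e.
Proof.
move=> Ki KX; have Xi : (@unif R).-integrable setT (EFin \o (fun=> X)).
  exact: (@unif_integrable _ _ `|X|).
have mK := measurable_EFin_integrable Ki.
rewrite -(unif_cst X) -RintegralB//; apply: norm_Rintegral_le.
  exact: integrable_EFinB.
apply: unif_le => //; apply/measurable_EFinP; apply: measurableT_comp => //.
exact: measurable_funB.
Qed.

Section chain_rule.
Context {R : realType} {N : nat}.
Local Notation H := 'rV[R]_(N + N + 1).
Local Notation mu := (leb (N + N + 1)).
Local Notation TR := (measurableTypeR R).
Local Notation P := (@unif R).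
Variables (p : R) (u g : H -> R) (y : 'rV[R]_(N + N)).
Hypotheses (p1 : 1 < p) (uL : Lp mu p u) (gL : Lp mu p g) (weak : weak_dir u g y).

Let p1' : 1 <= p := ltW p1.
Let mu_ : measurable_fun setT u := uL.1.
Let mg : measurable_fun setT g := gL.1.

(** The pointwise line identity admits every bounded integrable weight, in particular weights built
    from [u] itself, which the weak formulation does not accept as test functions. *)
Lemma weak_line_bint w a : bint mu w ->
  \int[mu]_x ((u (flow y a x) - u x) * w x) =
  a * \int[P]_s \int[mu]_x (g (flow y (s * a) x) * w x).
Proof.
move=> bw; have [mw _ _] := bw.
have iA := integrable_avg y p1' gL a bw.
have mfl : measurable_fun setT (flow y a) := (mpres_flow y a).1.
transitivity (\int[mu]_x (a * ((\int[P]_s g (flow y (s * a) x)) * w x))).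
  apply: ae_eq_Rintegral.
  - apply: measurable_funM => //; apply: measurable_funB => //.
    exact: measurableT_comp mu_ mfl.
  - by apply: measurable_funM => //; exact: measurable_EFin_integrable iA.
  - by apply: filterS (line_identity p1' uL gL weak a) => x ->; rewrite mulrA.
rewrite RintegralZl// (Rintegral_avg y p1' gL a bw).
by rewrite (Rintegral_fubini (integrable_flow_prod y p1' gL a bw)).
Qed.

(** Here [c] stands for the derivative of [G]. The Taylor estimate with the constant [L] is assumed
    in its place, so the argument works with increments only. *)
Variables (G c : R -> R) (L : R).
Hypotheses (mG : measurable_fun setT G) (mc : measurable_fun setT c)
  (c1 : forall a, `|c a| <= 1) (G1 : forall a b, `|G b - G a| <= `|b - a|)
  (GL : forall a b, `|G b - G a - c a * (b - a)| <= L * (b - a) ^+ 2)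
  (cL : forall a b, `|c b - c a| <= L * `|b - a|) (L0 : 0 <= L) (G0 : G 0 = 0).

Let mcu : measurable_fun setT (fun x => c (u x)).
Proof. exact: measurableT_comp mc mu_. Qed.

Lemma Lp_lipschitz : Lp mu p (G \o u).
Proof.
have mGu : measurable_fun setT (G \o u) by exact: measurableT_comp mG mu_.
apply: (Lp_le _ mGu uL) => [|x]; first exact: le_trans p1'.
by have := G1 0 (u x); rewrite G0 !subr0.
Qed.

Section test_function.
Variables (phi : H -> R) (t M B B1 I0 I1 E : R).
Hypotheses (sphi : smooth phi) (cphi : compactly_supported setT phi)
  (t0 : 0 < t) (M0 : 0 < M) (phiB : forall x, `|phi x| <= B)
  (DB : forall x, `|hderiv y phi x| <= B1) (B0 : 0 <= B) (B10 : 0 <= B1)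
  (I0E : (\int[mu]_x `|phi x|%:E = I0%:E)%E)
  (I1E : (\int[mu]_x `|hderiv y phi x|%:E = I1%:E)%E)
  (EE : pint mu p g = E%:E).

Let bphi : bint mu phi := bint_test sphi cphi.
Let bD : bint mu (hderiv y phi) := bint_hderiv y sphi cphi.
Let mphi : measurable_fun setT phi. Proof. by have [] := bphi. Qed.
Let mD : measurable_fun setT (hderiv y phi). Proof. by have [] := bD. Qed.
Let mfl a : measurable_fun setT (flow y a) := (mpres_flow y a).1.

(** By [dquotE], [phi] times the increment of [G \o u] over time [t] is [wt] times the increment of
    [u]; [w0] is the limit of the weights [wt] as [t] tends to 0. *)
Let w0 x := phi x * c (u x).
Let wt x := phi x * dquot G c (u x) (u (flow y t x)).

Let mufl a : measurable_fun setT (fun x => u (flow y a x)).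
Proof. exact: measurableT_comp mu_ (mfl a). Qed.

Let bw0 : bint mu w0.
Proof. exact: bintM bphi mcu (fun x => c1 (u x)). Qed.

Let bwt : bint mu wt.
Proof.
by apply: (bintM bphi (measurable_dquot mG mc mu_ (mufl t)) (B := 1)) => x; exact: dquot_le1.
Qed.

Let mw0 : measurable_fun setT w0. Proof. by have [] := bw0. Qed.
Let mwt : measurable_fun setT wt. Proof. by have [] := bwt. Qed.

Let I0_ge0 : 0 <= I0. Proof. by rewrite -lee_fin -I0E integral_ge0. Qed.
Let I1_ge0 : 0 <= I1. Proof. by rewrite -lee_fin -I1E integral_ge0. Qed.
Let E_ge0 : 0 <= E. Proof. by rewrite -lee_fin -EE pint_ge0. Qed.

Let w_bound w x : `|w| <= 1 -> `|phi x * w| <= B.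
Proof. by move=> w1; rewrite normrM -[B]mulr1 ler_pM. Qed.

Let integral_flow (h : H -> R) a : measurable_fun setT h ->
  (\int[mu]_x `|h (flow y a x)|%:E = \int[mu]_x `|h x|%:E)%E.
Proof.
move=> mh; apply: (mpres_integral (mpres_flow y a) (h := fun x => `|h x|%:E)).
  by apply/measurable_EFinP; exact: measurableT_comp.
by move=> x; rewrite lee_fin.
Qed.

Let dist_wt : (\int[mu]_x `|wt x - w0 x|%:E <= (t * (L * (I0 + B * E)))%:E)%E.
Proof.
have m : measurable_fun setT (fun x => phi x * (u (flow y t x) - u x)).
  by apply: measurable_funM => //; exact: measurable_funB.
apply: (@le_trans _ _ (\int[mu]_x `|L * (phi x * (u (flow y t x) - u x))|%:E)%E).
  apply: ge0_le_integral => //.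
  - apply/measurable_EFinP; apply: measurableT_comp => //; exact: measurable_funB.
  - by apply/measurable_EFinP; apply: measurableT_comp => //; exact: measurable_funM.
  move=> x _; rewrite lee_fin /wt /w0 -mulrBr !normrM (ger0_norm L0) mulrCA ler_wpM2l//.
  exact: dquot_dist.
rewrite (integral_normZ mu L m) (ger0_norm L0) mulrCA EFinM; apply: lee_wpmul2l; first by rewrite lee_fin.
apply: le_trans (flow_translation_L1 p1 uL gL weak t bphi B0 phiB) _.
by rewrite (gtr0_norm t0) I0E EE EFinM EFinD EFinM.
Qed.

Let dist_w0 (a : R) : `|a| <= t ->
  (\int[mu]_x `|w0 (flow y a x) - w0 x|%:E <= (t * (L * (I0 + B * E) + I1))%:E)%E.
Proof.
move=> at_; pose psi := phi \o flow y a.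
have bpsi : bint mu psi by exact: (bint_comp (mpres_flow y a) bphi).
have mpsi : measurable_fun setT psi by have [] := bpsi.
have m1 : measurable_fun setT (fun x => psi x * (u (flow y a x) - u x)).
  by apply: measurable_funM => //; exact: measurable_funB.
have m2 : measurable_fun setT (fun x => psi x - phi x) by exact: measurable_funB.
have mn1 : measurable_fun setT (fun x => `|L * (psi x * (u (flow y a x) - u x))|%:E).
  by apply/measurable_EFinP; apply: measurableT_comp => //; exact: measurable_funM.
have mn2 : measurable_fun setT (fun x => `|psi x - phi x|%:E).
  by apply/measurable_EFinP; exact: measurableT_comp.
apply: (@le_trans _ _ (\int[mu]_x (`|L * (psi x * (u (flow y a x) - u x))|%:E
    + `|psi x - phi x|%:E))%E).
  apply: ge0_le_integral => //.
  - apply/measurable_EFinP; apply: measurableT_comp => //; apply: measurable_funB => //.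
    exact: measurableT_comp mw0 (mfl a).
  - exact: emeasurable_funD.
  move=> x _; rewrite -EFinD lee_fin /w0 -/(psi x).
  rewrite (_ : _ - _ = psi x * (c (u (flow y a x)) - c (u x)) + (psi x - phi x) * c (u x)).
    apply: le_trans (ler_normD _ _) _; apply: lerD; last by rewrite normrM ler_piMr.
    by rewrite !normrM (ger0_norm L0) mulrCA ler_wpM2l.
  rewrite /psi /=; ring.
rewrite ge0_integralD// (integral_normZ mu L m1) (ger0_norm L0).
have a0 : (0 <= `|a|%:E)%E by rewrite lee_fin.
rewrite mulrDr EFinD; apply: leeD.
  apply: (@le_trans _ _ (L%:E * (`|a|%:E * (I0 + B * E)%:E))%E).
    apply: lee_wpmul2l; first by rewrite lee_fin.
    have psiB x : `|psi x| <= B by exact: phiB.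
    apply: le_trans (flow_translation_L1 p1 uL gL weak a bpsi B0 psiB) _.
    apply: lee_wpmul2l => //.
    by rewrite (integral_flow a mphi) I0E EE EFinD EFinM.
  by rewrite -!EFinM lee_fin mulrCA ler_wpM2r// mulr_ge0// addr_ge0// mulr_ge0.
apply: le_trans (test_translation_L1 y a sphi cphi) _.
by rewrite I1E -EFinM lee_fin ler_wpM2r.
Qed.

(** The flow is moved onto the weight, leaving [g] times a difference of two weights. That
    difference is [O(t)] in [L^1] by the two previous bounds, but only bounded by [2 B] pointwise,
    while [g] is only in [L^p]; hence the truncation at [M]. *)
Let dist_g (s : R) : 0 <= s <= 1 ->
  `|\int[mu]_x (g (flow y (s * t) x) * wt x) - \int[mu]_x (g x * w0 x)| <=
  M * (t * (L * (I0 + B * E)) + t * (L * (I0 + B * E) + I1)) + 2 * B * M `^ (1 - p) * E.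
Proof.
move=> /andP[s0 s1]; have t0' := ltW t0.
have st0 : 0 <= s * t by exact: mulr_ge0.
have stt : s * t <= t by exact: ler_piMl.
pose wts := wt \o flow y (- (s * t)).
have bwts : bint mu wts by exact: (bint_comp (mpres_flow y (- (s * t))) bwt).
have mwts : measurable_fun setT wts by have [] := bwts.
pose w0s := w0 \o flow y (- (s * t)).
have mw0s : measurable_fun setT w0s by exact: measurableT_comp mw0 (mfl _).
have i1 : mu.-integrable setT (EFin \o (fun x => g x * wts x)) by exact: Lp_bint p1' gL bwts.
have i2 : mu.-integrable setT (EFin \o (fun x => g x * w0 x)) by exact: Lp_bint p1' gL bw0.
have mk : measurable_fun setT (fun x => wts x - w0 x) by exact: measurable_funB.
rewrite -(Rintegral_flow_shift y gL (s * t) mwt) -RintegralB//.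
have kB x : `|wts x - w0 x| <= 2 * B.
  apply: le_trans (ler_normB _ _) _; rewrite mulr_natl mulr2n; apply: lerD; last exact: w_bound.
  by apply: w_bound; exact: dquot_le1.
have ik : mu.-integrable setT (EFin \o (fun x => g x * wts x - g x * w0 x)).
  exact: integrable_EFinB.
apply: (norm_Rintegral_le ik).
under eq_integral do rewrite -mulrBr.
have B20 : 0 <= 2 * B by rewrite mulr_ge0.
apply: le_trans (Lp_mul_truncate mu p1 M0 B20 mg mk kB) _.
rewrite EE -EFinM EFinD; apply: leeD; last by [].
rewrite EFinM; apply: lee_wpmul2l; first by rewrite lee_fin ltW.
have m1 : measurable_fun setT (fun x => `|wts x - w0s x|%:E).
  by apply/measurable_EFinP; apply: measurableT_comp => //; exact: measurable_funB.
have m2 : measurable_fun setT (fun x => `|w0s x - w0 x|%:E).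
  by apply/measurable_EFinP; apply: measurableT_comp => //; exact: measurable_funB.
apply: (@le_trans _ _ (\int[mu]_x (`|wts x - w0s x|%:E + `|w0s x - w0 x|%:E))%E).
  apply: ge0_le_integral => //.
  - by apply/measurable_EFinP; exact: measurableT_comp.
  - exact: emeasurable_funD.
  by move=> x _; rewrite -EFinD lee_fin; exact: ler_distD.
rewrite ge0_integralD// EFinD; apply: leeD.
  have mdw : measurable_fun setT (fun x => wt x - w0 x) by exact: measurable_funB.
  by apply: le_trans dist_wt; rewrite (integral_flow (- (s * t)) mdw).
by apply: dist_w0; rewrite normrN ger0_norm.
Qed.

Let dist_G (s : R) : 0 <= s <= 1 ->
  `|\int[mu]_x (G (u (flow y (s * t) x)) * hderiv y phi x)
    - \int[mu]_x (G (u x) * hderiv y phi x)| <= t * (I1 + B1 * E).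
Proof.
move=> /andP[s0 s1]; have t0' := ltW t0.
have st0 : 0 <= s * t by exact: mulr_ge0.
have stt : s * t <= t by exact: ler_piMl.
have i1 : mu.-integrable setT (EFin \o (fun x => G (u x) * hderiv y phi x)).
  exact: Lp_bint p1' Lp_lipschitz bD.
have i2 : mu.-integrable setT (EFin \o (fun x => G (u (flow y (s * t) x)) * hderiv y phi x)).
  exact: (Lp_bint p1' (Lp_comp (mpres_flow y (s * t)) Lp_lipschitz) bD).
rewrite -RintegralB//.
have i12 : mu.-integrable setT (EFin \o (fun x =>
    G (u (flow y (s * t) x)) * hderiv y phi x - G (u x) * hderiv y phi x)).
  exact: integrable_EFinB.
apply: (norm_Rintegral_le i12).
apply: (@le_trans _ _ (\int[mu]_x `|hderiv y phi x * (u (flow y (s * t) x) - u x)|%:E)%E).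
  apply: ge0_le_integral => //.
  - apply/measurable_EFinP; apply: measurableT_comp => //.
    exact: measurable_EFin_integrable i12.
  - apply/measurable_EFinP; apply: measurableT_comp => //; apply: measurable_funM => //.
    exact: measurable_funB.
  by move=> x _; rewrite lee_fin -mulrBl mulrC !normrM ler_wpM2l.
apply: le_trans (flow_translation_L1 p1 uL gL weak (s * t) bD B10 DB) _.
rewrite I1E EE [leLHS](_ : _ = (`|s * t| * (I1 + B1 * E))%:E); last first.
  by rewrite !(EFinM, EFinD).
by rewrite lee_fin ger0_norm// ler_wpM2r// addr_ge0// mulr_ge0.
Qed.

(** The increment of [G \o u] over time [t], tested with [phi], is computed in two ways: through the
    derivative of [phi], and through [g] against the weight [wt]. After division by [t] both are
    averages over [s] of quantities close to the two integrals in the claim. *)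
Lemma chain_rule_estimate :
  `|\int[mu]_x (g x * w0 x) + \int[mu]_x (G (u x) * hderiv y phi x)| <=
  M * (t * (L * (I0 + B * E)) + t * (L * (I0 + B * E) + I1)) + 2 * B * M `^ (1 - p) * E
  + t * (I1 + B1 * E).
Proof.
have := flow_difference_test y p1' Lp_lipschitz t sphi cphi.
have -> : \int[mu]_x (((G \o u) (flow y t x) - (G \o u) x) * phi x) =
    \int[mu]_x ((u (flow y t x) - u x) * wt x).
  by apply: eq_Rintegral => x _; rewrite /= -(dquotE G c) /wt mulrAC mulrC [X in _ * X]mulrC.
rewrite (weak_line_bint t bwt) mulNr => /eqP; rewrite -mulrN => /eqP/(mulfI (lt0r_neq0 t0)) e.
have Kg := unif_dist (integrable_Rintegral2 (integrable_flow_prod y p1' gL t bwt)) dist_g.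
have KG := unif_dist (integrable_Rintegral2 (integrable_flow_prod y p1' Lp_lipschitz t bD)) dist_G.
apply: le_trans (lerD Kg KG); rewrite /= e; move: (\int[P]_s _) => K.
rewrite (_ : _ + _ = - (- K - \int[mu]_x (g x * w0 x)
   + (K - \int[mu]_x (G (u x) * hderiv y phi x)))).
  by rewrite normrN ler_normD.
ring.
Qed.

End test_function.

Lemma weak_dir_comp : weak_dir (G \o u) (fun x => c (u x) * g x) y.
Proof.
move=> phi sphi cphi; have bphi := bint_test sphi cphi; have bD := bint_hderiv y sphi cphi.
have [B [B0 phiB]] := bint_bounded bphi; have [B1 [B10 DB]] := bint_bounded bD.
have fin (w : H -> R) : bint mu w -> exists I, (\int[mu]_x `|w x|%:E = I%:E)%E.
  move=> [_ iw _]; exists (fine (\int[mu]_x `|w x|%:E)%E); rewrite fineK// ge0_fin_numE.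
    by have /integrableP[] := iw.
  exact: integral_ge0.
have [I0 I0E] := fin _ bphi; have [I1 I1E] := fin _ bD.
have [E EE] : exists E, pint mu p g = E%:E.
  by exists (fine (pint mu p g)); rewrite fineK// ge0_fin_numE ?pint_ge0// gL.2.
have I0_ge0 : 0 <= I0 by rewrite -lee_fin -I0E integral_ge0.
have I1_ge0 : 0 <= I1 by rewrite -lee_fin -I1E integral_ge0.
have E_ge0 : 0 <= E by rewrite -lee_fin -EE pint_ge0.
apply/eqP; rewrite -addr_eq0 -normr_eq0 addrC.
have -> : \int[mu]_x (c (u x) * g x * phi x) = \int[mu]_x (g x * (phi x * c (u x))).
  by apply: eq_Rintegral => x _; ring.
set X := `|_|; pose C0 := L * (I0 + B * E) + (L * (I0 + B * E) + I1).
pose C1 := I1 + B1 * E; pose D := 2 * B * E.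
have C00 : 0 <= C0 by rewrite !addr_ge0 ?mulr_ge0 ?addr_ge0 ?mulr_ge0.
have C10 : 0 <= C1 by rewrite addr_ge0 ?mulr_ge0.
have D0 : 0 <= D by rewrite !mulr_ge0.
have est (t M : R) : 0 < t -> 0 < M -> X <= t * (M * C0 + C1) + D * M `^ (1 - p).
  move=> t0 M0; apply: le_trans (chain_rule_estimate sphi cphi t0 M0 phiB DB B0 B10 I0E I1E EE) _.
  by apply: le_of_eq; rewrite /C0 /C1 /D; ring.
(* First [t] tends to 0 with [M] fixed; [M] is chosen only afterwards, since it multiplies [t]. *)
have est2 (M : R) : 0 < M -> X <= D * M `^ (1 - p).
  move=> M0; apply/ler_addgt0Pl => e e0; have K0 : 0 < M * C0 + C1 + 1.
    by rewrite ltr_wpDl// addr_ge0// mulr_ge0// ltW.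
  apply: le_trans (est (e / (M * C0 + C1 + 1)) M (divr_gt0 e0 K0) M0) _.
  by rewrite lerD2r -mulrA ler_piMr ?(ltW e0)// mulrC ler_pdivrMr// mul1r lerDl.
rewrite eq_le normr_ge0 andbT leNgt; apply/negP => X0.
have D1 : 0 < D + 1 by rewrite ltr_wpDl.
have pm1 : p - 1 != 0 by rewrite subr_eq0 gt_eqF.
(* This [M] makes [M^(1-p)] equal to [X / (D + 1)], so that [X <= D * X / (D + 1)], which is
   impossible for [X > 0]. *)
have := est2 (((D + 1) / X) `^ (p - 1)^-1) (powR_gt0 _ (divr_gt0 D1 X0)).
rewrite -powRrM (_ : (p - 1)^-1 * (1 - p) = -1); last first.
  by rewrite -[1 - p]opprB mulrN mulVf.
rewrite powR_inv1 ?(ltW (divr_gt0 D1 X0))// invf_div mulrA ler_pdivlMr// mulrDr mulr1 mulrC.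
by rewrite gerDl leNgt X0.
Qed.

End chain_rule.

(** * Tent functions and their primitives *)

Section quadratic_difference.
Context {R : realType}.
Implicit Types (G c : R -> R) (a b x y : R).

Lemma quadratic_MVT G c L x y : 0 <= L -> x <= y ->
  (forall a b, `|G b - G a - c a * (b - a)| <= L * (b - a) ^+ 2) ->
  exists z, G y - G x = c z * (y - x).
Proof.
move=> L0 xy GL; have dG z : is_derive z (1 : R) (G : R -> R) (c z).
  apply: is_derive_eps => e e0; have L1 : 0 < L + 1 by rewrite ltr_wpDl.
  exists (e / (L + 1)) => [|h he]; first exact: divr_gt0.
  have := GL z (z + h); rewrite (_ : z + h - z = h); last by rewrite addrAC subrr add0r.
  rewrite [c z * h]mulrC => GLz; rewrite -[h%:A]/(h * 1) mulr1; apply: le_trans GLz _.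
  rewrite -[h ^+ 2]real_normK ?num_real// expr2 mulrA ler_wpM2r//.
  move: he; rewrite ltr_pdivlMr// mulrC => /ltW; apply: le_trans.
  by rewrite ler_wpM2r// lerDl.
have cG : continuous G.
  move=> z; apply/differentiable_continuous/derivable1_diffP.
  exact: (@ex_derive _ _ _ _ _ _ _ (dG z)).
have [z _ e] := @MVT_segment R G c x y xy (fun z _ => dG z) (continuous_subspaceT cG).
by exists z.
Qed.

End quadratic_difference.

Section tent.
Context {R : realType}.
Implicit Types (t a r x y : R).

Definition ramp x : R := Num.max x 0.

Definition tent a r x : R :=
  (ramp (x - a) - 2 * ramp (x - (a + r)) + ramp (x - (a + 2 * r))) / r.

(** The primitive of [tent] vanishing below [a], as half the second difference of squared ramps. Its
    final value [r] is the area of a triangle of base [2 r] and height 1. *)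
Definition itent a r x : R := (ramp (x - a) ^+ 2 - 2 * ramp (x - (a + r)) ^+ 2
  + ramp (x - (a + 2 * r)) ^+ 2) / (2 * r).

Variables (a r : R).
Hypothesis r0 : 0 < r.

Ltac ramps x := rewrite /ramp;
  have [?|?] := leP (x - a) 0; have [?|?] := leP (x - (a + r)) 0;
  have [?|?] := leP (x - (a + 2 * r)) 0; move: r0.

Lemma tent_ge0 x : 0 <= tent a r x.
Proof. by apply: divr_ge0 (ltW r0); ramps x; lra. Qed.

Lemma tent_le1 x : tent a r x <= 1.
Proof. by rewrite ler_pdivrMr// mul1r; ramps x; lra. Qed.

Lemma tent_norm x : `|tent a r x| <= 1.
Proof. by rewrite ger0_norm ?tent_ge0// tent_le1. Qed.

Lemma tent_eq0 x : x <= a \/ a + 2 * r <= x -> tent a r x = 0.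
Proof.
move=> xa; apply/eqP; rewrite mulf_eq0; apply/orP; left; apply/eqP.
by case: xa => ?; ramps x; lra.
Qed.

Lemma ramp_lip x y : `|ramp y - ramp x| <= `|y - x|.
Proof.
rewrite /ramp; have [?|?] := leP x 0; have [?|?] := leP y 0;
  by rewrite ler_norml; have := ler_norm (y - x); have := ler_norm (- (y - x));
  rewrite normrN => ? ?; apply/andP; split; lra.
Qed.

Lemma ramp_quad x y : `|ramp y ^+ 2 - ramp x ^+ 2 - 2 * ramp x * (y - x)| <= (y - x) ^+ 2.
Proof.
have hx := sqr_ge0 x; have hy := sqr_ge0 y; have hxy := sqr_ge0 (y - x).
rewrite /ramp; have [x0|x0] := leP x 0; have [y0|y0] := leP y 0;
  rewrite ler_norml; apply/andP; split.
- by lra.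
- by lra.
- by have := mulr_le0_ge0 x0 (ltW y0); lra.
- by have := mulr_le0_ge0 x0 (ltW y0); lra.
- by have := mulr_ge0_le0 (ltW x0) y0; lra.
- by have := mulr_ge0_le0 (ltW x0) y0; lra.
- by lra.
- by lra.
Qed.

(** The factor 4 is [1 + 2 + 1], the coefficients of the three 1-Lipschitz ramps. The chain rule
    takes one constant for this bound and for [itent_quad], where the same count gives half as
    much. *)
Lemma tent_lip x y : `|tent a r y - tent a r x| <= 4 / r * `|y - x|.
Proof.
have ir0 : 0 < r^-1 by rewrite invr_gt0.
rewrite -mulrBl normrM (gtr0_norm ir0) mulrAC ler_wpM2r ?(ltW ir0)//.
have := ramp_lip (x - a) (y - a); have := ramp_lip (x - (a + r)) (y - (a + r)).
have := ramp_lip (x - (a + 2 * r)) (y - (a + 2 * r)).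
have e c : y - c - (x - c) = y - x by ring.
rewrite !e; move: `|y - x| => D.
rewrite !ler_norml => /andP[? ?] /andP[? ?] /andP[? ?]; apply/andP; split; lra.
Qed.

Lemma itent_quad x y :
  `|itent a r y - itent a r x - tent a r x * (y - x)| <= 4 / r * (y - x) ^+ 2.
Proof.
have r20 : 0 < 2 * r by rewrite mulr_gt0.
have -> : itent a r y - itent a r x - tent a r x * (y - x) =
  ((ramp (y - a) ^+ 2 - ramp (x - a) ^+ 2 - 2 * ramp (x - a) * (y - a - (x - a)))
  - 2 * (ramp (y - (a + r)) ^+ 2 - ramp (x - (a + r)) ^+ 2
     - 2 * ramp (x - (a + r)) * (y - (a + r) - (x - (a + r))))
  + (ramp (y - (a + 2 * r)) ^+ 2 - ramp (x - (a + 2 * r)) ^+ 2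
     - 2 * ramp (x - (a + 2 * r)) * (y - (a + 2 * r) - (x - (a + 2 * r))))) / (2 * r).
  by rewrite /itent /tent; field; rewrite !gt_eqF.
have := ramp_quad (x - a) (y - a); have := ramp_quad (x - (a + r)) (y - (a + r)).
have := ramp_quad (x - (a + 2 * r)) (y - (a + 2 * r)).
move: (_ ^+ 2 - _ ^+ 2 - _) => A; move: (_ ^+ 2 - _ ^+ 2 - _) => B.
move: (_ ^+ 2 - _ ^+ 2 - _) => C.
have e c : y - c - (x - c) = y - x by ring.
rewrite !e.
rewrite !ler_norml => /andP[A1 A2] /andP[B1 B2] /andP[C1 C2].
have -> : 4 / r * (y - x) ^+ 2 = (8 * (y - x) ^+ 2) / (2 * r) by field; rewrite gt_eqF.
have := sqr_ge0 (y - x) => ?.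
rewrite ler_pdivlMr// ler_pdivrMr//.
by rewrite mulNr !divfK ?gt_eqF//; apply/andP; split; lra.
Qed.

Lemma itent_MVT x y : x <= y -> exists z, itent a r y - itent a r x = tent a r z * (y - x).
Proof.
move=> xy; apply: (quadratic_MVT _ xy itent_quad).
by rewrite divr_ge0// ltW.
Qed.

Lemma itent_homo x y : x <= y -> itent a r x <= itent a r y.
Proof.
move=> xy; have [z e] := itent_MVT xy; rewrite -subr_ge0 e.
by rewrite mulr_ge0 ?tent_ge0 ?subr_ge0.
Qed.

Lemma itent_lip x y : `|itent a r y - itent a r x| <= `|y - x|.
Proof.
wlog xy : x y / x <= y.
  by move=> h; have [/h//|/ltW/h] := leP x y; rewrite distrC [leRHS]distrC.
by have [z ->] := itent_MVT xy; rewrite normrM ler_piMl// tent_norm.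
Qed.

Lemma itent_eq0 x : x <= a -> itent a r x = 0.
Proof.
move=> xa; apply/eqP; rewrite mulf_eq0; apply/orP; left; apply/eqP.
ramps x; nra.
Qed.

Lemma itent_ge0 x : 0 <= itent a r x.
Proof.
have [xa|ax] := leP x a; first by rewrite itent_eq0.
by rewrite -(itent_eq0 (lexx a)) itent_homo// ltW.
Qed.

Lemma itent_plateau x : a + 2 * r <= x -> itent a r x = r.
Proof.
move=> ax; have r20 : 0 < 2 * r by rewrite mulr_gt0.
apply/(canLR (mulfK (lt0r_neq0 r20))).
have xa : 0 <= x - a by move: r0; lra.
have xr : 0 <= x - (a + r) by move: r0; lra.
have x2r : 0 <= x - (a + 2 * r) by lra.
by rewrite /ramp !max_l//; ring.
Qed.

Lemma measurable_ramp b : measurable_fun setT (fun x : R => ramp (x - b)).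
Proof.
by apply: measurable_maxr => //; apply: measurable_funB => //; exact: measurable_cst.
Qed.

Lemma measurable_tent : measurable_fun setT (tent a r).
Proof.
have m := measurable_ramp.
apply: measurable_funM => //; apply: measurable_funD => //.
by apply: measurable_funB => //; exact: measurable_funM.
Qed.

Lemma measurable_itent : measurable_fun setT (itent a r).
Proof.
have m c : measurable_fun setT (fun x : R => ramp (x - c) ^+ 2).
  by apply: measurable_funX; exact: measurable_ramp.
apply: measurable_funM => //; apply: measurable_funD => //.
by apply: measurable_funB => //; exact: measurable_funM.
Qed.

End tent.

(** * Sobolev inequality on level sets *)

Section tonelli_bounds.
Context {d} {T : measurableType d} {R : realType}.

Lemma measurable_superlevel (f : T -> R) (c : R) : measurable_fun setT f ->
  measurable [set x | c < f x] /\ measurable [set x | c <= f x].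
Proof.
move=> mf; split.
  rewrite (_ : mkset _ = setT `&` f @^-1` `]c, +oo[%classic); first exact: mf.
  by apply/seteqP; split => x; rewrite /= in_itv/= andbT => // -[].
rewrite (_ : mkset _ = setT `&` f @^-1` `[c, +oo[%classic); first exact: mf.
by apply/seteqP; split => x; rewrite /= in_itv/= andbT => // -[].
Qed.

Lemma integral_indicZ (m : {measure set T -> \bar R}) (S : set T) (a : R) :
  measurable S -> 0 <= a -> (\int[m]_x (a * \1_S x)%:E = a%:E * m S)%E.
Proof.
move=> mS a0; under eq_integral do rewrite EFinM.
rewrite ge0_integralZl//; first by rewrite integral_indic// setIT.
by apply/measurable_EFinP; exact: measurable_indic.
Qed.

Lemma ge_integral_indic (m : {measure set T -> \bar R}) (S : set T) (a : R) (f : T -> R) :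
  measurable S -> 0 <= a -> measurable_fun setT f -> (forall x, 0 <= f x) ->
  (forall x, S x -> a <= f x) -> (a%:E * m S <= \int[m]_x (f x)%:E)%E.
Proof.
move=> mS a0 mf f0 af; rewrite -integral_indicZ//; apply: ge0_le_integral => //.
- by move=> x _; rewrite lee_fin mulr_ge0.
- by apply/measurable_EFinP; apply: measurable_funM => //; exact: measurable_indic.
- exact/measurable_EFinP.
move=> x _; rewrite lee_fin indicE; have [xS|xS] := boolP (x \in S).
  by rewrite mulr1 af// -in_setE.
by rewrite mulr0 f0.
Qed.

(** The integral of [\1_E x * \1_B h * F (x, h)] is estimated in both orders: from below by
    integrating over [h] first, from above by integrating over [x] first. *)
Lemma tonelli_level (m : {sigma_finite_measure set T -> \bar R}) (F : T * T -> R)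
    (E B : set T) (c K : R) :
  measurable E -> measurable B -> measurable_fun setT F -> (forall z, 0 <= F z) ->
  0 <= c -> 0 <= K ->
  (forall x, E x -> (c%:E <= \int[m]_h (\1_B h * F (x, h))%:E)%E) ->
  (forall h, B h -> (\int[m]_x (F (x, h))%:E <= K%:E)%E) ->
  (c%:E * m E <= K%:E * m B)%E.
Proof.
move=> mE mB mF F0 c0 K0 lower upper.
pose k z := \1_E z.1 * (\1_B z.2 * F z).
have iE : measurable_fun setT (\1_E : T -> R) by exact: measurable_indic.
have iB : measurable_fun setT (\1_B : T -> R) by exact: measurable_indic.
have mE1 : measurable_fun setT (fun z : T * T => \1_E z.1 : R).
  exact: (measurableT_comp iE measurable_fst).
have mB1 : measurable_fun setT (fun z : T * T => \1_B z.2 : R).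
  exact: (measurableT_comp iB measurable_snd).
have mk : measurable_fun setT (EFin \o k).
  by apply/measurable_EFinP; apply: measurable_funM => //; exact: measurable_funM.
have k0 z : (0 <= (EFin \o k) z)%E by rewrite /= lee_fin !mulr_ge0.
have mk1 : measurable_fun setT (fun x => \int[m]_h (k (x, h))%:E)%E.
  exact: measurable_fun_fubini_tonelli_F mk k0.
have mk2 : measurable_fun setT (fun h => \int[m]_x (k (x, h))%:E)%E.
  exact: measurable_fun_fubini_tonelli_G mk k0.
apply: (@le_trans _ _ (\int[m]_x \int[m]_h (k (x, h))%:E)%E).
  rewrite -integral_indicZ//; apply: ge0_le_integral => //.
  - by move=> x _; rewrite lee_fin mulr_ge0.
  - by apply/measurable_EFinP; apply: measurable_funM => //; exact: measurable_indic.
  move=> x _; rewrite /k indicE /=; have [xE|xE] := boolP (x \in E).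
    under eq_integral do rewrite mul1r.
    by rewrite mulr1; apply: lower; rewrite -in_setE.
  by rewrite mulr0; apply: integral_ge0 => h _; rewrite mul0r.
rewrite (fubini_tonelli _ mk k0) -integral_indicZ//; apply: ge0_le_integral => //.
- by move=> h _; apply: integral_ge0 => x _; exact: k0.
- by apply/measurable_EFinP; apply: measurable_funM => //; exact: measurable_indic.
move=> h _; rewrite /k /=; rewrite [in leRHS]indicE; have [hB|hB] := boolP (h \in B).
  have hB' : B h by rewrite -in_setE.
  rewrite mulr1; apply: le_trans (upper h hB').
  have mFh : measurable_fun setT (fun x => F (x, h)).
    apply: (measurableT_comp mF); exact: measurable_fun_pair.
  apply: ge0_le_integral => //.
  - by move=> x _; rewrite lee_fin !mulr_ge0.
  - apply/measurable_EFinP; apply: measurable_funM; first exact: measurable_indic.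
    exact: measurable_funM.
  - exact/measurable_EFinP.
  move=> x _; rewrite lee_fin indicE [\1_B _]indicE hB mul1r ler_piMl//.
  by case: (_ \in _).
rewrite mulr0 integral0_eq// => x _; rewrite indicE [\1_B _]indicE (negbTE hB).
by rewrite mul0r mulr0.
Qed.

Variable m : {measure set T -> \bar R}.

Lemma powR_normD (p a b : R) : 0 <= p ->
  `|a + b| `^ p <= 2 `^ p * (`|a| `^ p + `|b| `^ p).
Proof.
move=> p0; wlog ab : a b / `|a| <= `|b|.
  move=> h; have [/h//|/ltW/h] := leP `|a| `|b|.
  by rewrite addrC [X in _ * X]addrC.
apply: (@le_trans _ _ ((2 * `|b|) `^ p)).
  rewrite ge0_ler_powR ?nnegrE ?mulr_ge0// (le_trans (ler_normD _ _))//.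
  by rewrite mulr_natl mulr2n lerD2r.
by rewrite powRM// ler_wpM2l ?powR_ge0// lerDr powR_ge0.
Qed.

Lemma pintD (p : R) (u w : T -> R) : 0 <= p ->
  measurable_fun setT u -> measurable_fun setT w ->
  (pint m p (fun x => (u x + w x)%R) <= (2 `^ p)%:E * (pint m p u + pint m p w))%E.
Proof.
move=> p0 mu_ mw.
have mu' := measurable_powR_norm p mu_; have mw' := measurable_powR_norm p mw.
have mup : measurable_fun setT (fun x => (`|u x| `^ p)%:E) by exact/measurable_EFinP.
have mwp : measurable_fun setT (fun x => (`|w x| `^ p)%:E) by exact/measurable_EFinP.
have p2 : (0%R <= (2 `^ p)%:E)%E by rewrite lee_fin powR_ge0.
rewrite /pint -ge0_integralD// -ge0_integralZl//; [|exact: emeasurable_funD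
  |by move=> x _; apply: adde_ge0; rewrite lee_fin powR_ge0].
apply: ge0_le_integral => //.
- apply/measurable_EFinP; apply: measurable_powR_norm; exact: measurable_funD.
- by apply: measurable_funeM; exact: emeasurable_funD.
by move=> x _; rewrite -EFinD -EFinM lee_fin powR_normD.
Qed.

Lemma pint_le (p c : R) (u w : T -> R) : 0 <= p -> 0 <= c ->
  measurable_fun setT u -> measurable_fun setT w -> (forall x, `|u x| <= c * `|w x|) ->
  (pint m p u <= (c `^ p)%:E * pint m p w)%E.
Proof.
move=> p0 c0 mu_ mw uw.
have mwp : measurable_fun setT (fun x => (`|w x| `^ p)%:E).
  exact: emeasurable_powR_norm.
rewrite /pint -ge0_integralZl// ?lee_fin ?powR_ge0//.
apply: ge0_le_integral => //.
- exact: emeasurable_powR_norm.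
- exact: measurable_funeM.
move=> x _; rewrite -EFinM lee_fin -powRM// ge0_ler_powR ?nnegrE ?mulr_ge0//.
Qed.

End tonelli_bounds.

Section sobolev_level.
Context {R : realType} {N : nat}.
Local Notation H := 'rV[R]_(N + N + 1).
Local Notation mu := (leb (N + N + 1)).
Local Notation TR := (measurableTypeR R).

Implicit Types (h k l : H) (y : 'rV[R]_(N + N)).

(** Sides of order [r] horizontally and [r^2] vertically follow the dilations of the group, so the
    volume is a multiple of [r^Q]. A vertical displacement up to [r^2] is also what a commutator of
    two horizontal steps of size [r] can reach. *)
Definition hbox (r : R) : set H :=
  obox (snoc (const_mx (- r), - r ^+ 2)) (snoc (const_mx r, r ^+ 2)).

Lemma leb_hbox (r : R) : 0 <= r ->
  mu (hbox r) = (2 ^+ (N + N + 1) * r ^+ (2 * N + 2))%:E.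
Proof.
move=> r0; rewrite leb_obox => [|i]; last first.
  case: (splitP i) => j ij.
    have -> : i = lshift 1 j by exact/val_inj.
    by rewrite !snocl !mxE ge0_cp.
  have -> : i = rshift (N + N) j by exact/val_inj.
  by rewrite !snocr ge0_cp// exprn_ge0.
congr EFin; rewrite big_split_ord/= big_ord1 !snocr.
under eq_bigr do rewrite !snocl !mxE.
rewrite prodr_const card_ord.
have e (x : R) : x - - x = 2 * x by ring.
rewrite !e exprMn mulrACA -exprSr -exprD.
by rewrite addn1 mul2n addnn.
Qed.

Lemma hboxP (r : R) h : 0 <= r -> hbox r h ->
  (forall j, `|lsubmx h ord0 j| <= r) /\ `|htau h| <= r ^+ 2.
Proof.
move=> r0 hB; split=> [j|].
  have := hB (lshift 1 j); rewrite !snocl !mxE in_itv/= => /andP[? ?].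
  by rewrite ler_norml !ltW.
have := hB (rshift (N + N) ord0); rewrite !snocr in_itv/= => /andP[? ?].
by rewrite ler_norml !ltW.
Qed.

(* The commutator of the exponentials of [a X_i] and [b X_{N+i}] is the
   vertical translation by [a b]. *)
Lemma horiz_factor (i : 'I_N) (h : H) (a b : R) : htau h = a * b ->
  let e1 : 'rV[R]_(N + N) := a *: delta_mx ord0 (lshift N i) in
  let e2 : 'rV[R]_(N + N) := b *: delta_mx ord0 (rshift N i) in
  h = hmul (horiz (lsubmx h)) (hmul (hmul (horiz e1) (horiz e2))
                                    (hmul (horiz (- e1)) (horiz (- e2)))).
Proof.
move=> hab e1 e2.
have e12 : rsymp e1 e2 = a * b.
  by rewrite /e1 /e2 rsympZl rsympZr rsymp_basisr mxE !eqxx mulr1.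
have e21 : rsymp e2 e1 = - (a * b).
  by rewrite /e1 /e2 rsympZl rsympZr rsymp_basisl mxE !eqxx mulrN mulr1 mulrN mulrC.
apply: hP; first by rewrite !lsubmx_hmul !lsubmx_horiz addrACA !subrr !addr0.
rewrite !htau_hmul !lsubmx_hmul !lsubmx_horiz !htau_horiz.
rewrite !(rsympDl, rsympDr, rsympNl, rsympNr, rsympvv, e12, e21) hab.
by field.
Qed.

Definition translation_pint (p : R) (w : H -> R) (h : H) : \bar R :=
  pint mu p (fun x => (w (hmul x h) - w x)%R).

(** The increment along [h k] is the increment along [k] taken at the point [x h], plus the
    increment along [h]; right translation by [h] preserves the measure. *)
Lemma translation_pintM (p : R) (w : H -> R) h k : 0 <= p -> measurable_fun setT w ->
  (translation_pint p w (hmul h k) <=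
   (2 `^ p)%:E * (translation_pint p w k + translation_pint p w h))%E.
Proof.
move=> p0 mw.
have mr z : measurable_fun setT (fun x : H => hmul x z) := (mpres_hmulr z).1.
have md z : measurable_fun setT (fun x => w (hmul x z) - w x).
  by apply: measurable_funB => //; exact: measurableT_comp mw (mr z).
rewrite /translation_pint -(pint_comp p (mpres_hmulr h) (md k)).
have mdk := measurableT_comp (md k) (mr h).
apply: le_trans (pintD mu p0 mdk (md h)).
apply: le_of_eq; apply: eq_integral => x _.
by rewrite /= hmulA addrA subrK.
Qed.

Lemma hgrad_norm_ge0 (g : 'I_(N + N) -> H -> R) x : 0 <= hgrad_norm g x.
Proof. exact: sqrtr_ge0. Qed.

Lemma ler_hgrad_norm (g : 'I_(N + N) -> H -> R) j x : `|g j x| <= hgrad_norm g x.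
Proof.
rewrite -sqrtr_sqr ler_wsqrtr// /hdot (bigD1 j)//= expr2 lerDl sumr_ge0// => i _.
by rewrite -expr2 sqr_ge0.
Qed.

Lemma measurable_hgrad_norm (g : 'I_(N + N) -> H -> R) :
  (forall j, measurable_fun setT (g j)) -> measurable_fun setT (hgrad_norm g).
Proof.
move=> mg; rewrite (_ : hgrad_norm g = fun x => (`|hdot g g x|) `^ 2^-1).
  apply: measurable_powR_norm; apply: measurable_sum => j; exact: measurable_funM.
apply/funext => x; have d0 : 0 <= hdot g g x.
  by apply: sumr_ge0 => j _; rewrite -expr2 sqr_ge0.
by rewrite ger0_norm// powR12_sqrt.
Qed.

Variables (p : R) (w : H -> R) (g : 'I_(N + N) -> H -> R).
Hypotheses (N0 : (0 < N)%N) (p1 : 1 < p) (wL : Lp mu p w)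
  (mg : forall j, measurable_fun setT (g j)) (gL : Lp mu p (hgrad_norm g))
  (weak : forall y, weak_dir w (fun x => \sum_j y ord0 j * g j x) y).

Let p0 : 0 <= p. Proof. by rewrite (le_trans ler01)// ltW. Qed.
Let mw : measurable_fun setT w := wL.1.

Lemma horiz_translation_pint (r : R) y : 0 <= r -> (forall j, `|y ord0 j| <= r) ->
  (translation_pint p w (horiz y) <=
   ((r * (2 * N)%:R) `^ p)%:E * pint mu p (hgrad_norm g))%E.
Proof.
move=> r0 yr; pose gy x := \sum_j y ord0 j * g j x.
have mgy : measurable_fun setT gy.
  by apply: measurable_sum => j; exact: measurable_funM.
have le_gy x : `|gy x| <= r * (2 * N)%:R * `|hgrad_norm g x|.
  rewrite (ger0_norm (hgrad_norm_ge0 g x)) (le_trans (ler_norm_sum _ _ _))//.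
  apply: (@le_trans _ _ (\sum_(j < N + N) r * hgrad_norm g x)).
    by apply: ler_sum => j _; rewrite normrM ler_pM// ler_hgrad_norm.
  by rewrite sumr_const card_ord addnn -mul2n -[leLHS]mulr_natr mulrAC.
have rN0 : 0 <= r * (2 * N)%:R by rewrite mulr_ge0.
have gyg := pint_le mu p0 rN0 mgy gL.1 le_gy.
have gyL : Lp mu p gy.
  split => //; apply: le_lt_trans gyg _.
  by rewrite lte_mul_pinfty// ?lee_fin ?powR_ge0//; exact: gL.2.
apply: le_trans gyg.
have := flow_translation_Lp p1 wL gyL (weak y).
by rewrite /flow scale1r.
Qed.

Lemma box_translation_pint (r : R) h : 0 <= r -> hbox r h ->
  (translation_pint p w h <= ((2 * 2 `^ p) ^+ 3)%:E *
   (((r * (2 * N)%:R) `^ p)%:E * pint mu p (hgrad_norm g)))%E.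
Proof.
move=> r0 /(hboxP r0)[hr ht]; set K := (X in (_ * X)%E); set c := 2 * _.
have K0 : (0 <= K)%E by rewrite mule_ge0 ?pint_ge0// lee_fin powR_ge0.
have hor y : (forall j, `|y ord0 j| <= r) ->
    (translation_pint p w (horiz y) <= 1%:E * K)%E.
  by move=> yr; rewrite mul1e; exact: horiz_translation_pint.
clearbody K.
have c1 : 1 <= c.
  rewrite /c -[leLHS]mulr1 ler_pM ?ler1n//.
  by rewrite -[leLHS](powRr0 2) ler_powR ?ler1n.
have c0 : 0 <= c by rewrite (le_trans ler01).
have step k l (b : R) : 0 <= b -> (translation_pint p w k <= b%:E * K)%E ->
    (translation_pint p w l <= b%:E * K)%E ->
    (translation_pint p w (hmul k l) <= (b * c)%:E * K)%E.
  move=> b0 kb lb; apply: le_trans (translation_pintM k l p0 mw) _; rewrite addeC.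
  apply: (@le_trans _ _ ((2 `^ p)%:E * (b%:E * K + b%:E * K))%E).
    by apply: lee_wpmul2l; [rewrite lee_fin powR_ge0|exact: leeD kb lb].
  rewrite -ge0_muleDl ?lee_fin// muleA -EFinD -EFinM.
  by rewrite (_ : 2 `^ p * (b + b) = b * c)// /c; ring.
pose a := Num.sqrt `|htau h|; pose b := htau h / a.
have a0 : 0 <= a by exact: sqrtr_ge0.
have aa : a * a = `|htau h| by rewrite -expr2 sqr_sqrtr.
have ar : a <= r by rewrite -(ger0_norm r0) -sqrtr_sqr ler_wsqrtr.
have ab : htau h = a * b.
  have [a00|a00] := eqVneq a 0; last by rewrite /b mulrC divfK.
  by apply/eqP; rewrite a00 mul0r -normr_eq0 -aa a00 mulr0.
have br : `|b| <= r.
  have [a00|a00] := eqVneq a 0; first by rewrite /b a00 invr0 mulr0 normr0.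
  by rewrite /b normrM -aa normfV (ger0_norm a0) mulfK.
pose i := Ordinal N0.
have small j j1 (t : R) : `|t| <= r -> `|(t *: delta_mx ord0 j1 : 'rV[R]_(N + N)) ord0 j| <= r.
  move=> tr; rewrite !mxE eqxx /=; case: (_ == _); rewrite ?mulr1//.
  by rewrite mulr0 normr0.
rewrite (horiz_factor i ab).
set e1 := _ *: _; set e2 := _ *: _.
have e1r j : `|e1 ord0 j| <= r by apply: small; rewrite ger0_norm.
have e2r j : `|e2 ord0 j| <= r by exact: small.
have Ne1r j : `|(- e1) ord0 j| <= r by rewrite mxE normrN.
have Ne2r j : `|(- e2) ord0 j| <= r by rewrite mxE normrN.
(* The five horizontal factors form a product tree of depth 3, and every level costs a factor [c].
   The outermost product pairs one horizontal factor with the commutator, so the bound of the former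
   is weakened to that of the latter. *)
have := step _ _ (c * c).
rewrite (_ : c * c * c = c ^+ 3); last by rewrite !exprS expr0; ring.
apply.
- exact: mulr_ge0.
- apply: le_trans (hor _ hr) _; rewrite lee_wpmul2r// lee_fin.
  by rewrite -[leLHS]mulr1 ler_pM.
apply: (step) => //.
  by have := step _ _ 1 ler01 (hor _ e1r) (hor _ e2r); rewrite mul1r.
by have := step _ _ 1 ler01 (hor _ Ne1r) (hor _ Ne2r); rewrite mul1r.
Qed.

(** The first 2 is the measure of the box divided by that of its guaranteed part in the translate of
    [{w = 0}]; the cube comes from the factorization into horizontal elements, and [(2 N)^p] from
    bounding a horizontal derivative by the gradient. *)
Definition level_cst : R := 2 * (2 * 2 `^ p) ^+ 3 * (2 * N)%:R `^ p.

Lemma level_cst_ge0 : 0 <= level_cst.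
Proof. by rewrite !mulr_ge0 ?powR_ge0// exprn_ge0// mulr_ge0// powR_ge0. Qed.

Let P := [set x | 0 < w x].

Let mP : measurable P.
Proof. exact: (measurable_superlevel 0 mw).1. Qed.

(* For x in {w >= L}, the left translate of {w = 0} fills at least half of a box
   of measure 2 |{w > 0}|; averaging |w (x h) - w x|^p over that box bounds L^p
   by the p-th powers of horizontal differences. *)
Lemma sobolev_level (L : R) : (forall x, 0 <= w x) -> (mu P < +oo)%E -> 0 <= L ->
  ((L `^ p)%:E * mu [set x | (L <= w x)%R] <=
   (level_cst * fine (mu P) `^ (p / @hdim R N))%:E * pint mu p (hgrad_norm g))%E.
Proof.
move=> w0 Poo L0; have [L00|Ln0] := eqVneq L 0.
  rewrite L00 powR0 ?mul0e ?mule_ge0 ?pint_ge0//; last by rewrite gt_eqF// (lt_trans ltr01).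
  by rewrite lee_fin !mulr_ge0 ?powR_ge0 ?exprn_ge0 ?mulr_ge0 ?powR_ge0.
have Lpos : 0 < L by rewrite lt_neqAle eq_sym Ln0.
set E := [set x | L <= w x].
have mE : measurable E := (measurable_superlevel L mw).2.
have EP : E `<=` P by move=> x Lx; exact: lt_le_trans Lpos Lx.
set A := fine (mu P); have AE : mu P = A%:E by rewrite fineK// ge0_fin_numE.
have A0 : 0 <= A by exact: fine_ge0.
have [A00|An0] := eqVneq A 0.
  have -> : mu E = 0%E.
    by apply/eqP; rewrite eq_le measure_ge0 andbT -[leRHS]/(0%:E)%E -A00 -AE le_measure// inE.
  rewrite mule0 mule_ge0 ?pint_ge0// lee_fin.
  by rewrite !mulr_ge0 ?powR_ge0 ?exprn_ge0 ?mulr_ge0 ?powR_ge0.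
have Apos : 0 < A by rewrite lt_neqAle eq_sym An0.
pose Q : R := @hdim R N; have Q0 : 0 < Q by rewrite ltr0n addn_gt0 orbT.
(* Solves [2^(2N+1) * r^Q = 2 A], so that the box has twice the measure of [{w > 0}]. *)
pose r := (A / 4 ^+ N) `^ Q^-1; have r0 : 0 <= r by exact: powR_ge0.
have A40 : 0 <= A / 4 ^+ N by rewrite divr_ge0// exprn_ge0.
have rQ : r ^+ (2 * N + 2) = A / 4 ^+ N.
  by rewrite -powR_mulrn// -powRrM mulVf ?gt_eqF// powRr1.
have BE : mu (hbox r) = (2 * A)%:E.
  rewrite leb_hbox// rQ addn1 exprS addnn -mul2n exprM (_ : 2 ^+ 2 = 4 :> R); last first.
    by rewrite -natrX.
  by rewrite -mulrA [4 ^+ N * _]mulrCA mulfV ?mulr1// expf_neq0.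
have mB : measurable (hbox r) by exact: measurable_obox.
pose F (z : H * H) := `|w (hmul z.1 z.2) - w z.1| `^ p.
have mF : measurable_fun setT F.
  apply: measurable_powR_norm; apply: measurable_funB.
    exact: measurableT_comp mw measurable_hmul.
  exact: measurableT_comp mw measurable_fst.
have [I IE] : exists I, pint mu p (hgrad_norm g) = I%:E.
  by exists (fine (pint mu p (hgrad_norm g))); rewrite fineK// ge0_fin_numE ?pint_ge0// gL.2.
have I0 : 0 <= I by rewrite -lee_fin -IE pint_ge0.
pose c := (2 * 2 `^ p) ^+ 3; have c0 : 0 <= c by rewrite exprn_ge0// mulr_ge0// powR_ge0.
pose K := c * ((r * (2 * N)%:R) `^ p * I).
have K0 : 0 <= K by rewrite !mulr_ge0// powR_ge0.
have LA0 : 0 <= L `^ p * A by rewrite mulr_ge0// powR_ge0.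
have lower x : E x -> ((L `^ p * A)%:E <= \int[mu]_h (\1_(hbox r) h * F (x, h))%:E)%E.
  move=> Ex; pose Z := [set h | P (hmul x h)].
  have mZ : measurable Z.
    rewrite -[Z]setTI; exact: ((mpres_hmull x).1 measurableT _ mP).
  have ZA : mu Z = A%:E by rewrite -AE; exact: ((mpres_hmull x).2 _ mP).
  (* The points [h] with [w (x h) > 0] form a left translate of [P], of measure [A]; they leave at
     least [A] of the box. *)
  have AS : (A%:E <= mu (hbox r `\` Z))%E.
    have e : ((2 * A)%:E = mu (hbox r `\` Z) + mu (hbox r `&` Z))%E.
      by rewrite -BE; exact: measureDI.
    have le2 : (mu (hbox r `&` Z) <= A%:E)%E.
      by rewrite -ZA le_measure ?inE//; exact: measurableI.
    have : (A%:E + A%:E <= mu (hbox r `\` Z) + A%:E)%E.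
      by rewrite -EFinD -mulr2n -mulr_natl e leeD2l.
    by rewrite leeD2rE.
  apply: (@le_trans _ _ ((L `^ p)%:E * mu (hbox r `\` Z))%E).
    by rewrite EFinM; apply: lee_wpmul2l => //; rewrite lee_fin powR_ge0.
  have mFx : measurable_fun setT (fun h => F (x, h)).
    by apply: (measurableT_comp mF); exact: measurable_fun_pair.
  apply: ge_integral_indic.
  - exact: measurableD.
  - exact: powR_ge0.
  - by apply: measurable_funM => //; exact: measurable_indic.
  - by move=> h; rewrite mulr_ge0 ?powR_ge0// indicE.
  move=> h [hB nP]; rewrite indicE mem_set// mul1r /F /=.
  have -> : w (hmul x h) = 0.
    by apply/eqP; rewrite eq_le w0 andbT leNgt; apply/negP.
  rewrite sub0r normrN (ger0_norm (w0 x)) ge0_ler_powR ?nnegrE//.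
have upper h : hbox r h -> (\int[mu]_x (F (x, h))%:E <= K%:E)%E.
  move=> hB; have := box_translation_pint r0 hB; rewrite IE.
  by rewrite /K !EFinM.
have := tonelli_level mE mB mF (fun z => powR_ge0 _ _) LA0 K0 lower upper.
have [e eE] : exists e, mu E = e%:E.
  exists (fine (mu E)); rewrite fineK// ge0_fin_numE//; apply: le_lt_trans Poo.
  by rewrite le_measure ?inE.
rewrite BE eE IE -!EFinM !lee_fin => le1.
have {}le1 : L `^ p * e <= 2 * K.
  by rewrite -(ler_pM2r Apos) mulrAC (le_trans le1)// mulrCA mulrA.
apply: le_trans le1 _; rewrite /K /level_cst -/c powRM//.
have rp : r `^ p <= A `^ (p / Q).
  have pQ0 : 0 <= p / Q by rewrite divr_ge0// ltW.
  rewrite /r -powRrM [Q^-1 * p]mulrC ge0_ler_powR ?nnegrE//.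
  by rewrite ler_piMr// invf_le1 ?exprn_gt0// exprn_ege1// ler1n.
rewrite [leLHS](_ : _ = 2 * c * (2 * N)%:R `^ p * I * r `^ p); last by ring.
rewrite [leRHS](_ : _ = 2 * c * (2 * N)%:R `^ p * I * A `^ (p / Q)); last by rewrite /Q; ring.
by rewrite ler_wpM2l// !mulr_ge0// powR_ge0.
Qed.

End sobolev_level.

(** * Weak horizontal gradients on the group and on open subsets *)

Section Lnorm_pint.
Context {d} {T : measurableType d} {R : realType} (m : {measure set T -> \bar R}).

Lemma finite_norm_pint (p : R) (f : T -> R) : 0 < p ->
  finite_norm m p%:E f <-> (pint m p f < +oo)%E.
Proof.
move=> p0; rewrite /finite_norm unlock /=.
rewrite (_ : (\int[m]_x _)%E = pint m p f); last by [].
by split => [/lty_poweRy->//|/poweR_lty//]; rewrite invr_eq0 gt_eqF.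
Qed.

Lemma Rintegral_sum (I : Type) (s : seq I) (h : I -> T -> R) :
  (forall i, m.-integrable setT (EFin \o h i)) ->
  \int[m]_x (\sum_(i <- s) h i x) = \sum_(i <- s) \int[m]_x h i x.
Proof.
move=> hi; suff : m.-integrable setT (EFin \o (fun x => \sum_(i <- s) h i x)) /\
  \int[m]_x (\sum_(i <- s) h i x) = \sum_(i <- s) \int[m]_x h i x by case.
elim: s => [|i s [IH1 IH2]].
  split; last by rewrite big_nil; under eq_Rintegral do rewrite big_nil;
    by rewrite /Rintegral integral0.
  rewrite (_ : _ \o _ = cst 0%E); first exact: integrable0.
  by apply/funext => x; rewrite /= big_nil.
split.
  rewrite (_ : _ \o _ = EFin \o (fun x => h i x + \sum_(i <- s) h i x)).
    exact: integrable_EFinD.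
  by apply/funext => x; rewrite /= big_cons.
under eq_Rintegral do rewrite big_cons.
by rewrite RintegralD// IH2 big_cons.
Qed.

End Lnorm_pint.

Section weak_gradient.
Context {R : realType} {N : nat}.
Local Notation H := 'rV[R]_(N + N + 1).
Local Notation mu := (leb (N + N + 1)).
Implicit Types (phi u : H -> R) (g : 'I_(N + N) -> H -> R) (D : set H)
  (y : 'rV[R]_(N + N)) (p : R).

Lemma inLp_Lp p u : 0 < p -> inLp setT p%:E u <-> Lp mu p u.
Proof.
move=> p0; rewrite /inLp patch_setT; split => -[mu_ up]; split => //;
  exact/finite_norm_pint.
Qed.

Lemma Lp_loc_integrable p u D : 1 <= p -> Lp mu p u -> loc_integrable D u.
Proof.
move=> p1 uL; split; first exact: measurable_funTS uL.1.
move=> K cK _; have mK : measurable K.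
  by apply: closed_measurable_rV; exact: compact_closed.
have bK : bint mu (\1_K : H -> R).
  by apply: bint_indic => //; apply: leb_bounded => //; exact: compact_bounded.
apply/(integrable_mkcond _ mK).
have := Lp_bint p1 uL bK; congr (_.-integrable _ _); apply/funext => x /=.
by rewrite /patch indicE; case: ifPn; rewrite ?mulr1 ?mulr0.
Qed.

Lemma hvfE phi j : smooth phi -> hvf j phi = hderiv (delta_mx ord0 j) phi.
Proof.
move=> sphi; apply/funext => xi; rewrite (hderivE _ xi (sphi 1%N)) (bigD1 j)//=.
rewrite big1 ?addr0 => [|i ij]; first by rewrite mxE !eqxx mul1r.
by rewrite mxE eqxx (negbTE ij) mul0r.
Qed.

Lemma compactly_supported_setT D phi : compactly_supported D phi ->
  compactly_supported setT phi.
Proof. by case. Qed.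

Lemma weak_hgrad_dir p u g : 1 <= p -> Lp mu p u -> (forall j, Lp mu p (g j)) ->
  weak_hgrad setT u g -> forall y, weak_dir u (fun x => \sum_j y ord0 j * g j x) y.
Proof.
move=> p1 uL gL [_ _ weak] y phi sphi cphi.
have bphi := bint_test sphi cphi.
have iu j : mu.-integrable setT (EFin \o (fun x => y ord0 j * (u x * hvf j phi x))).
  by apply: integrable_EFinZ; apply: Lp_bint p1 uL _; rewrite hvfE//; exact: bint_hderiv.
have ig j : mu.-integrable setT (EFin \o (fun x => y ord0 j * (g j x * phi x))).
  by apply: integrable_EFinZ; exact: Lp_bint p1 (gL j) bphi.
transitivity (\int[mu]_x (\sum_j y ord0 j * (u x * hvf j phi x))).
  apply: eq_Rintegral => x _; rewrite (hderivE _ x (sphi 1%N)) mulr_sumr.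
  by apply: eq_bigr => j _; rewrite mulrCA.
transitivity (- \int[mu]_x (\sum_j y ord0 j * (g j x * phi x))); last first.
  apply: (congr1 -%R); apply: eq_Rintegral => x _; rewrite mulr_suml.
  by apply: eq_bigr => j _; rewrite mulrA.
rewrite (Rintegral_sum _ iu) (Rintegral_sum _ ig) -sumrN; apply: eq_bigr => j _.
rewrite RintegralZl//; last first.
  by apply: Lp_bint p1 uL _; rewrite hvfE//; exact: bint_hderiv.
by rewrite weak// RintegralZl ?mulrN//; exact: Lp_bint p1 (gL j) bphi.
Qed.

Lemma weak_dir_hgrad p u g : 1 <= p -> Lp mu p u -> (forall j, Lp mu p (g j)) ->
  (forall j, weak_dir u (g j) (delta_mx ord0 j)) -> weak_hgrad setT u g.
Proof.
move=> p1 uL gL weak; split => [|j|j phi sphi cphi].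
- exact: Lp_loc_integrable uL.
- exact: Lp_loc_integrable (gL j).
- by rewrite hvfE// weak.
Qed.

(** A test function supported in [D] vanishes off [D] together with its derivatives, so its
    integrals over [D] and over the whole space agree. [HW1_0] provides gradients on the whole
    space, while the weak identity asks for gradients on [Omega]. *)
Lemma weak_hgrad_sub D u g : open D -> weak_hgrad setT u g -> weak_hgrad D u g.
Proof.
move=> oD [[mu_ ui] gi weak]; have mD := open_measurable_rV oD.
have sub h : loc_integrable setT h -> loc_integrable D h.
  by move=> [mh hi]; split; [exact: measurable_funTS|move=> K cK _; exact: hi].
split => [|j|j phi sphi cphi]; [exact: sub|exact: sub|].
have off x : ~ D x -> phi x = 0 /\ hvf j phi x = 0.
  move=> nD; have ncl : ~ closure [set x | phi x != 0] x by move=> /cphi.2.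
  split; last by rewrite hvfE//; exact: derive_off_support.
  by apply: contrapT => /eqP px; apply: ncl; exact: subset_closure.
have restr h : (forall x, ~ D x -> h x = 0) -> \int[mu]_(x in D) h x = \int[mu]_x h x.
  move=> h0; rewrite Rintegral_mkcond; apply: eq_Rintegral => x _.
  by rewrite /patch; case: ifPn => //; rewrite notin_setE => /h0.
rewrite restr => [|x nD]; last by rewrite (off x nD).2 mulr0.
rewrite [in RHS]restr => [|x nD]; last by rewrite (off x nD).1 mulr0.
exact/weak/(compactly_supported_setT cphi).
Qed.

End weak_gradient.

(** * Energy estimate *)

Section Lp_closure.
Context {d} {T : measurableType d} {R : realType} (m : {measure set T -> \bar R}).
Implicit Types (u w : T -> R) (p : R).

Lemma le_measure_ae (A B : set T) : measurable A -> measurable B ->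
  (\forall x \ae m, A x -> B x) -> (m A <= m B)%E.
Proof.
move=> mA mB AB; rewrite -[m A]mul1e -[m B]mul1e -!integral_indicZ//.
apply: ae_ge0_le_integral => //.
- by apply/measurable_EFinP; apply: measurable_funM => //; exact: measurable_indic.
- by apply/measurable_EFinP; apply: measurable_funM => //; exact: measurable_indic.
apply: filterS AB => x AB _; rewrite lee_fin !mul1r !indicE ler_nat.
case: (boolP (x \in A)) => // /set_mem/AB Bx.
by rewrite mem_set.
Qed.

Lemma LpD p u w : 0 <= p -> Lp m p u -> Lp m p w -> Lp m p (fun x => u x + w x).
Proof.
move=> p0 [mu_ up] [mw wp]; split; first exact: measurable_funD.
apply: le_lt_trans (pintD m p0 mu_ mw) _; rewrite lte_mul_pinfty ?lee_fin ?powR_ge0//.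
exact: (lte_add_pinfty up wp).
Qed.

Lemma LpZ p (c : R) u : 0 <= p -> Lp m p u -> Lp m p (fun x => c * u x).
Proof.
move=> p0 [mu_ up]; have mcu : measurable_fun setT (fun x => c * u x) by exact: measurable_funM.
have cu x : `|c * u x| <= `|c| * `|u x| by rewrite normrM.
split; [exact: mcu|apply: le_lt_trans (pint_le m p0 (normr_ge0 c) mcu mu_ cu) _].
by rewrite lte_mul_pinfty ?lee_fin ?powR_ge0.
Qed.

Lemma Lp0 p : 0 < p -> Lp m p (fun=> 0).
Proof.
move=> p0; split; first exact: measurable_cst.
rewrite /pint; under eq_integral do rewrite normr0 powR0 ?gt_eqF//.
by rewrite integral0 ltry.
Qed.

Lemma Lp_sum p (I : Type) (s : seq I) (h : I -> T -> R) : 0 < p ->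
  (forall i, Lp m p (h i)) -> Lp m p (fun x => \sum_(i <- s) h i x).
Proof.
move=> p0 hp; elim: s => [|i s IH].
  rewrite (_ : (fun x => _) = fun=> 0); first exact: Lp0.
  by apply/funext => x; rewrite big_nil.
rewrite (_ : (fun x => _) = fun x => h i x + \sum_(i <- s) h i x).
  exact: LpD (ltW p0) (hp i) IH.
by apply/funext => x; rewrite big_cons.
Qed.

Lemma Lp_norm p u : Lp m p u -> Lp m p (fun x => `|u x|).
Proof.
move=> [mu_ up]; split; first exact: measurableT_comp.
by rewrite /pint; under eq_integral do rewrite normr_id.
Qed.

End Lp_closure.

Section energy.
Context {R : realType} {N : nat}.
Local Notation H := 'rV[R]_(N + N + 1).
Local Notation mu := (leb (N + N + 1)).
Implicit Types (g : 'I_(N + N) -> H -> R) (y : 'rV[R]_(N + N)) (x : H).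

Lemma hgrad_norm_le_sum g x : hgrad_norm g x <= \sum_j `|g j x|.
Proof.
have S0 : 0 <= \sum_j `|g j x| by exact: sumr_ge0.
rewrite -(ger0_norm S0) -sqrtr_sqr ler_wsqrtr// expr2 mulr_suml /hdot.
apply: ler_sum => j _; rewrite -expr2 -real_normK ?num_real// expr2 ler_wpM2l//.
by rewrite (bigD1 j)//= lerDl sumr_ge0.
Qed.

Lemma Lp_hgrad_norm (p : R) g : 0 < p -> (forall j, Lp mu p (g j)) -> Lp mu p (hgrad_norm g).
Proof.
move=> p0 gL; apply: (@Lp_le _ _ _ mu p _ (fun x => \sum_j `|g j x|)).
- exact: ltW.
- by apply: measurable_hgrad_norm => j; exact: (gL j).1.
- by apply: (Lp_sum _ p0) => j; exact: Lp_norm.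
move=> x; rewrite ger0_norm ?hgrad_norm_ge0// ger0_norm ?hgrad_norm_le_sum//.
exact: sumr_ge0.
Qed.

Lemma hgrad_normZ g (c : H -> R) x :
  hgrad_norm (fun j x => c x * g j x) x = `|c x| * hgrad_norm g x.
Proof.
rewrite /hgrad_norm (_ : hdot _ _ x = c x ^+ 2 * hdot g g x).
  by rewrite sqrtrM ?sqr_ge0// sqrtr_sqr.
by rewrite /hdot mulr_sumr; apply: eq_bigr => j _; ring.
Qed.

Lemma local_termZ (p : R) g (c : H -> R) x : 0 < p ->
  local_term p g (fun j x => c x * g j x) x = c x * hgrad_norm g x `^ p.
Proof.
move=> p0; rewrite /local_term.
have -> : hdot g (fun j x => c x * g j x) x = c x * hdot g g x.
  by rewrite /hdot mulr_sumr; apply: eq_bigr => j _; ring.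
rewrite mulrCA; congr (_ * _).
have h0 : 0 <= hdot g g x by apply: sumr_ge0 => j _; rewrite -expr2 sqr_ge0.
have -> : hdot g g x = hgrad_norm g x ^+ 2 by rewrite sqr_sqrtr.
have [->|n0] := eqVneq (hgrad_norm g x) 0; first by rewrite expr0n mulr0 powR0// gt_eqF.
by rewrite -powR_mulrn ?hgrad_norm_ge0// -powRD ?subrK// n0 implybT.
Qed.

(** A nondecreasing [G] gives the increments of [u] and of [G \o u] the same sign, and [Jp]
    preserves signs. *)
Lemma nonlocal_term_ge0 (s p : R) (u : H -> R) (G : R -> R) z :
  {homo G : a b / a <= b} -> 0 <= nonlocal_term s p u (G \o u) z.
Proof.
move=> Gm; rewrite /nonlocal_term /Jp divr_ge0 ?powR_ge0// -mulrA mulr_ge0 ?powR_ge0//=.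
have [le|/ltW le] := leP (u z.1) (u z.2).
  by rewrite mulr_le0 ?subr_le0 ?Gm.
by rewrite mulr_ge0 ?subr_ge0 ?Gm.
Qed.

Variables (Omega : set H) (s p alpha : R) (f v : H -> R) (n : nat) (a r : R).
Hypotheses (N0 : (0 < N)%N) (oO : open Omega) (bO : bounded_set Omega) (p1 : 1 < p)
  (alpha0 : 0 < alpha) (mf : measurable_fun Omega f) (n0 : (0 < n)%N)
  (sol : approx_solution Omega s p alpha f n v) (a0 : 0 <= a) (r0 : 0 < r).

Let p0 : 0 < p. Proof. exact: lt_trans p1. Qed.
Let p1' : 1 <= p. Proof. exact: ltW. Qed.
Let mO : measurable Omega := open_measurable_rV oO.
Let w := itent a r \o v.

Let ramp_bound t : 0 <= t -> itent a r t <= t.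
Proof.
move=> t0; have := itent_lip a r0 0 t; rewrite (itent_eq0 r0 a0) !subr0.
by rewrite !ger0_norm// itent_ge0.
Qed.

(** On [{v > a}] one has [w <= v <= v + 1/n], which cancels the singular factor uniformly in [n];
    elsewhere [w] vanishes. *)
Let source_bound (x : H) :
  `|Num.min (f x) n%:R * (Num.max (v x) 0 + n%:R^-1)^-1 * w x| <=
  `|f x| * \1_[set x | a < v x] x.
Proof.
rewrite /w /= indicE; have [vx|vx] := boolP (x \in _); last first.
  have va : v x <= a by rewrite leNgt; apply/negP => av; move: vx; rewrite mem_set.
  by rewrite (itent_eq0 r0 va) mulr0 normr0 mulr0.
have v0 : 0 < v x by apply: le_lt_trans a0 _; exact: (set_mem vx).
have ni : 0 < n%:R^-1 :> R by rewrite invr_gt0 ltr0n.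
rewrite max_l ?(ltW v0)// -mulrA normrM ler_pM//.
  have [//|nf] := leP (f x) n%:R.
  by rewrite (ger0_norm (ler0n _ _)) (le_trans (ltW nf))// ler_norm.
have vn : 0 < v x + n%:R^-1 by exact: addr_gt0.
rewrite mulrC normrM normfV (gtr0_norm vn) ger0_norm ?itent_ge0// ler_pdivrMr// mul1r.
by rewrite (le_trans (ramp_bound (ltW v0)))// lerDl ltW.
Qed.

Lemma energy_level :
  ((r `^ p)%:E * mu [set x | (a + 2 * r <= v x)%R] <=
   (@level_cst R N p * fine (mu [set x | a < v x]) `^ (p / @hdim R N))%:E *
   \int[mu]_(x in Omega `&` [set x | (a < v x)%R]) `|f x|%:E)%E.
Proof.
have [[[vL [g wg gL]] v0] _ _ test] := sol.
have {}vL : Lp mu p v := (inLp_Lp v p0).1 vL.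
have {}gL j : Lp mu p (g j) := (inLp_Lp (g j) p0).1 (gL j).
have mv : measurable_fun setT v := vL.1.
pose gw j x := tent a r (v x) * g j x.
have mcv : measurable_fun setT (fun x => tent a r (v x)).
  exact: measurableT_comp (measurable_tent a r) mv.
have gwL j : Lp mu p (gw j).
  apply: (@Lp_le _ _ _ mu p _ (g j)) => [|||x]; [exact: ltW| |exact: gL|].
    by apply: measurable_funM => //; exact: (gL j).1.
  by rewrite normrM ler_piMl// tent_norm.
have wL : Lp mu p w.
  apply: (Lp_lipschitz p1 vL (measurable_itent a r)) => [b c|].
    exact: itent_lip.
  exact: itent_eq0.
have weak_w y : weak_dir w (fun x => \sum_j y ord0 j * gw j x) y.
  have gyL : Lp mu p (fun x => \sum_j y ord0 j * g j x).
    by apply: (Lp_sum _ p0) => j; exact: LpZ (ltW p0) (gL j).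
  have r4 : 0 <= 4 / r by rewrite divr_ge0// ltW.
  have := weak_dir_comp p1 vL gyL (weak_hgrad_dir p1' vL gL wg y)
    (measurable_itent a r) (measurable_tent a r) (tent_norm a r0) (itent_lip a r0)
    (itent_quad a r0) (tent_lip a r0) r4 (itent_eq0 r0 a0).
  congr (weak_dir _ _ _); apply/funext => x; rewrite mulr_sumr.
  by apply: eq_bigr => j _; rewrite mulrCA.
have wgw : weak_hgrad setT w gw.
  apply: (weak_dir_hgrad p1' wL gwL) => j; have := weak_w (delta_mx ord0 j).
  congr (weak_dir _ _ _); apply/funext => x; rewrite (bigD1 j)//= big1 ?addr0 => [|i ij].
    by rewrite mxE !eqxx mul1r.
  by rewrite mxE eqxx (negbTE ij) mul0r.
have wH : HW1_0 Omega p w.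
  split; last by apply: filterS v0 => x h /h vx; rewrite /w /= vx itent_eq0.
  split; first exact: (inLp_Lp w p0).2 wL.
  by exists gw; [exact: wgw|move=> j; exact: (inLp_Lp (gw j) p0).2 (gwL j)].
have [i1 i2 i3 e] := test w wH g gw (weak_hgrad_sub oO wg) (weak_hgrad_sub oO wgw).
set I1 := \int[mu]_(x in Omega) _ in e; set I3 := (RHS) in e.
have I13 : I1 <= I3.
  rewrite -e lerDl mulr_ge0 ?(ltW alpha0)//; apply: Rintegral_ge0 => z _.
  by apply: nonlocal_term_ge0 => b c; exact: itent_homo.
have gw_norm x : hgrad_norm gw x = tent a r (v x) * hgrad_norm g x.
  by rewrite hgrad_normZ ger0_norm// tent_ge0.
have localE x : local_term p g gw x = tent a r (v x) * hgrad_norm g x `^ p.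
  exact: local_termZ.
have local_ge0 x : 0 <= local_term p g gw x by rewrite localE mulr_ge0 ?tent_ge0 ?powR_ge0.
have hgwL : Lp mu p (hgrad_norm gw) by exact: Lp_hgrad_norm.
(* Uses that the [p]-th power of the tent is at most the tent, whose values lie between 0 and 1. Off
   [Omega], [v] vanishes almost everywhere, and there the tent is 0 because [a >= 0]. *)
have left_le : (pint mu p (hgrad_norm gw) <= I1%:E)%E.
  rewrite /I1 /Rintegral fineK; last exact: integrable_fin_num i1.
  rewrite integral_mkcond; apply: ae_ge0_le_integral => //.
  - exact: emeasurable_powR_norm hgwL.1.
  - by move=> x _; rewrite /patch; case: ifPn => // _; rewrite lee_fin.
  - by apply/(measurable_restrictT _ mO); exact: measurable_int i1.
  apply: filterS v0 => x h _; rewrite /patch; case: ifPn => [_|]; last first.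
    rewrite notin_setE => /h vx; rewrite gw_norm vx tent_eq0//; last by left.
    by rewrite mul0r normr0 powR0// gt_eqF.
  have t0 := tent_ge0 a r0 (v x); have h0 := hgrad_norm_ge0 g x.
  rewrite /= lee_fin localE gw_norm (ger0_norm (mulr_ge0 t0 h0)) (powRM _ t0 h0).
  rewrite ler_wpM2r ?powR_ge0//.
  have [->|tn0] := eqVneq (tent a r (v x)) 0; first by rewrite powR0// gt_eqF.
  rewrite -[leRHS](powRr1 t0) ger_powR// tent_le1// andbT.
  by rewrite lt_neqAle eq_sym tn0.
have right_le : (I3%:E <= \int[mu]_(x in Omega `&` [set x | (a < v x)%R]) `|f x|%:E)%E.
  have mlev : measurable [set x | a < v x] := (measurable_superlevel a mv).1.
  apply: (@le_trans _ _ (`|I3|%:E)); first by rewrite lee_fin ler_norm.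
  rewrite /I3 EFin_normr_Rintegral//; apply: le_trans (le_abse_integral _ mO _) _.
    exact: measurable_int i3.
  rewrite integral_mkcondr; apply: ge0_le_integral => //.
  - by apply: measurableT_comp => //; exact: measurable_int i3.
  - apply/(measurable_restrict _ mlev mO); apply/measurable_EFinP.
    by apply: measurableT_comp => //; exact: measurable_funS mf.
  move=> x _; apply: (@le_trans _ _ (`|f x| * \1_[set x | a < v x] x)%:E).
    by rewrite /= lee_fin source_bound.
  by rewrite /patch indicE; case: ifPn; rewrite ?mulr1 ?mulr0.
have mlev : measurable [set x | a < v x] := (measurable_superlevel a mv).1.
have levoo : (mu [set x | (a < v x)%R] < +oo)%E.
  apply: le_lt_trans (leb_bounded bO mO); apply: le_measure_ae => //.
  apply: filterS v0 => x h /= av; apply: contrapT => /h vx.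
  by move: av; rewrite vx ltNge a0.
have sub : [set x | 0 < w x] `<=` [set x | a < v x].
  move=> x /=; apply: contraTT; rewrite -!leNgt => va.
  by rewrite /w /= itent_eq0.
have mw0 : measurable [set x | 0 < w x] := (measurable_superlevel 0 wL.1).1.
have posle : (mu [set x | (0 < w x)%R] <= mu [set x | (a < v x)%R])%E.
  by rewrite le_measure ?inE.
have posoo : (mu [set x | (0 < w x)%R] < +oo)%E by exact: le_lt_trans levoo.
have mgw j : measurable_fun setT (gw j) := (gwL j).1.
have w_ge0 x : 0 <= w x := itent_ge0 a r0 (v x).
have key := sobolev_level N0 p1 wL mgw hgwL weak_w w_ge0 posoo (ltW r0).
(* Above [a + 2 r] the primitive of the tent is constantly [r], so that superlevel set of [v] lies
   in [{w >= r}]. *)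
apply: (@le_trans _ _ ((r `^ p)%:E * mu [set x | (r <= w x)%R])%E).
  apply: lee_wpmul2l; first by rewrite lee_fin powR_ge0.
  rewrite le_measure ?inE//; [exact: (measurable_superlevel _ mv).2
    |exact: (measurable_superlevel _ wL.1).2|].
  by move=> x /= /(itent_plateau r0); rewrite /w /= => ->.
apply: le_trans key _; apply: lee_pmul.
- by rewrite lee_fin mulr_ge0 ?powR_ge0 ?level_cst_ge0.
- exact: pint_ge0.
- rewrite lee_fin ler_wpM2l ?level_cst_ge0//.
  rewrite ge0_ler_powR ?nnegrE ?fine_ge0//.
    by rewrite divr_ge0// ?(ltW p0)// ler0n.
  by rewrite fine_le// ge0_fin_numE.
- apply: le_trans left_le (le_trans _ right_le).
  by rewrite lee_fin.
Qed.

End energy.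

(** * Passage to the limit in the approximate solutions *)

Section monotone_limit.
Context {d} {T : measurableType d} {R : realType} (m : {measure set T -> \bar R}).

Definition superlevel (D : set T) (u : T -> R) (b : R) : set T := D `&` [set x | b < u x].

Lemma measurable_superlevel_on (D : set T) (u : T -> R) (b : R) : measurable D ->
  measurable_fun D u -> measurable (superlevel D u b).
Proof.
move=> mD mu_.
rewrite /superlevel (_ : [set x | _] = u @^-1` `]b, +oo[%classic); first exact: mu_.
by apply/seteqP; split => x; rewrite /= in_itv/= andbT.
Qed.

Lemma superlevel_lty (D : set T) (u : T -> R) (b : R) : measurable D ->
  measurable_fun D u -> (m D < +oo)%E -> (m (superlevel D u b) < +oo)%E.
Proof.
move=> mD mu_; apply: le_lt_trans; rewrite le_measure ?inE//.
- exact: measurable_superlevel_on.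
- by move=> x [].
Qed.

Lemma measure_bigcup_le (B : nat -> set T) (M : \bar R) :
  (forall n, measurable (B n)) -> nondecreasing_seq B -> (forall n, m (B n) <= M)%E ->
  (m (\bigcup_n B n) <= M)%E.
Proof.
move=> mB ndB BM.
have cv := nondecreasing_cvg_mu (mu := m) mB (bigcup_measurable (fun n _ => mB n)) ndB.
rewrite -(cvg_lim _ cv)//; apply: lime_le; first by apply/cvg_ex; eexists; exact: cv.
by apply: nearW => n /=.
Qed.

Lemma le_integral_ae_subset (D A B : set T) (h : T -> \bar R) :
  measurable D -> measurable A -> measurable B -> measurable_fun D h ->
  (forall x, 0 <= h x)%E -> (\forall x \ae m, D x -> A x -> B x) ->
  (\int[m]_(x in D `&` A) h x <= \int[m]_(x in D `&` B) h x)%E.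
Proof.
move=> mD mA mB mh h0 AB; rewrite !integral_mkcondr; apply: ae_ge0_le_integral => //.
- by move=> x _; rewrite /patch; case: ifPn.
- by apply/(measurable_restrict _ mA mD); apply: measurable_funS mh.
- by move=> x _; rewrite /patch; case: ifPn.
- by apply/(measurable_restrict _ mB mD); apply: measurable_funS mh.
apply: filterS AB => x AB Dx; rewrite /patch.
case: (boolP (x \in A)) => [/set_mem/(AB Dx) Bx|_]; first by rewrite mem_set.
by case: ifPn.
Qed.

End monotone_limit.

Section level_estimate.
Context {R : realType} {N : nat}.
Local Notation H := 'rV[R]_(N + N + 1).
Local Notation mu := (leb (N + N + 1)).

Variables (Omega : set H) (s p alpha : R) (f u : H -> R) (u_ : nat -> H -> R).
Hypotheses (N0 : (0 < N)%N) (oO : open Omega) (bO : bounded_set Omega) (p1 : 1 < p)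
  (alpha0 : 0 < alpha) (mf : measurable_fun Omega f) (mu_ : measurable_fun Omega u)
  (sol : forall n, (0 < n)%N -> approx_solution Omega s p alpha f n (u_ n))
  (ndu : forall n, (0 < n)%N -> \forall x \ae mu, u_ n x <= u_ n.+1 x)
  (cvu : \forall x \ae mu, u_ n x @[n --> \oo] --> u x).

Let mO : measurable Omega := open_measurable_rV oO.

Let S := superlevel Omega u.
Let mS b : measurable (S b) := measurable_superlevel_on b mO mu_.
Let Soo b : (mu (S b) < +oo)%E := superlevel_lty b mO mu_ (leb_bounded bO mO).

(** A nondecreasing convergent sequence stays below its limit. The index is shifted because the
    approximate solutions are given from index 1 on. *)
Let le_u : \forall x \ae mu, forall n, u_ n.+1 x <= u x.
Proof.
have : \forall x \ae mu, forall n, u_ n.+1 x <= u_ n.+2 x.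
  by apply/ae_foralln => n; exact: ndu.
move=> nd; apply: filterS2 nd cvu => x nd cv n.
have ndx : nondecreasing_seq (fun n => u_ n.+1 x).
  by apply/nondecreasing_seqP => k; exact: nd.
have cv1 : u_ k.+1 x @[k --> \oo] --> u x by rewrite (cvg_shiftS (fun k => u_ k x)).
rewrite -(cvg_lim _ cv1)//; apply: nondecreasing_cvgn_le => //.
by apply/cvg_ex; exists (u x).
Qed.

Lemma level_estimate (a r : R) : 0 <= a -> 0 < r ->
  ((r `^ p)%:E * mu (superlevel Omega u (a + 2 * r)) <=
   (@level_cst R N p * fine (mu (superlevel Omega u a)) `^ (p / @hdim R N))%:E *
   \int[mu]_(x in superlevel Omega u a) `|f x|%:E)%E.
Proof.
move=> a0 r0; rewrite -/S; set K := leRHS.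
have rp : 0 < r `^ p by exact: powR_gt0.
have meas n : measurable_fun setT (u_ n.+1).
  by have [[[vL _] _] _ _ _] := sol (ltn0Sn n); exact: vL.1.
have mge n : measurable [set x | a + 2 * r <= u_ n.+1 x] := (measurable_superlevel _ (meas n)).2.
have mgt n : measurable [set x | a < u_ n.+1 x] := (measurable_superlevel _ (meas n)).1.
have est n : (mu [set x | (a + 2 * r <= u_ n.+1 x)%R] <= ((r `^ p)^-1)%:E * K)%E.
  rewrite lee_pdivlMl//.
  apply: le_trans (energy_level N0 oO bO p1 alpha0 mf (ltn0Sn n) (sol (ltn0Sn n)) a0 r0) _.
  have sub : \forall x \ae mu, a < u_ n.+1 x -> S a x.
    have [[_ out] _ _ _] := sol (ltn0Sn n).
    apply: filterS2 out le_u => x out le_ux aux; split.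
      apply: contrapT => /out u0; by move: aux; rewrite u0 ltNge a0.
    exact: lt_le_trans aux (le_ux n).
  have lemu : (mu [set x | (a < u_ n.+1 x)%R] <= mu (S a))%E.
    exact: (le_measure_ae (mgt n) (mS a) sub).
  apply: lee_pmul.
  - by rewrite lee_fin mulr_ge0 ?powR_ge0 ?level_cst_ge0.
  - exact: integral_ge0.
  - rewrite lee_fin ler_wpM2l ?level_cst_ge0// ge0_ler_powR ?nnegrE ?fine_ge0//.
      by rewrite divr_ge0 ?ler0n// ltW// (lt_trans ltr01).
    rewrite fine_le//; rewrite ge0_fin_numE ?Soo//.
    exact: le_lt_trans lemu (Soo a).
  - have -> : S a = Omega `&` S a by rewrite /S /superlevel setIA setIid.
    apply: (le_integral_ae_subset mO (mgt n) (mS a)) => //.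
      by apply/measurable_EFinP; exact: measurableT_comp.
    by apply: filterS sub => x sub _; exact: sub.
rewrite -lee_pdivlMl//.
(* Where [u > a + 2 r], all late [u_n] exceed this level too, so the strict superlevel set of [u] is
   covered by the increasing union of the sets [B n]; each of them lies in a superlevel set of a
   single [u_n]. The right-hand side has already been enlarged from [u_n] to [u] by monotonicity. *)
pose B n := \bigcap_(k in [set k | (n <= k)%N]) [set x | a + 2 * r <= u_ k.+1 x].
have mB n : measurable (B n) by apply: bigcap_measurable => [|k _]; [exists n => /=|exact: mge].
apply: (@le_trans _ _ (mu (\bigcup_n B n))).
  apply: le_measure_ae; first exact: mS.
    exact: bigcup_measurable.
  apply: filterS cvu => x cv [_ /= ux].
  have cv1 : u_ k.+1 x @[k --> \oo] --> u x by rewrite (cvg_shiftS (fun k => u_ k x)).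
  have [n _ nP] : \forall k \near \oo, a + 2 * r < u_ k.+1 x by exact: cvgr_gt cv1 _ ux.
  by exists n => // k /= nk; rewrite ltW// nP.
apply: measure_bigcup_le => // [|n].
  apply/nondecreasing_seqP => n; apply/subsetPset => x Bx k /= nk.
  by apply: Bx; exact: ltnW.
apply: le_trans (est n); rewrite le_measure ?inE//.
by move=> x /(_ n (leqnn n)).
Qed.

End level_estimate.

(** * Iteration over levels *)

Section recursive_bounds.
Context {R : realType}.

Lemma powR2_gt1 (q : R) : 0 < q -> 1 < 2 `^ q.
Proof.
move=> q0; apply: (@le_lt_trans _ _ (1 `^ q)); first by rewrite powR1.
by rewrite gt0_ltr_powR ?nnegrE ?ltr1n.
Qed.

(* Stampacchia's lemma; along the levels T (1 - 2^-k) the values decay like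
   2^(-k p / (kappa - 1)). *)
Lemma stampacchia (A : R -> R) (p kappa C : R) : 0 < p -> 1 < kappa -> 0 <= C ->
  (forall a, 0 <= A a) -> (forall a b, a <= b -> A b <= A a) ->
  (forall a r, 0 <= a -> 0 < r -> r `^ p * A (a + 2 * r) <= C * A a `^ kappa) ->
  exists T, A T = 0.
Proof.
move=> p0 k1 C0 A0 nA est; have [A00|An0] := eqVneq (A 0) 0; first by exists 0.
have A0pos : 0 < A 0 by rewrite lt_neqAle eq_sym An0 A0.
have km0 : 0 < kappa - 1 by rewrite subr_gt0.
pose q := p / (kappa - 1); have q0 : 0 < q by exact: divr_gt0.
have qk : q * kappa = p + q by rewrite /q; field; rewrite gt_eqF.
(* With [q * kappa = p + q], one step of the iteration reproduces the decay [2^-q] as soon as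
   [C * A 0^kappa * 2^q <= Z * A 0]. The summand 1 keeps [Z] positive, and [T] is chosen so that
   [(T / 4)^p = Z], where [T / 4] times [2^-k] is the half-width of step [k]. *)
pose Z := C * A 0 `^ kappa * 2 `^ q / A 0 + 1.
have Z0 : 0 < Z by rewrite ltr_wpDl// divr_ge0// !mulr_ge0 ?powR_ge0.
pose T := 4 * Z `^ p^-1; have T40 : 0 < T / 4 by rewrite /T mulrC mulKf// powR_gt0.
have T4p : (T / 4) `^ p = Z.
  by rewrite /T mulrC mulKf// -powRrM mulVf ?gt_eqF// powRr1// ltW.
pose e k : R := 2^-1 ^+ k.
have e0 k : 0 < e k by rewrite exprn_gt0// invr_gt0.
have eS k : e k.+1 = e k / 2 by rewrite /e exprSr.
pose a k := T * (1 - e k).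
have a0 k : 0 <= a k.
  rewrite mulr_ge0 ?subr_ge0//; first by rewrite -(divfK (_ : 4 != 0) T)// mulr_ge0// ltW.
  by rewrite exprn_ile1// invf_le1// ler1n.
have aS k : a k.+1 = a k + 2 * (T / 4 * e k).
  by rewrite /a eS; field.
have decay k : A (a k) <= A 0 * e k `^ q.
  elim: k => [|k IH]; first by rewrite /a /e expr0 subrr mulr0 powR1 mulr1.
  have rk0 : 0 < T / 4 * e k by exact: mulr_gt0.
  have := est (a k) (T / 4 * e k) (a0 k) rk0; rewrite -aS.
  have ekp : 0 < e k `^ p by exact: powR_gt0.
  rewrite (powRM _ (ltW T40) (ltW (e0 k))) T4p => E.
  have {}E : Z * A (a k.+1) <= C * A 0 `^ kappa * e k `^ q.
    rewrite -(ler_pM2l ekp) mulrA [_ * Z]mulrC (le_trans E)//.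
    apply: (@le_trans _ _ (C * (A 0 * e k `^ q) `^ kappa)).
      rewrite ler_wpM2l// ge0_ler_powR ?nnegrE ?mulr_ge0 ?powR_ge0//.
      by rewrite (le_trans ler01)// ltW.
    rewrite (powRM _ (A0 _) (powR_ge0 _ _)) -powRrM qk powRD; last first.
      by rewrite (gt_eqF (e0 k)) implybT.
    by apply: le_of_eq; ring.
  rewrite -(ler_pM2l Z0) (le_trans E)// eS powRM ?(ltW (e0 k)) ?invr_ge0//.
  rewrite -[2^-1]powR_inv1// -powRrM mulN1r powRN.
  have q2 : 0 < 2 `^ q by exact: powR_gt0.
  rewrite [leRHS](_ : _ = Z * A 0 / 2 `^ q * e k `^ q); last by ring.
  rewrite ler_wpM2r ?powR_ge0// ler_pdivlMr// /Z mulrDl mul1r divfK ?gt_eqF//.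
  by rewrite lerDl ltW.
exists T; apply/eqP; rewrite eq_le A0 andbT.
have aT k : A T <= A 0 * (2^-1 `^ q) ^+ k.
  rewrite -powR_mulrn ?powR_ge0// -powRrM [q * _]mulrC powRrM powR_mulrn ?invr_ge0//.
  apply: le_trans (decay k); apply: nA; rewrite /a mulrBr mulr1 gerBl.
  by rewrite mulr_ge0 ?(ltW (e0 k))// -(divfK (_ : 4 != 0) T)// mulr_ge0// ltW.
have r1 : `|2^-1 `^ q : R| < 1.
  rewrite ger0_norm ?powR_ge0// -[2^-1]powR_inv1// -powRrM mulN1r powRN invf_lt1 ?powR_gt0//.
  exact: powR2_gt1.
have cv : (A 0 * (2^-1 `^ q) ^+ k) @[k --> \oo] --> (A 0 * 0 : R).
  by apply: cvgM; [exact: cvg_cst|exact: cvg_expr].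
rewrite mulr0 in cv.
by apply: (cvgr_to_ge cv); exact: nearW.
Qed.

Lemma sublinear_recursion (S : nat -> R) (D C kappa : R) : 0 <= D -> 0 <= C ->
  0 <= kappa -> kappa < 1 -> (forall k, 0 <= S k) -> S 0%N <= D ->
  (forall k, S k.+1 <= D + C * S k `^ kappa) -> exists B, forall k, S k <= B.
Proof.
move=> D0 C0 k0 k1 S0 S00 rec.
have k1' : 0 < 1 - kappa by rewrite subr_gt0.
(* The first summand gives [2 * C * B^kappa <= B], since [B^(1 - kappa)] is at least [2 * C + 1];
   the second gives [2 * D <= B]. Hence [D + C * B^kappa <= B], and the bound is inherited. *)
pose B := (2 * C + 1) `^ (1 - kappa)^-1 + 2 * D.
have C1 : 0 < 2 * C + 1 by rewrite ltr_wpDl// mulr_ge0.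
have P0 : 0 < (2 * C + 1) `^ (1 - kappa)^-1 by exact: powR_gt0.
have B0 : 0 < B by rewrite ltr_wpDr// mulr_ge0.
have BC : 2 * C * B `^ kappa <= B.
  have -> : B = B `^ (1 - kappa) * B `^ kappa.
    by rewrite -powRD ?subrK ?powRr1 ?ltW// gt_eqF.
  have -> : (B `^ (1 - kappa) * B `^ kappa) `^ kappa = B `^ kappa.
    by rewrite -powRD ?subrK ?powRr1 ?ltW// (gt_eqF B0) implybT.
  rewrite ler_wpM2r ?powR_ge0//.
  apply: (@le_trans _ _ (((2 * C + 1) `^ (1 - kappa)^-1) `^ (1 - kappa))).
    by rewrite -powRrM mulVf ?gt_eqF// powRr1 ?(ltW C1)// lerDl.
  by rewrite ge0_ler_powR ?nnegrE ?(ltW P0) ?(ltW B0) ?(ltW k1')// /B lerDl mulr_ge0.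
exists B; elim=> [|k IH].
  by rewrite (le_trans S00)// /B ler_wpDl ?powR_ge0// mulr_natl mulr2n lerDl.
have SB : S k `^ kappa <= B `^ kappa by rewrite ge0_ler_powR ?nnegrE ?S0 ?(ltW B0).
have DB : 2 * D <= B by rewrite /B lerDr powR_ge0.
have := ler_wpM2l C0 SB; have := rec k; lra.
Qed.

(** The indices with [c k] true form an initial segment, on which a geometric sum is at most
    [b / (b - 1)] times its last term; the power of that last term occurs in the sum of powers. *)
Lemma geometric_power_bound (K : nat) (b q : R) (c : nat -> bool) :
  1 < b -> 0 < q -> (forall i j, (i <= j)%N -> c j -> c i) ->
  (\sum_(k < K) (c k)%:R * b ^+ k) `^ q <=
  (b / (b - 1)) `^ q * \sum_(k < K) (c k)%:R * (b ^+ k) `^ q.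
Proof.
move=> b1 q0 cc; have b10 : 0 < b - 1 by rewrite subr_gt0.
have b0 : 0 < b by exact: lt_trans b1.
have bb : 0 <= b / (b - 1) by rewrite divr_ge0// ltW.
elim: K => [|K IH]; first by rewrite !big_ord0 mulr0 powR0// gt_eqF.
rewrite [in leRHS]big_ord_recr/= mulrDr.
case cK : (c K); last by rewrite big_ord_recr/= cK !mul0r !addr0 mulr0 addr0.
rewrite mul1r; set s := (X in X `^ q); have -> : s = \sum_(k < K.+1) b ^+ k.
  by apply: eq_bigr => k _; rewrite (cc k K) ?mul1r// -ltnS.
have sum0 k : 0 <= \sum_(i < k) (c i)%:R * (b ^+ i) `^ q.
  by apply: sumr_ge0 => i _; rewrite mulr_ge0 ?powR_ge0.
apply: (@le_trans _ _ ((b / (b - 1)) `^ q * (b ^+ K) `^ q)); last first.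
  by rewrite lerDr mulr_ge0 ?powR_ge0 ?sum0.
have bK : 0 <= b ^+ K by rewrite exprn_ge0// ltW.
rewrite -powRM// ge0_ler_powR ?nnegrE ?(ltW q0)//.
- by apply: sumr_ge0 => i _; rewrite exprn_ge0// ltW.
- exact: mulr_ge0.
rewrite mulrAC ler_pdivlMr// -exprS mulrC -subrX1 -subr_ge0 opprB addrC subrK.
by [].
Qed.

End recursive_bounds.

(** * Integrability from level estimates *)

Section integral_steps.
Context {d} {T : measurableType d} {R : realType} (m : {measure set T -> \bar R}).
Variables (I : Type) (a : I -> R) (E : I -> set T).
Hypotheses (a0 : forall i, 0 <= a i) (mE : forall i, measurable (E i)).

Lemma weighted_integral_step (h : T -> R) (s : seq I) : measurable_fun setT h ->
  (\int[m]_x (`|h x| * \sum_(i <- s) a i * \1_(E i) x)%:E =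
   \sum_(i <- s) (a i)%:E * \int[m]_(x in E i) `|h x|%:E)%E.
Proof.
move=> mh; transitivity (\int[m]_x (\sum_(i <- s) (a i * (`|h x| * \1_(E i) x))%:E))%E.
  apply: eq_integral => x _; rewrite sumEFin mulr_sumr; congr EFin.
  by apply: eq_bigr => i _; rewrite mulrCA.
have mhE i : measurable_fun setT (fun x => `|h x| * \1_(E i) x).
  by apply: measurable_funM; [exact: measurableT_comp|exact: measurable_indic].
rewrite ge0_integral_sum//; last first.
  by move=> i x _; rewrite lee_fin !mulr_ge0.
  by move=> i; apply/measurable_EFinP; exact: measurable_funM.
apply: eq_bigr => i _; under eq_integral do rewrite EFinM.
rewrite ge0_integralZl ?lee_fin//; last first.
  exact/measurable_EFinP.
congr (_ * _)%E; rewrite [RHS]integral_mkcond; apply: eq_integral => x _.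
by rewrite /patch indicE; case: ifPn => _; rewrite ?mulr1 ?mulr0.
Qed.

Lemma integral_step (s : seq I) :
  (\int[m]_x (\sum_(i <- s) a i * \1_(E i) x)%:E = \sum_(i <- s) (a i)%:E * m (E i))%E.
Proof.
have := weighted_integral_step s (measurable_cst (1 : R)).
under eq_integral do rewrite /= normr1 mul1r.
move=> ->; apply: eq_bigr => i _; congr (_ * _)%E.
by under eq_integral do rewrite normr1; rewrite integral_cst// mul1e.
Qed.

End integral_steps.

Section hoelder_bound.
Context {d} {T : measurableType d} {R : realType} (m : {measure set T -> \bar R}).

Lemma hoelder_pint (q : R) (f h : T -> R) (I : R) : 1 < q -> Lp m q f ->
  measurable_fun setT h -> 0 <= I -> (pint m (1 - q^-1)^-1 h <= I%:E)%E ->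
  (\int[m]_x `|f x * h x|%:E <= (fine (pint m q f) `^ q^-1 * I `^ (1 - q^-1))%:E)%E.
Proof.
move=> q1 [mf fq] mh I0 hI; have q0 : 0 < q by exact: lt_trans q1.
have iq1 : 0 < 1 - q^-1 by rewrite subr_gt0 invf_lt1.
have q'0 : 0 < (1 - q^-1)^-1 by rewrite invr_gt0.
have pq : q^-1 + ((1 - q^-1)^-1)^-1 = 1 by rewrite invrK addrC subrK.
have N_pint (r : R) (w : T -> R) : ('N[m]_r%:E[EFin \o w] = (pint m r w) `^ r^-1)%E.
  by rewrite unlock.
have := hoelder m mf mh q0 q'0 pq; rewrite Lnorm1 !N_pint invrK => H.
apply: (le_trans H); rewrite EFinM -!poweR_EFin fineK; last by rewrite ge0_fin_numE ?pint_ge0.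
apply: lee_wpmul2l; first exact: poweR_ge0.
by apply: gt0_ler_poweR; rewrite ?in_itv/= ?leey ?pint_ge0 ?lee_fin ?I0 ?(ltW iq1).
Qed.

End hoelder_bound.

Section level_integrability.
Context {d} {T : measurableType d} {R : realType} (m : {measure set T -> \bar R}).
Variables (D : set T) (f u : T -> R) (p q theta C : R).
Hypotheses (mD : measurable D) (Doo : (m D < +oo)%E) (mu_ : measurable_fun D u)
  (q1 : 1 < q) (fL : Lp m q f) (p0 : 0 < p) (theta0 : 0 < theta) (C0 : 0 <= C).

Local Notation S := (superlevel D u).

Hypothesis est : forall a r : R, 0 <= a -> 0 < r ->
  ((r `^ p)%:E * m (S (a + 2 * r)) <=
   (C * fine (m (S a)) `^ theta)%:E * \int[m]_(x in S a) `|f x|%:E)%E.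

Let A b := fine (m (S b)).
Let F b := fine (\int[m]_(x in S b) `|f x|%:E)%E.
Let nu := 1 - q^-1.
Let M := fine (pint m q f) `^ q^-1.

Let mS b : measurable (S b) := measurable_superlevel_on b mD mu_.
Let Soo b : (m (S b) < +oo)%E := superlevel_lty b mD mu_ Doo.
Let mf : measurable_fun setT f := fL.1.
Let q0 : 0 < q. Proof. exact: lt_trans q1. Qed.
Let nu0 : 0 < nu. Proof. by rewrite subr_gt0 invf_lt1. Qed.
Let M0 : 0 <= M. Proof. exact: powR_ge0. Qed.
Let A0 b : 0 <= A b. Proof. exact: fine_ge0. Qed.
Let F0 b : 0 <= F b. Proof. by apply: fine_ge0; exact: integral_ge0. Qed.

Let AE b : m (S b) = (A b)%:E.
Proof. by rewrite fineK// ge0_fin_numE. Qed.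

Let nA b c : b <= c -> A c <= A b.
Proof.
move=> bc; rewrite fine_le ?ge0_fin_numE// le_measure ?inE// => x [Dx /= cu].
by split => //=; exact: le_lt_trans cu.
Qed.

Let F_le b : (\int[m]_(x in S b) `|f x|%:E <= (M * A b `^ nu)%:E)%E.
Proof.
have mi : measurable_fun setT (\1_(S b) : T -> R) by exact: measurable_indic.
have pi : (pint m (1 - q^-1)^-1 (\1_(S b) : T -> R) <= (A b)%:E)%E.
  rewrite -AE -[m _]mul1e -integral_indicZ//; apply: ge0_le_integral => //.
  - exact: emeasurable_powR_norm.
  - by apply/measurable_EFinP; exact: measurable_funM.
  move=> x _; rewrite lee_fin mul1r indicE; case: (x \in _) => /=.
    by rewrite normr1 powR1.
  by rewrite normr0 powR0// invr_eq0 gt_eqF.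
apply: le_trans (hoelder_pint q1 fL mi (A0 b) pi).
rewrite integral_mkcond; apply: le_of_eq.
apply: eq_integral => x _; rewrite /patch indicE.
by case: (x \in _); rewrite /= ?mulr1 ?mulr0 ?normr0.
Qed.

Let FE b : (\int[m]_(x in S b) `|f x|%:E = (F b)%:E)%E.
Proof.
rewrite fineK// ge0_fin_numE; first exact: le_lt_trans (F_le b) (ltry _).
exact: integral_ge0.
Qed.

Let level (a r : R) : 0 <= a -> 0 < r -> r `^ p * A (a + 2 * r) <= C * A a `^ theta * F a.
Proof. by move=> a0 r0; have := est a0 r0; rewrite !AE FE -!EFinM lee_fin. Qed.

(** Hölder bounds the integral of [f] over the level set by [M * A a^nu], so the level estimate
    acquires the exponent [theta + nu > 1] of Stampacchia's iteration. *)
Lemma superlevel_null : 1 < theta + nu -> exists b, m (S b) = 0%E.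
Proof.
move=> k1.
suff lev (a r : R) : 0 <= a -> 0 < r ->
    r `^ p * A (a + 2 * r) <= C * M * A a `^ (theta + nu).
  have [b Ab] := stampacchia p0 k1 (mulr_ge0 C0 M0) A0 nA lev.
  by exists b; rewrite AE Ab.
move=> a0 r0; apply: le_trans (level a0 r0) _.
have Fa : F a <= M * A a `^ nu by rewrite -lee_fin -FE.
have CA : 0 <= C * A a `^ theta by rewrite mulr_ge0// powR_ge0.
apply: le_trans (ler_wpM2l CA Fa) _.
have [A00|An0] := eqVneq (A a) 0.
  by rewrite A00 [0 `^ theta]powR0 ?gt_eqF// mulr0 mul0r mulr_ge0 ?powR_ge0 ?mulr_ge0.
rewrite powRD ?An0 ?implybT//; apply: le_of_eq; ring.
Qed.

Section integrability.
Hypothesis (subcritical : theta < q^-1).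

Let t := p / (q^-1 - theta).
Let beta := t * nu.
Let gap : 0 < q^-1 - theta. Proof. by rewrite subr_gt0. Qed.
Let t0 : 0 < t. Proof. exact: divr_gt0. Qed.
Let beta0 : 0 < beta. Proof. exact: mulr_gt0. Qed.
(** This relation determines [t]. In the recursion the level [2^k] carries the weight [2^(k t)],
    gains [2^(-k p)] from the level estimate and [2^(-k t theta)] from the bound of the measure by
    the full sum; what is left is [2^(k beta)]. Since [beta = t * nu], raising it to the power
    [1 / nu] restores [2^(k t)]. *)
Let betaE : beta = t - p - t * theta.
Proof.
have pE : p = t * (q^-1 - theta) by rewrite /t divfK// gt_eqF.
by rewrite [in RHS]pE /beta /nu; ring.
Qed.

Let z k : R := 2 ^+ k.
Let b := 2 `^ beta.
Let z0 k : 0 < z k. Proof. by rewrite exprn_gt0. Qed.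
Let zb k : z k `^ beta = b ^+ k.
Proof.
rewrite /z; elim: k => [|k IH]; first by rewrite !expr0 powR1.
by rewrite !exprS powRM// ?IH// exprn_ge0.
Qed.
Let zt k : (b ^+ k) `^ nu^-1 = z k `^ t.
Proof. by rewrite -zb -powRrM /beta mulfK// gt_eqF. Qed.
Let b1 : 1 < b. Proof. exact: powR2_gt1. Qed.

Let Sum K := \sum_(k < K) z k `^ t * A (z k).
Let c0 := (b / (b - 1)) `^ nu^-1.

Let Sum0 K : 0 <= Sum K.
Proof. by apply: sumr_ge0 => k _; rewrite mulr_ge0 ?powR_ge0. Qed.

(** The sum is the integral of [|f|] against a single step function [h], to which Hölder is applied
    once. The superlevel sets being nested, [h^(1/nu)] is at most [c0] times the step function with
    weights [2^(k t)], whose integral is [Sum K]. *)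
Let sum_F K : \sum_(k < K) b ^+ k * F (z k) <= M * (c0 * Sum K) `^ nu.
Proof.
pose h x := \sum_(k < K) b ^+ k * \1_(S (z k)) x.
have b0 k : 0 <= b ^+ k by rewrite exprn_ge0// powR_ge0.
have mh : measurable_fun setT h.
  by apply: measurable_sum => k; apply: measurable_funM => //; exact: measurable_indic.
have h0 x : 0 <= h x by apply: sumr_ge0 => k _; rewrite mulr_ge0.
have c00 : 0 <= c0 by exact: powR_ge0.
have ph : (pint m (1 - q^-1)^-1 h <= (c0 * Sum K)%:E)%E.
  pose g x := \sum_(k < K) z k `^ t * \1_(S (z k)) x.
  have mg : measurable_fun setT g.
    by apply: measurable_sum => k; apply: measurable_funM => //; exact: measurable_indic.
  have g0 x : 0 <= g x by apply: sumr_ge0 => k _; rewrite mulr_ge0 ?powR_ge0.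
  have -> : (c0 * Sum K)%:E = (\int[m]_x (c0 * g x)%:E)%E.
    under eq_integral do rewrite EFinM.
    rewrite ge0_integralZl; [|exact: measurableT|exact/measurable_EFinP
      |by move=> x _; rewrite lee_fin|by rewrite lee_fin].
    rewrite (integral_step m (fun k : 'I_K => powR_ge0 (z k) t) (fun k => mS (z k))) EFinM.
    by congr (_ * _)%E; rewrite -sumEFin; apply: eq_bigr => k _; rewrite AE.
  apply: ge0_le_integral => //.
  - exact: emeasurable_powR_norm.
  - by apply/measurable_EFinP; exact: measurable_funM.
  move=> x _; rewrite lee_fin ger0_norm// -/nu.
  have dec i j : (i <= j)%N -> x \in S (z j) -> x \in S (z i).
    move=> ij; rewrite !inE => -[Dx /= zu]; split => //=; apply: le_lt_trans zu.
    by rewrite /z ler_eXn2l ?ltr1n.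
  have inu0 : 0 < nu^-1 by rewrite invr_gt0.
  have hE : h x = \sum_(k < K) (x \in S (z k))%:R * b ^+ k.
    by apply: eq_bigr => k _; rewrite mulrC indicE.
  have gE : g x = \sum_(k < K) (x \in S (z k))%:R * (b ^+ k) `^ nu^-1.
    by apply: eq_bigr => k _; rewrite zt mulrC indicE.
  rewrite hE gE; exact: (@geometric_power_bound R K b _ (fun k => x \in S (z k)) b1 inu0 dec).
rewrite -lee_fin.
have := hoelder_pint q1 fL mh (mulr_ge0 c00 (Sum0 K)) ph; rewrite -/M -/nu.
apply: le_trans; apply: le_of_eq.
under [RHS]eq_integral do rewrite normrM (ger0_norm (h0 _)).
rewrite (weighted_integral_step m (fun k : 'I_K => b0 k) (fun k : 'I_K => mS (z k)) _ mf).
by rewrite -sumEFin; apply: eq_bigr => k _; rewrite FE.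
Qed.

(** Partial sums are finite from the outset, so they may appear on both sides of the recursion
    [Sum (K + 1) <= A 1 + C1 * (Sum K)^kappa]. Subcriticality says [kappa < 1], which bounds them
    independently of [K]. *)
Lemma dyadic_sums_bounded : exists B, forall K, Sum K <= B.
Proof.
pose kappa := theta + nu.
pose C1 := 2 `^ t * 2 `^ p * C * M * c0 `^ nu.
have C10 : 0 <= C1 by rewrite !mulr_ge0 ?powR_ge0.
apply: (@sublinear_recursion R Sum (A 1) C1 kappa) => //.
- by rewrite addr_ge0// ltW.
- by move: subcritical; rewrite /kappa /nu; lra.
- by rewrite /Sum big_ord0.
move=> K; rewrite /Sum big_ord_recl /= /z expr0 powR1 mul1r lerD2l -/(Sum K).
have step (k : 'I_K) : z k.+1 `^ t * A (z k.+1) <=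
    2 `^ t * 2 `^ p * C * Sum K `^ theta * (b ^+ k * F (z k)).
  (* With [a = 2^k] and [r = 2^k / 2], the level [a + 2 r] is the next dyadic level. *)
  have r0 : 0 < z k / 2 by rewrite divr_gt0.
  have := level (ltW (z0 k)) r0.
  have -> : z k + 2 * (z k / 2) = z k.+1 by rewrite /z exprS; field.
  have r_E : (z k / 2) `^ p = z k `^ p / 2 `^ p.
    by rewrite powRM ?invr_ge0 ?(ltW (z0 k))// -[2^-1]powR_inv1// -powRrM mulN1r powRN.
  rewrite r_E => lev; have zp0 : 0 < z k `^ p by exact: powR_gt0.
  have p20 : 0 < 2 `^ p :> R by exact: powR_gt0.
  have zt0 : 0 < z k `^ t by exact: powR_gt0.
  (* Bounding the measure of one level set by the whole sum makes the factor [A^theta] uniform in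
     [k] apart from a power of [2^k], so it can be taken out of the summation. *)
  have Ale : A (z k) <= z k `^ (- t) * Sum K.
    rewrite powRN mulrC ler_pdivlMr// mulrC /Sum (bigD1 k)//= lerDl.
    by apply: sumr_ge0 => i _; rewrite mulr_ge0 ?powR_ge0.
  have Ath : A (z k) `^ theta <= z k `^ (- t * theta) * Sum K `^ theta.
    rewrite powRrM -powRM ?powR_ge0//.
    by rewrite ge0_ler_powR ?nnegrE ?(ltW theta0)// mulr_ge0 ?powR_ge0.
  have lev2 : A (z k.+1) <= 2 `^ p * z k `^ (- p) *
      (C * (z k `^ (- t * theta) * Sum K `^ theta) * F (z k)).
    have lev' : z k `^ p / 2 `^ p * A (z k.+1) <=
        C * (z k `^ (- t * theta) * Sum K `^ theta) * F (z k).
      by apply: le_trans lev _; rewrite ler_wpM2r// ler_wpM2l.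
    have zp2 : 0 < z k `^ p / 2 `^ p by exact: divr_gt0.
    rewrite -(ler_pM2l zp2) (le_trans lev')// powRN; apply: le_of_eq.
    by field; rewrite !gt_eqF.
  have ztS : z k.+1 `^ t = 2 `^ t * z k `^ t by rewrite /z exprS powRM// ltW// z0.
  apply: le_trans (ler_wpM2l (powR_ge0 _ _) lev2) _; rewrite ztS -zb betaE.
  rewrite (_ : t - p - t * theta = t + (- p + - t * theta)); last by ring.
  rewrite powRD ?(gt_eqF (z0 k)) ?implybT// [z k `^ (- p + _)]powRD ?(gt_eqF (z0 k)) ?implybT//.
  by apply: le_of_eq; ring.
apply: (@le_trans _ _ (\sum_(k < K) 2 `^ t * 2 `^ p * C * Sum K `^ theta * (b ^+ k * F (z k)))).
  by apply: ler_sum => k _; exact: step.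
rewrite -mulr_sumr.
have P0 : 0 <= 2 `^ t * 2 `^ p * C * Sum K `^ theta by rewrite !mulr_ge0 ?powR_ge0.
apply: le_trans (ler_wpM2l P0 (sum_F K)) _.
rewrite (powRM _ (powR_ge0 _ _) (Sum0 K)).
have [S00|Sn0] := eqVneq (Sum K) 0.
  by rewrite S00 [0 `^ theta]powR0 ?gt_eqF// mulr0 mul0r mulr_ge0 ?powR_ge0.
rewrite /kappa powRD ?Sn0 ?implybT//; apply: le_of_eq.
rewrite /C1; ring.
Qed.

Lemma pint_lty : (\forall x \ae m, D x -> 0 <= u x) -> (pint m t (u \_ D) < +oo)%E.
Proof.
move=> u0; have [B SB] := dyadic_sums_bounded.
have muD : measurable_fun setT (u \_ D) by apply/(measurable_restrictT _ mD).
pose g k x := (z k.+1 `^ t * \1_(S (z k)) x)%:E.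
have mg k : measurable_fun setT (g k).
  by apply/measurable_EFinP; apply: measurable_funM => //; exact: measurable_indic.
have g0 k x : (0 <= g k x)%E by rewrite lee_fin mulr_ge0 ?powR_ge0.
have gE k : (\int[m]_x g k x = (z k.+1 `^ t * A (z k))%:E)%E.
  by rewrite integral_indicZ ?powR_ge0// AE -EFinM.
(* Pointwise layer-cake majorant: where [u <= 1] the indicator of [D] suffices, and where
   [2^k < u <= 2^(k+1)] the term of index [k] does. The series integrates to at most [2^t] times a
   bound of the dyadic sums. *)
apply: (@le_lt_trans _ _ (\int[m]_x ((\1_D x)%:E + \sum_(k <oo) g k x))%E).
  apply: ae_ge0_le_integral => //.
  - exact: emeasurable_powR_norm.
  - by move=> x _; apply: adde_ge0; [rewrite lee_fin|exact: nneseries_ge0].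
  - apply: emeasurable_funD; first by apply/measurable_EFinP; exact: measurable_indic.
    exact: ge0_emeasurable_sum.
  apply: filterS u0 => x u0 _; rewrite /patch indicE; case: ifPn => [xD|_]; last first.
    rewrite normr0 powR0 ?gt_eqF// add0e; exact: nneseries_ge0.
  have Dx : D x by rewrite -in_setE.
  have ux0 := u0 Dx; rewrite (ger0_norm ux0).
  have [ux1|u1] := leP (u x) 1.
    apply: (@le_trans _ _ 1%E); last by rewrite leeDl// nneseries_ge0.
    have u1t : u x `^ t <= 1 `^ t by rewrite ge0_ler_powR ?nnegrE ?(ltW t0).
    by rewrite lee_fin (le_trans u1t)// powR1.
  have [k uk ku] : exists2 k, z k < u x & u x <= z k.+1.
    have [n un] : exists n, u x <= z n.
      have [n nu'] : exists n : nat, u x < n%:R.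
        by exists (Num.truncn (u x)).+1; rewrite truncnS_gt.
      by exists n; rewrite (le_trans (ltW nu'))// /z -natrX ler_nat ltnW// ltn_expl.
    elim: n un => [|n IH] un; first by move: u1; rewrite ltNge (le_trans un)// /z expr0.
    have [/IH//|zu] := leP (u x) (z n).
    by exists n.
  apply: (@le_trans _ _ (g k x)).
    rewrite /g indicE mem_set//= mulr1 lee_fin ge0_ler_powR ?nnegrE ?(ltW t0) ?(ltW (z0 _))//.
  apply: (@le_trans _ _ (\sum_(k <oo) g k x)%E); last by rewrite leeDr// lee_fin.
  have := @nneseries_lim_ge R (fun k => g k x) xpredT 0%N k.+1 (fun k _ _ => g0 k x).
  apply: le_trans; rewrite big_nat_recr//= leeDr// sume_ge0// => i _; exact: g0.
rewrite ge0_integralD//; last first.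
  exact: ge0_emeasurable_sum.
  by move=> x _; exact: nneseries_ge0.
  by apply/measurable_EFinP; exact: measurable_indic.
rewrite integral_indic// setIT lte_add_pinfty//.
rewrite integral_nneseries//; apply: (@le_lt_trans _ _ (2 `^ t * B)%:E); last exact: ltry.
apply: lime_le; first by apply: is_cvg_nneseries => k _ _; exact: integral_ge0.
apply: nearW => K; under eq_bigr do rewrite gE.
rewrite sumEFin big_mkord lee_fin (le_trans _ (ler_wpM2l (powR_ge0 _ _) (SB K)))//.
rewrite /Sum mulr_sumr; apply: le_of_eq; apply: eq_bigr => k _.
by rewrite /z exprS powRM ?mulrA// ltW// z0.
Qed.

End integrability.

End level_integrability.

(** * Exponents and conclusion *)

Lemma sobolev_gamma_exp {R : realType} (Q p m : R) : 0 < p -> p < Q -> 1 < m ->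
  m < Q / p -> sobolev_exp Q p * gamma_exp Q p m = p / (m^-1 - p / Q).
Proof.
move=> p0 pQ m1 mQ; have Q0 : 0 < Q by exact: lt_trans pQ.
have m0 : 0 < m by exact: lt_trans m1.
have m10 : m - 1 != 0 by rewrite subr_eq0 gt_eqF.
have Qp : Q - p != 0 by rewrite subr_eq0 gt_eqF.
have Qpm : Q - p * m != 0.
  by rewrite subr_eq0 gt_eqF// mulrC -ltr_pdivlMr.
rewrite /gamma_exp /sobolev_exp /conj_exp.
have -> : p * (m / (m - 1)) - Q * p / (Q - p) = p * (Q - p * m) / ((m - 1) * (Q - p)).
  by field; rewrite ?m10 ?Qp.
have -> : m^-1 - p / Q = (Q - p * m) / (m * Q).
  by field; rewrite !gt_eqF.
field.
by rewrite ?Qp ?m10 ?Qpm !gt_eqF.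
Qed.

Lemma inLp_pinfty {R : realType} {n : nat} (D : set 'rV[R]_n) (u : 'rV[R]_n -> R) (b : R) :
  measurable_fun D u -> (\forall x \ae leb n, D x -> `|u x| <= b) -> inLp D +oo%E u.
Proof.
move=> mu_ ub; split => //; rewrite /finite_norm unlock.
case: ifPn => _; last exact: ltry.
apply: le_lt_trans (ltry (Num.max b 0)); apply/ess_sup_inf.ess_supP; apply: filterS ub => x ub.
rewrite /= lee_fin le_max /patch; case: ifPn => [/set_mem/ub->//|_].
by rewrite normr0 lexx orbT.
Qed.

Theorem theorem1p5 (R : realType) (N : nat) (Omega : set 'rV[R]_(N + N + 1))
    (s p alpha m : R) (f u : 'rV[R]_(N + N + 1) -> R)
    (u_ : nat -> 'rV[R]_(N + N + 1) -> R)
    (Q := @hdim R N) (mu := @leb R (N + N + 1)) :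
  (0 < N)%N ->
  bounded_smooth_domain Omega ->
  0 < s -> s < 1 -> 1 < p -> p < Q -> 0 < alpha ->
  inLp Omega m%:E f ->
  (\forall x \ae mu, Omega x -> 0 <= f x) ->
  ~ (\forall x \ae mu, Omega x -> f x = 0) ->
  (forall n, (0 < n)%N -> approx_solution Omega s p alpha f n (u_ n)) ->
  (forall n, (0 < n)%N -> \forall x \ae mu, u_ n x <= u_ n.+1 x) ->
  (\forall x \ae mu, u_ n x @[n --> \oo] --> u x) ->
  weak_solution Omega s p alpha f u ->
  (1 < m -> m < Q / p ->
     inLp Omega (sobolev_exp Q p * gamma_exp Q p m)%:E u) /\
  (Q / p < m -> inLp Omega +oo%E u).
Proof.
move=> N0 [oO _ _ bO _] _ _ p1 pQ alpha0 [mf fm] _ _ sol ndu cvu.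
move=> [[_ [mu_ _]] _ [u0 _] _ _].
have p0 : 0 < p by exact: lt_trans p1.
have Q0 : 0 < Q by exact: lt_trans pQ.
have mO : measurable Omega := open_measurable_rV oO.
have Ooo : (mu Omega < +oo)%E := leb_bounded bO mO.
have th0 : 0 < p / Q by exact: divr_gt0.
have C0 : 0 <= @level_cst R N p by exact: level_cst_ge0.
(* The extension of [f] by 0 carries the integrability hypothesis on the whole space, and superlevel
   sets lie in [Omega], where it equals [f]. *)
have est (a r : R) : 0 <= a -> 0 < r ->
    ((r `^ p)%:E * mu (superlevel Omega u (a + 2 * r)) <=
     (@level_cst R N p * fine (mu (superlevel Omega u a)) `^ (p / Q))%:E *
     \int[mu]_(x in superlevel Omega u a) `|(f \_ Omega) x|%:E)%E.
  move=> a0 r0.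
  apply: le_trans (level_estimate N0 oO bO p1 alpha0 mf mu_ sol ndu cvu a0 r0) _.
  apply: le_of_eq; congr (_ * _)%E.
  by apply: eq_integral => x /set_mem[Ox _]; rewrite /patch mem_set.
have fL : 1 < m -> Lp mu m (f \_ Omega).
  move=> m1; split; first exact/(measurable_restrictT _ mO).
  by apply/finite_norm_pint => //; exact: lt_trans m1.
have pos : \forall x \ae mu, Omega x -> 0 <= u x by apply: filterS u0.
split => [m1 mQ|mQ].
  have m0 : 0 < m by exact: lt_trans m1.
  have sub : p / Q < m^-1.
    by rewrite -invf_div ltf_pV2 ?posrE// divr_gt0.
  rewrite sobolev_gamma_exp//; split => //.
  apply/finite_norm_pint; first by rewrite divr_gt0// subr_gt0.
  exact: (pint_lty mO Ooo mu_ m1 (fL m1) p0 th0 C0 est sub pos).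
(* Since [p < Q], the hypothesis [Q / p < m] forces [m > 1], so that Hölder with exponent [m] is
   available. *)
have m1 : 1 < m by apply: lt_trans mQ; rewrite ltr_pdivlMr// mul1r.
have m0 : 0 < m by exact: lt_trans m1.
(* The exponent [theta + nu] exceeds 1 exactly when [1/m < p/Q]. *)
have sup : 1 < p / Q + (1 - m^-1).
  rewrite addrCA ltrDl subr_gt0 -[p / Q]invf_div ltf_pV2 ?posrE//.
  by rewrite divr_gt0.
have [b b0] := superlevel_null mO Ooo mu_ m1 (fL m1) p0 th0 C0 est sup.
apply: (inLp_pinfty (b := b)) => //.
have out : \forall x \ae mu, ~ superlevel Omega u b x.
  exists (superlevel Omega u b); split => //; first exact: measurable_superlevel_on.
  by move=> x /= /contrapT.
apply: filterS2 out pos => x out pos Ox; rewrite ger0_norm ?pos// leNgt.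
by apply/negP => bu; exact: out.
Qed.
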